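(* Let $n\ge3$ and $r\in(0,\pi/2)$. Let $B\subset\mathbb S^n_+$ be the centered ball of radius $r$. Then $B$ is neither a minimizer nor a maximizer of the integral $\int_{S^{n-1}} \mathrm{vol}(K\cap\xi^\perp)^n\, d\xi$ in the class of origin-symmetric convex bodies $K\subset\mathbb S^n_+$ with $\mathrm{vol}(K)=\mathrm{vol}(B)$.
   Context: $\mathbb S^n_+$ is the closed upper hemisphere of the unit sphere in $\mathbb R^{n+1}$, with its geodesic distance $\mathrm d$; the origin $o$ is the center (pole) of the hemisphere, and the centered ball of radius $r$ is $\{x:\mathrm d(x,o)\le r\}$. A set $A\subset\mathbb S^n_+$ is convex if it is the intersection of $\mathbb S^n_+$ with a convex cone in $\mathbb R^{n+1}$ with vertex at the origin of $\mathbb R^{n+1}$; a convex body is a closed convex set with nonempty interior. $S^{n-1}$ is the unit sphere in $T_o\mathbb S^n_+$ with its unnormalized surface measure $d\xi$. For $\xi\in S^{n-1}$, $\xi^\perp$ is the totally geodesic hypersurface of $\mathbb S^n_+$ through $o$ with normal $\xi$ at $o$. $\mathrm{vol}$ is the spherical Riemannian volume in the appropriate dimension. $\rho_K(\xi)$ is the supremum of $\mathrm d(x,o)$ over $x\in K$ on the geodesic ray from $o$ in direction $\xi$; $K$ is origin-symmetric if $\rho_K(\xi)=\rho_K(-\xi)$ for all $\xi\in S^{n-1}$. *)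

(* Defs.v *)
From HB Require Import structures.
From mathcomp Require Import all_boot all_order all_algebra.
From mathcomp Require Import all_classical all_reals all_analysis.
From mathcomp Require Import measurable_realfun.

Set Implicit Arguments.
Unset Strict Implicit.
Unset Printing Implicit Defensive.

Import Order.TTheory GRing.Theory Num.Theory.
Import numFieldNormedType.Exports.

Local Open Scope classical_set_scope.
Local Open Scope ring_scope.

Definition rV_display : measure_display.
Proof. exact. Qed.

Section measurable_rV.
Context {R : realType} (m : nat).

Let coord (i : 'I_m) (x : 'rV[R]_m) : measurableTypeR R := x ord0 i.

Let rV_set0 : g_sigma_preimage coord set0.
Proof. exact: sigma_algebra0. Qed.

Let rV_setC A : g_sigma_preimage coord A -> g_sigma_preimage coord (~` A).
Proof. exact: sigma_algebraC. Qed.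

Let rV_bigcup (F : _^nat) : (forall i, g_sigma_preimage coord (F i)) ->
  g_sigma_preimage coord (\bigcup_i (F i)).
Proof. exact: sigma_algebra_bigcup. Qed.

(* The product sigma-algebra on R^m, which is the Borel one. *)
HB.instance Definition _ := @isMeasurable.Build rV_display 'rV[R]_m
  (g_sigma_preimage coord) rV_set0 rV_setC rV_bigcup.

Lemma measurable_coord (i : 'I_m) :
  measurable_fun [set: 'rV[R]_m] (fun x => x ord0 i : measurableTypeR R).
Proof.
move=> _ Y mY; rewrite setTI; apply: sub_sigma_algebra => /=.
rewrite -bigcup_seq/=; exists i => /=; first by rewrite mem_index_enum.
by exists Y => //; rewrite setTI.
Qed.

Lemma measurable_fun_rVP d (T : measurableType d) (f : T -> 'rV[R]_m) :
  measurable_fun [set: T] f <->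
  forall i, measurable_fun [set: T] (fun t => f t ord0 i : measurableTypeR R).
Proof.
split=> [mf i|mf]; first exact: (measurableT_comp (measurable_coord i) mf).
apply: (measurability (\big[setU/set0]_(i < m)
  preimage_set_system setT (coord i) measurable)) => // _ [B + <-].
rewrite -bigcup_seq => -[i /= _ [A mA <-]]; rewrite setTI.
by have := mf i measurableT A mA; rewrite !setTI.
Qed.

End measurable_rV.

Section lebesgue_step.
Context {R : realType} (m : nat).

Definition cons_rV (p : measurableTypeR R * 'rV[R]_m) : 'rV[R]_m.+1 :=
  row_mx (p.1%:M : 'rV_1) p.2.

Lemma measurable_cons_rV : measurable_fun setT cons_rV.
Proof.
apply/measurable_fun_rVP => i.
case: (split_ordP (i : 'I_(1 + m))) => j ->.
  rewrite (_ : (fun t => _) = fst); first exact: measurable_fst.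
  apply/funext => t; rewrite /cons_rV (@row_mxEl _ 1 1 m) mxE.
  by rewrite !ord1 eqxx mulr1n.
rewrite (_ : (fun t => _) = (fun x : 'rV[R]_m => x ord0 j) \o snd).
  exact: (measurableT_comp (measurable_coord j)).
by apply/funext => t; rewrite /cons_rV (@row_mxEr _ 1 1 m).
Qed.

Definition uncons_rV (x : 'rV[R]_m.+1) : measurableTypeR R * 'rV[R]_m :=
  (x ord0 ord0, rsubmx (x : 'rV_(1 + m))).

Lemma cons_rVK : cancel cons_rV uncons_rV.
Proof.
move=> [a v]; rewrite /uncons_rV /cons_rV /= row_mxKr; congr pair.
rewrite (_ : ord0 = lshift m (ord0 : 'I_1)); last exact: val_inj.
by rewrite (@row_mxEl _ 1 1 m) mxE !ord1 eqxx mulr1n.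
Qed.

Lemma measurable_uncons_rV : measurable_fun setT uncons_rV.
Proof.
apply: measurable_fun_pair; first exact: measurable_coord.
apply/measurable_fun_rVP => i.
rewrite (_ : (fun t => _) = fun x : 'rV[R]_m.+1 => x ord0 (rshift 1 i)).
  exact: measurable_coord.
by apply/funext => t; rewrite /rsubmx mxE.
Qed.

Variable mu : {sigma_finite_measure set 'rV[R]_m -> \bar R}.

Definition lebesgue_step : set 'rV[R]_m.+1 -> \bar R :=
  pushforward (lebesgue_measure \x mu)%E cons_rV.

Let image_measure : {measure set 'rV[R]_m.+1 -> \bar R} :=
  measure_function_pushforward__canonical__measure_function_Measure
    (lebesgue_measure \x mu)%E measurable_cons_rV.

HB.instance Definition _ := isMeasure.Build _ _ _ lebesgue_step
  (measure0 image_measure) (measure_ge0 image_measure)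
  (@measure_semi_sigma_additive _ _ _ image_measure).

Let lebesgue_step_sigma_finite : sigma_finite setT lebesgue_step.
Proof.
have /sigma_finiteP[F [TF ndF Foo]] := sigma_finiteT (@lebesgue_measure R).
have /sigma_finiteP[G [TG ndG Goo]] := sigma_finiteT mu.
exists (fun k => uncons_rV @^-1` (F k `*` G k)).
  rewrite -preimage_bigcup predeqE => x; split => // _.
  have [/= i _ Fi] : (\bigcup_k F k) (uncons_rV x).1 by rewrite -TF.
  have [/= j _ Gj] : (\bigcup_k G k) (uncons_rV x).2 by rewrite -TG.
  exists (maxn i j) => //; split.
  - by move: Fi; exact/subsetPset/ndF/leq_maxl.
  - by move: Gj; exact/subsetPset/ndG/leq_maxr.
move=> k; have [? ?] := Foo k; have [? ?] := Goo k; split.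
  rewrite -[X in measurable X]setTI; apply: measurable_uncons_rV => //.
  exact: measurableX.
rewrite /lebesgue_step /pushforward -comp_preimage.
rewrite (_ : _ \o _ = id) ?preimage_id; last exact/funext/cons_rVK.
by rewrite product_measure1E// lte_mul_pinfty// ge0_fin_numE.
Qed.

HB.instance Definition _ := Measure_isSigmaFinite.Build _ _ _ lebesgue_step
  lebesgue_step_sigma_finite.

End lebesgue_step.

Fixpoint lebesgue_rV {R : realType} (m : nat) :
    {sigma_finite_measure set 'rV[R]_m -> \bar R} :=
  match m with
  | 0 => \d_(0 : 'rV[R]_0)
  | m'.+1 => lebesgue_step (lebesgue_rV m')
  end.

Section euclidean.
Context {R : realType} (m : nat).
Implicit Types x y : 'rV[R]_m.

Definition dotp x y : R := (x *m y^T) ord0 ord0.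

(* The norm `|x| of the library is the sup norm. *)
Definition enorm x : R := Num.sqrt (dotp x x).

Definition usphere : set 'rV[R]_m := [set x | enorm x = 1].

Definition normalize x : 'rV[R]_m := (enorm x)^-1 *: x.

Definition punctured_ball : set 'rV[R]_m := [set x | 0 < enorm x <= 1].

Lemma measurable_enorm : measurable_fun [set: 'rV[R]_m] enorm.
Proof.
apply: measurableT_comp.
  apply: continuous_measurable_fun; exact: sqrt_continuous.
rewrite (_ : (fun x => _) = fun x => \sum_i x ord0 i * x ord0 i).
  by apply: measurable_sum => i; apply: measurable_funM; exact: measurable_coord.
by apply/funext => x; rewrite /dotp mxE; apply: eq_bigr => i _; rewrite mxE.
Qed.

Lemma measurable_punctured_ball : measurable punctured_ball.
Proof.
rewrite (_ : punctured_ball = enorm @^-1` `]0, 1]).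
  by rewrite -[X in measurable X]setTI; exact: measurable_enorm.
by apply/seteqP; split => x /=; rewrite in_itv.
Qed.

Lemma measurable_normalize : measurable_fun setT normalize.
Proof.
apply/measurable_fun_rVP => i.
rewrite (_ : (fun t => _) = fun x => (enorm x `^ (-1)) * x ord0 i).
  apply: measurable_funM; last exact: measurable_coord.
  apply: (measurableT_comp (measurable_powR (-1))); exact: measurable_enorm.
apply/funext => x; rewrite /normalize mxE powR_inv1//; exact: sqrtr_ge0.
Qed.

(* The unnormalized surface measure of the unit sphere of R^m, i.e. its
   (m-1)-dimensional Riemannian volume: by polar coordinates,
   lambda {t x | x in A, 0 < t <= 1} = sigma(A) / m for A in the sphere. *)
Definition sphere_measure : set 'rV[R]_m -> \bar R := fun A =>
  (m%:R%:E * lebesgue_rV m (normalize @^-1` A `&` punctured_ball))%E.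

Let image_measure : {measure set 'rV[R]_m -> \bar R} :=
  mscale (m%:R)%:nng
   (measure_function_pushforward__canonical__measure_function_Measure
    (mrestr (lebesgue_rV m) measurable_punctured_ball) measurable_normalize).

HB.instance Definition _ := isMeasure.Build _ _ _ sphere_measure
  (measure0 image_measure) (measure_ge0 image_measure)
  (@measure_semi_sigma_additive _ _ _ image_measure).

End euclidean.

Arguments usphere {R m}.
Arguments sphere_measure {R m}.

Section hemisphere.
Context {R : realType} (n : nat).
Implicit Types (x y : 'rV[R]_(1 + n)) (xi : 'rV[R]_n).

(* In R^(1+n) = R x R^n the pole is (1, 0), and a vector xi of R^n stands for
   the tangent vector (0, xi) at the pole. *)
Definition pole : 'rV[R]_(1 + n) := row_mx 1%:M 0.

Definition tangent xi : 'rV[R]_(1 + n) := row_mx 0 xi.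

Definition hemisphere : set 'rV[R]_(1 + n) :=
  [set x | usphere x /\ 0 <= dotp x pole].

Definition gdist x y : R := acos (dotp x y).

Definition centered_ball (r : R) : set 'rV[R]_(1 + n) :=
  [set x | hemisphere x /\ gdist x pole <= r].

Definition convex_cone (C : set 'rV[R]_(1 + n)) : Prop :=
  convex_set (C : set (convex_lmodType 'rV[R]_(1 + n))) /\
  forall (t : R) x, 0 < t -> C x -> C (t *: x).

Definition sconvex (A : set 'rV[R]_(1 + n)) : Prop :=
  exists2 C, convex_cone C & A = hemisphere `&` C.

Definition convex_body (K : set 'rV[R]_(1 + n)) : Prop :=
  [/\ closed K, sconvex K &
      exists x e, [/\ hemisphere x, 0 < e &
        forall y, hemisphere y -> gdist x y < e -> K y]].

Definition geodesic_ray xi : set 'rV[R]_(1 + n) :=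
  [set cos t *: pole + sin t *: tangent xi | t in `[0, pi / 2]].

(* Pitfall: sup set0 = 0. *)
Definition radial (K : set 'rV[R]_(1 + n)) xi : R :=
  sup [set gdist x pole | x in K `&` geodesic_ray xi].

Definition origin_symmetric (K : set 'rV[R]_(1 + n)) : Prop :=
  forall xi, usphere xi -> radial K xi = radial K (- xi).

Definition perp xi : set 'rV[R]_(1 + n) :=
  [set x | hemisphere x /\ dotp x (tangent xi) = 0].

Definition vol (A : set 'rV[R]_(1 + n)) : \bar R := sphere_measure A.

(* The rows of Q form an orthonormal basis of the hyperplane of R^(1+n)
   orthogonal to (0, xi), so that u |-> u *m Q is a linear isometry of R^n onto
   that hyperplane, mapping the unit sphere of R^n onto the great subsphere
   containing perp xi. *)
Definition is_frame xi (Q : 'M[R]_(n, 1 + n)) : Prop :=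
  Q *m Q^T = 1%:M /\ tangent xi *m Q^T = 0.

(* The (n-1)-dimensional volume of a subset of perp xi; by rotation invariance
   of sphere_measure, it does not depend on the frame. *)
Definition vol_perp xi (A : set 'rV[R]_(1 + n)) : \bar R :=
  sphere_measure [set u : 'rV[R]_n | A (u *m get (is_frame xi))].

Definition section_integral (K : set 'rV[R]_(1 + n)) : \bar R :=
  (\int[sphere_measure]_(xi in usphere) vol_perp xi (K `&` perp xi) ^+ n)%E.

End hemisphere.

(* Main.v *)
From HB Require Import structures.
Require Import Defs.
From mathcomp Require Import all_boot all_order all_algebra.
From mathcomp Require Import all_classical all_reals all_analysis.
From mathcomp Require Import measurable_realfun ring lra.

Set Implicit Arguments.
Unset Strict Implicit.
Unset Printing Implicit Defensive.

Import Order.TTheory GRing.Theory Num.Theory.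
Import numFieldNormedType.Exports.

Local Open Scope classical_set_scope.
Local Open Scope ring_scope.

(** The competitors are hemispherical sections of quadratic cones around the
pole o. Write a point of the sphere as (x_0, y), and let w be the square of the
slope x_0 / |y| of the cone bounding a body K, as a function of the direction
y / |y|. If w depends only on the square of one coordinate of that direction,
then K is rotationally symmetric, and both functionals become means in one real variable
t in [0, 1], the squared coordinate of a uniform unit vector:
  vol K            = const * E (H (w t)),
  section_integral = const * E (S t ^ n),
where H and J ([conecap]) are the areas of caps of the spheres of dimensions n
and n - 1 bounded by a round cone, and S t is the mean of J o w over the
subsphere orthogonal to a vector xi with xi_0 ^ 2 = t ([slice_mean]).
Averaging over subspheres does not change the mean: E S = E (J o w)
([sqmean_slice_mean]). For the ball, w is a constant w0.

Fix E (H o w) = H w0. Near w0, J is strictly concave as a function of H, so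
E S - J w0 is negative and of the order of the variance of w ([deficit_ge],
[deficit_le]). On the other hand E (S ^ n) exceeds (E S) ^ n by an amount of the
order of the variance of S, since x ^ n is convex. Neither effect wins always.

For an ellipsoid w t = A + eps t with small eps, both effects are of order
eps ^ 2, and comparing the two constants amounts to the inequality
(n - 1) c J < s ^ (n - 1) between the height c of the boundary of the ball, its
distance s to the axis and J ([cap_area_lt]); so the second effect wins and
the ball is not a maximizer ([ellipsoid_larger]).

For a ball from which two small opposite caps of angular radius theta are cut
off, w differs from a constant A by an amount of order theta ^ 2 on a set of
measure of order theta ^ (n - 1), so the first effect is at least of order
theta ^ (n + 3). Each single section loses at most an amount of order
theta ^ n, and on average theta ^ (n + 1), so the variance of S is at most of
order theta ^ (2 n + 1). As n + 3 < 2 n + 1 for n >= 3, the first effect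
wins and the ball is not a minimizer ([cut_ball_smaller]).

In the lemmas n = q.+3, so H is [conecap q.+3], J is [conecap q.+2], and means
over xi are [sqmean q.+2]. *)

(** * Lebesgue measure under affine maps *)

Definition image_measure d1 d2 (T1 : measurableType d1) (T2 : measurableType d2)
    (R : realType) (mu : {measure set T1 -> \bar R}) (f : T1 -> T2)
    (mf : measurable_fun setT f) : {measure set T2 -> \bar R} :=
  measure_function_pushforward__canonical__measure_function_Measure mu mf.

Lemma measurable_preimage d1 d2 (T1 : measurableType d1) (T2 : measurableType d2)
    (f : T1 -> T2) (A : set T2) :
  measurable_fun setT f -> measurable A -> measurable (f @^-1` A).
Proof. by move=> mf mA; rewrite -[X in measurable X]setTI; exact: mf. Qed.

Section affine.
Context {R : realType}.
Local Notation leb := (@lebesgue_measure R).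

(** Both sides are measures in A that agree on half-open intervals. *)
Lemma lebesgue_affine (r a : R) (A : set (measurableTypeR R)) :
  r != 0 -> measurable A ->
  (`|r|%:E * leb ((fun x : R => (r * x + a)%R) @^-1` A) = leb A)%E.
Proof.
move=> r0 mA.
have mf : measurable_fun setT (fun x : measurableTypeR R => r * x + a : measurableTypeR R).
  apply: measurable_funD => //; exact: measurable_funM.
apply/esym/(@lebesgue_measure_unique _ (mscale (`|r|%:nng) (image_measure leb mf))) => //.
move=> _ [[u v] /= uv <-].
rewrite /mscale /= /pushforward.
have [rp|rn|r00] := ltgtP 0 r; last by rewrite -r00 eqxx in r0.
- have -> : (fun x => r * x + a) @^-1` `]u, v] = `](u - a) / r, (v - a) / r]%classic.
    apply/seteqP; split => x /=; rewrite !in_itv /= ltr_pdivrMr// ler_pdivlMr//.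
      by move=> /andP[? ?]; apply/andP; split; lra.
    by move=> /andP[? ?]; apply/andP; split; lra.
  rewrite !lebesgue_measure_itv /= !lte_fin ltr_pM2r ?invr_gt0// ltrD2r.
  case: ifPn => _; last by rewrite mule0.
  by rewrite -!EFinD -EFinM gtr0_norm//; congr EFin; field.
- have -> : (fun x => r * x + a) @^-1` `]u, v] = `[(v - a) / r, (u - a) / r[%classic.
    apply/seteqP; split => x /=; rewrite !in_itv /= ltr_ndivlMr// ler_ndivrMr//.
      by move=> /andP[? ?]; apply/andP; split; lra.
    by move=> /andP[? ?]; apply/andP; split; lra.
  rewrite !lebesgue_measure_itv /= !lte_fin ltr_nM2r ?invr_lt0// ltrD2r.
  case: ifPn => _; last by rewrite mule0.
  by rewrite -!EFinD -EFinM ltr0_norm//; congr EFin; field.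
Qed.

Lemma measurable_affine_rV m (r : R) (a : 'rV[R]_m) :
  measurable_fun [set: 'rV[R]_m] (fun x : 'rV[R]_m => r *: x + a).
Proof.
apply/measurable_fun_rVP => i.
rewrite (_ : (fun t => _) = (fun x : 'rV[R]_m => r * x ord0 i + a ord0 i)); last first.
  by apply/funext => x; rewrite !mxE.
by apply: measurable_funD => //; apply: measurable_funM => //; exact: measurable_coord.
Qed.

Lemma cons_rV0 m (t : R) (y : 'rV[R]_m) : cons_rV (t, y) ord0 ord0 = t.
Proof. by have := cons_rVK (t, y) => /(congr1 fst). Qed.

Lemma cons_rVl m (t : R) (y : 'rV[R]_m) (j : 'I_1) : cons_rV (t, y) ord0 (lshift m j) = t.
Proof. by rewrite (_ : lshift m j = ord0) ?cons_rV0//; apply: val_inj; rewrite /= ord1. Qed.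

Lemma cons_rVS m (t : R) (y : 'rV[R]_m) i : cons_rV (t, y) ord0 (rshift 1 i) = y ord0 i.
Proof. by rewrite /cons_rV (@row_mxEr _ 1 1 m). Qed.

Lemma uncons_rVK m : cancel (@uncons_rV R m) (@cons_rV R m).
Proof.
move=> x; apply/rowP => i; case: (split_ordP (i : 'I_(1 + m))) => j ->.
  have -> : lshift m j = ord0 by apply: val_inj; rewrite /= ord1.
  by rewrite cons_rV0.
by rewrite cons_rVS mxE.
Qed.

Lemma lebesgue_rVS m (A : set 'rV[R]_m.+1) :
  lebesgue_rV m.+1 A = (leb \x lebesgue_rV m)%E (@cons_rV R m @^-1` A).
Proof. by []. Qed.

(** By induction on the dimension: a product measure is determined by its values on
rectangles, and an affine map of this form sends rectangles to rectangles. *)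
Lemma lebesgue_rV_affine m (r : R) (a : 'rV[R]_m) (A : set 'rV[R]_m) :
  r != 0 -> measurable A ->
  ((`|r| ^+ m)%:E * lebesgue_rV m ((fun x => (r *: x + a)%R) @^-1` A) = lebesgue_rV m A)%E.
Proof.
move=> r0; elim: m a A => [|m IH] a A mA.
  rewrite expr0 mul1e /=; congr (lebesgue_rV 0 _); apply/seteqP.
  by split => x /=; rewrite [r *: x + a]thinmx0 [x]thinmx0.
rewrite !lebesgue_rVS.
pose a0 := (uncons_rV a).1; pose a' := (uncons_rV a).2.
pose g (p : measurableTypeR R * 'rV[R]_m) : measurableTypeR R * 'rV[R]_m :=
  (r * p.1 + a0, r *: p.2 + a').
have mg : measurable_fun setT g.
  apply: measurable_fun_pair.
    apply: (measurableT_comp (f := fun x : measurableTypeR R => r * x + a0)) => //.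
    by apply: measurable_funD => //; exact: measurable_funM.
  exact: (measurableT_comp (measurable_affine_rV r a')).
have -> : cons_rV (m:=m) @^-1` ((fun x : 'rV_m.+1 => r *: x + a) @^-1` A) =
          g @^-1` (cons_rV (m:=m) @^-1` A).
  have gE t y : r *: cons_rV (t, y) + a = cons_rV (g (t, y)).
    rewrite -[in LHS](uncons_rVK a); apply/rowP => i.
    have lin p (u v : 'rV[R]_p) j : (r *: u + v) ord0 j = r * u ord0 j + v ord0 j.
      by rewrite !mxE.
    rewrite lin; case: (split_ordP (i : 'I_(1 + m))) => j ->; first by rewrite !cons_rVl.
    by rewrite !cons_rVS lin.
  by apply/seteqP; split => -[t y]; rewrite /= gE.
have mA' : measurable (cons_rV (m:=m) @^-1` A).
  exact: (measurable_preimage (@measurable_cons_rV _ _)).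
pose mu' : {measure set _ -> \bar R} := mscale (NngNum (exprn_ge0 m.+1 (normr_ge0 r))) (image_measure (leb \x lebesgue_rV m)%E mg).
apply/esym/(@product_measure_unique _ _ _ _ _ leb (lebesgue_rV m) mu') => // X Y mX mY.
transitivity ((`|r| ^+ m.+1)%:E * (leb \x lebesgue_rV m)
  (((fun x => (r * x + a0)%R) @^-1` X) `*` ((fun x => (r *: x + a')%R) @^-1` Y)))%E => //.
rewrite product_measure1E//; last 2 first.
- apply: (measurable_preimage (f := fun x : measurableTypeR R => r * x + a0 : measurableTypeR R)) => //.
  by apply: measurable_funD => //; exact: measurable_funM.
- exact: (measurable_preimage (@measurable_affine_rV m r a')).
transitivity (lebesgue_measure X * lebesgue_rV m Y)%E => //.
rewrite -(lebesgue_affine a0 r0 mX) -(IH a' Y mY).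
by rewrite exprS EFinM -!muleA; congr (_ * _)%E; rewrite !muleA; congr (_ * _)%E; rewrite muleC.
Qed.

Lemma lebesgue_rV_rect m (A : set (measurableTypeR R)) (B : set 'rV[R]_m) :
  measurable A -> measurable B ->
  (leb \x lebesgue_rV m)%E (A `*` B) = (lebesgue_measure A * lebesgue_rV m B)%E.
Proof. by move=> mA mB; rewrite product_measure1E. Qed.

End affine.

(** * Rotation invariance of Lebesgue measure *)

Section euclid.
Context {R : realType}.

Lemma dotpE m (x y : 'rV[R]_m) : dotp x y = \sum_i x ord0 i * y ord0 i.
Proof. by rewrite /dotp mxE; apply: eq_bigr => i _; rewrite mxE. Qed.

Lemma scale_rVE m a (x : 'rV[R]_m) i : (a *: x) ord0 i = a * x ord0 i.
Proof. by rewrite mxE. Qed.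

Lemma dotp_ge0 m (x : 'rV[R]_m) : 0 <= dotp x x.
Proof. by rewrite dotpE; apply: sumr_ge0 => i _; rewrite -expr2 sqr_ge0. Qed.

Lemma dotpC m (x y : 'rV[R]_m) : dotp x y = dotp y x.
Proof. by rewrite !dotpE; apply: eq_bigr => i _; rewrite mulrC. Qed.

Lemma dotpDl m (x y z : 'rV[R]_m) : dotp (x + y) z = dotp x z + dotp y z.
Proof. by rewrite /dotp mulmxDl mxE. Qed.

Lemma dotpZl m a (x z : 'rV[R]_m) : dotp (a *: x) z = a * dotp x z.
Proof. by rewrite /dotp -scalemxAl mxE. Qed.

Lemma dotpDr m (x y z : 'rV[R]_m) : dotp z (x + y) = dotp z x + dotp z y.
Proof. by rewrite dotpC dotpDl !(dotpC z). Qed.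

Lemma dotpZr m a (x z : 'rV[R]_m) : dotp z (a *: x) = a * dotp z x.
Proof. by rewrite dotpC dotpZl dotpC. Qed.

Lemma enorm_ge0 m (x : 'rV[R]_m) : 0 <= enorm x.
Proof. exact: sqrtr_ge0. Qed.

Lemma enorm_sqr m (x : 'rV[R]_m) : enorm x ^+ 2 = dotp x x.
Proof. by rewrite sqr_sqrtr// dotp_ge0. Qed.

Lemma enormZ m r (x : 'rV[R]_m) : enorm (r *: x) = `|r| * enorm x.
Proof.
by rewrite /enorm dotpZl dotpZr mulrA -expr2 sqrtrM ?sqr_ge0// sqrtr_sqr.
Qed.

Lemma enorm0 m : enorm (0 : 'rV[R]_m) = 0.
Proof. by rewrite -(scale0r 0) enormZ normr0 mul0r. Qed.

Lemma coord_le_enorm m (x : 'rV[R]_m) i : x ord0 i ^+ 2 <= enorm x ^+ 2.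
Proof.
rewrite enorm_sqr dotpE (bigD1 i)//= -expr2 lerDl.
by apply: sumr_ge0 => j _; rewrite -expr2 sqr_ge0.
Qed.

Lemma enorm_eq0 m (x : 'rV[R]_m) : (enorm x == 0) = (x == 0).
Proof.
apply/eqP/eqP => [x0|->]; last exact: enorm0.
apply/rowP => i; apply/eqP; rewrite mxE -sqrf_eq0 eq_le sqr_ge0 andbT.
by rewrite (le_trans (coord_le_enorm x i))// x0 expr0n.
Qed.

Lemma enorm_gt0 m (x : 'rV[R]_m) : (0 < enorm x) = (x != 0).
Proof. by rewrite lt_def enorm_ge0 andbT enorm_eq0. Qed.

Lemma dotp_mulmx m p (x y : 'rV[R]_m) (Q : 'M[R]_(m, p)) : Q *m Q^T = 1%:M ->
  dotp (x *m Q) (y *m Q) = dotp x y.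
Proof. by move=> QQ; rewrite /dotp trmx_mul mulmxA -(mulmxA x) QQ mulmx1. Qed.

Lemma enorm_mulmx m p (x : 'rV[R]_m) (Q : 'M[R]_(m, p)) : Q *m Q^T = 1%:M ->
  enorm (x *m Q) = enorm x.
Proof. by move=> QQ; rewrite /enorm dotp_mulmx. Qed.

Lemma dotp_cons m (t u : R) (y z : 'rV[R]_m) :
  dotp (cons_rV (t, y)) (cons_rV (u, z)) = t * u + dotp y z.
Proof.
rewrite dotpE big_ord_recl !cons_rV0 dotpE; congr (_ + _).
apply: eq_bigr => i _.
by rewrite (_ : lift ord0 i = rshift 1 i) ?cons_rVS//; exact: val_inj.
Qed.

Lemma enorm_cons m (t : R) (y : 'rV[R]_m) :
  enorm (cons_rV (t, y)) ^+ 2 = t ^+ 2 + enorm y ^+ 2.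
Proof. by rewrite !enorm_sqr dotp_cons expr2. Qed.

Lemma measurable_mulmxr m p (Q : 'M[R]_(m, p)) :
  measurable_fun [set: 'rV[R]_m] (fun x : 'rV[R]_m => x *m Q).
Proof.
apply/measurable_fun_rVP => i.
rewrite (_ : (fun t => _) = (fun x : 'rV[R]_m => \sum_j x ord0 j * Q j i)); last first.
  by apply/funext => x; rewrite mxE.
apply: measurable_sum => j; apply: measurable_funM => //; exact: measurable_coord.
Qed.

Definition cball m (r : R) : set 'rV[R]_m := [set x | enorm x <= r].

Lemma measurable_cball m r : measurable (@cball m r).
Proof.
rewrite (_ : cball r = (@enorm R m : 'rV[R]_m -> measurableTypeR R) @^-1` `]-oo, r]).
  apply: (measurable_preimage (@measurable_enorm R m)) => //.
by apply/seteqP; split => x; rewrite /= in_itv.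
Qed.

Lemma lebesgue_rV_linear m (r : R) (A : set 'rV[R]_m) : r != 0 -> measurable A ->
  ((`|r| ^+ m)%:E * lebesgue_rV m ((fun x => (r *: x)%R) @^-1` A) = lebesgue_rV m A)%E.
Proof.
move=> r0 mA; rewrite -[RHS](@lebesgue_rV_affine R m r 0)//; do 2 congr (_ _ _)%E.
by apply/seteqP; split => x /=; rewrite addr0.
Qed.

Lemma lebesgue_rV_translate m (a : 'rV[R]_m) (A : set 'rV[R]_m) : measurable A ->
  lebesgue_rV m ((fun x => x + a) @^-1` A) = lebesgue_rV m A.
Proof.
move=> mA; rewrite -[RHS](@lebesgue_rV_affine R m 1 a)// normr1 expr1n mul1e.
by congr (lebesgue_rV m _); apply/seteqP; split => x /=; rewrite scale1r.
Qed.

Lemma lebesgue_rV_reflect m (a : 'rV[R]_m) (A : set 'rV[R]_m) : measurable A ->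
  lebesgue_rV m ((fun x => a - x) @^-1` A) = lebesgue_rV m A.
Proof.
move=> mA; rewrite -[RHS](@lebesgue_rV_affine R m (-1) a)// ?oppr_eq0 ?oner_eq0//.
rewrite normrN normr1 expr1n mul1e.
by congr (lebesgue_rV m _); apply/seteqP; split => x /=; rewrite scaleN1r addrC.
Qed.

Lemma lebesgue_cball_scale m (r : R) : 0 < r ->
  lebesgue_rV m (cball r) = ((r ^+ m)%:E * lebesgue_rV m (cball 1))%E.
Proof.
move=> r0; rewrite -(@lebesgue_rV_linear m r^-1 (cball 1)) ?invr_neq0 ?gt_eqF//; last first.
  exact: measurable_cball.
rewrite muleA -EFinM normfV gtr0_norm// -exprMn divff ?gt_eqF// expr1n mul1e.
congr (lebesgue_rV m _); apply/seteqP; split => x /=; rewrite /cball /= enormZ.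
  by rewrite gtr0_norm ?invr_gt0// ler_pdivrMl// mulr1.
by rewrite gtr0_norm ?invr_gt0// ler_pdivrMl// mulr1.
Qed.

Lemma lebesgue_cball_fin m : (lebesgue_rV m (cball 1) < +oo)%E.
Proof.
elim: m => [|m IH]; first by rewrite /= diracE ltry.
rewrite lebesgue_rVS.
apply: (@le_lt_trans _ _ ((@lebesgue_measure R \x lebesgue_rV m)%E (`[(-1)%R, 1%R]%classic `*` cball 1))).
  apply: le_measure; rewrite ?inE.
  - exact: (measurable_preimage (@measurable_cons_rV _ _) (@measurable_cball _ _)).
  - by apply: measurableX => //; exact: measurable_cball.
  - move=> [t y]; rewrite /cball /= => ty1; rewrite in_itv /=.
    have : t ^+ 2 + enorm y ^+ 2 <= 1.
      by rewrite -enorm_cons expr_le1// enorm_ge0.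
    have := sqr_ge0 t; have := sqr_ge0 (enorm y); have := enorm_ge0 y => h1 h2 h3 h4.
    split; last by rewrite -(@expr_le1 _ 2)//; lra.
    by rewrite -ler_norml -(@expr_le1 _ 2)// real_normK ?num_real//; lra.
rewrite lebesgue_rV_rect//; last exact: measurable_cball.
rewrite lte_mul_pinfty//; first by rewrite lebesgue_measure_itv /=; case: ifP.
Qed.

Lemma lebesgue_cball_gt0 m : (0 < lebesgue_rV m (cball 1))%E.
Proof.
elim: m => [|m IH]; first by rewrite /= diracE mem_set ?lte_fin//= /cball /= enorm0.
rewrite lebesgue_rVS.
apply: (@lt_le_trans _ _ ((@lebesgue_measure R \x lebesgue_rV m)%E (`[0%R, (2^-1)%R]%classic `*` cball (2^-1)))).
  rewrite lebesgue_rV_rect//; last exact: measurable_cball.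
  rewrite lebesgue_cball_scale ?invr_gt0//; apply: mule_gt0.
    by rewrite lebesgue_measure_itv /= lte_fin invr_gt0 ltr0n oppr0 adde0 lte_fin invr_gt0.
  by rewrite mule_gt0// lte_fin exprn_gt0// invr_gt0.
apply: le_measure; rewrite ?inE.
- by apply: measurableX => //; exact: measurable_cball.
- exact: (measurable_preimage (@measurable_cons_rV _ _) (@measurable_cball _ _)).
- move=> [t y] /=; rewrite /cball in_itv /= => -[/andP[t0 t1] y1].
  rewrite -(@expr_le1 _ 2)// ?enorm_ge0// enorm_cons.
  have := enorm_ge0 y; nra.
Qed.

Lemma fubini_sets d1 d2 (T1 : measurableType d1) (T2 : measurableType d2)
  (m1 : {sigma_finite_measure set T1 -> \bar R})
  (m2 : {sigma_finite_measure set T2 -> \bar R}) (S : set (T1 * T2)) : measurable S ->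
  (\int[m1]_x m2 (xsection S x) = \int[m2]_y m1 (ysection S y))%E.
Proof.
move=> mS; have := @indic_fubini_tonelli _ _ _ _ _ m1 m2 S mS.
by rewrite indic_fubini_tonelli_FE// indic_fubini_tonelli_GE.
Qed.

Lemma mule_cancelr (r : R) (a b : \bar R) : r != 0 ->
  (a * r%:E = b * r%:E -> a = b)%E.
Proof.
move=> r0 /(congr1 (fun z => (z * r^-1%:E)%E)).
by rewrite -!muleA -EFinM divff// !mule1.
Qed.

Lemma orthogonal_inv m (Q : 'M[R]_m) : Q *m Q^T = 1%:M -> Q^T *m Q = 1%:M.
Proof. exact: mulmx1C. Qed.

(** A rotation does not preserve rectangles, so the uniqueness of product measures is
of no direct use. Let B be the unit ball, which is invariant under Q. The sets
  S = {(x, y) | x Q in A, y + x Q in B}, S' = {(x, y) | x Q - y in A, x Q in B}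
have sections at fixed y that are translates of each other, hence equal volumes;
the sections at fixed x show that these volumes are |Q^-1 A| |B| and |A| |Q^-1 B|. *)
Lemma lebesgue_rV_rotate m (Q : 'M[R]_m) (A : set 'rV[R]_m) :
  Q *m Q^T = 1%:M -> measurable A ->
  lebesgue_rV m [set x | A (x *m Q)] = lebesgue_rV m A.
Proof.
move=> QQ mA; have QQ' := orthogonal_inv QQ.
pose B := @cball m 1; have mB : measurable B := measurable_cball _.
have mAQ : measurable [set x : 'rV[R]_m | A (x *m Q)].
  exact: (measurable_preimage (measurable_mulmxr Q)).
have mBQ : measurable [set x : 'rV[R]_m | B (x *m Q)].
  exact: (measurable_preimage (measurable_mulmxr Q)).
have mQ1 : measurable_fun setT (fun p : 'rV[R]_m * 'rV[R]_m => p.1 *m Q).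
  exact: (measurableT_comp (measurable_mulmxr Q) measurable_fst).
have mQ2 : measurable_fun setT (fun p : 'rV[R]_m * 'rV[R]_m => p.2 + p.1 *m Q).
  apply/measurable_fun_rVP => i.
  rewrite (_ : (fun t => _) = (fun p : 'rV[R]_m * 'rV[R]_m => p.2 ord0 i + (p.1 *m Q) ord0 i)).
    apply: measurable_funD.
      exact: (measurableT_comp (measurable_coord i) measurable_snd).
    exact: (measurableT_comp (measurable_coord i) mQ1).
  by apply/funext => p; rewrite mxE.
have mQ3 : measurable_fun setT (fun p : 'rV[R]_m * 'rV[R]_m => p.1 *m Q - p.2).
  apply/measurable_fun_rVP => i.
  rewrite (_ : (fun t => _) = (fun p : 'rV[R]_m * 'rV[R]_m => (p.1 *m Q) ord0 i - p.2 ord0 i)).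
    apply: measurable_funB.
      exact: (measurableT_comp (measurable_coord i) mQ1).
    exact: (measurableT_comp (measurable_coord i) measurable_snd).
  by apply/funext => p; rewrite !mxE.
pose S := [set p : 'rV[R]_m * 'rV[R]_m | A (p.1 *m Q) /\ B (p.2 + p.1 *m Q)].
pose S' := [set p : 'rV[R]_m * 'rV[R]_m | A (p.1 *m Q - p.2) /\ B (p.1 *m Q)].
have mS : measurable S by apply: measurableI; exact: measurable_preimage.
have mS' : measurable S' by apply: measurableI; exact: measurable_preimage.
have indE (C : set 'rV[R]_m) : measurable C ->
    (lebesgue_rV m C = \int[lebesgue_rV m]_x (\1_C x)%:E)%E.
  by move=> mC; rewrite integral_indic// setIT.
have E1 : (\int[lebesgue_rV m]_x lebesgue_rV m (xsection S x) =
    lebesgue_rV m [set x | A (x *m Q)] * lebesgue_rV m B)%E.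
  rewrite muleC (indE _ mAQ) -ge0_integralZl//; last by apply/measurable_EFinP; exact: measurable_indic.
  apply: eq_integral => x _; rewrite indicE.
  case: (asboolP (A (x *m Q))) => Ax.
    rewrite mem_set// mule1 -(lebesgue_rV_translate (x *m Q) mB); congr (lebesgue_rV m _).
    by apply/seteqP; split => y; rewrite /xsection /= inE /S /=; [case|].
  rewrite memNset// mule0 (_ : xsection _ _ = set0) ?measure0//.
  by apply/seteqP; split => y //; rewrite /xsection /= inE /S /= => -[].
have E2 : (\int[lebesgue_rV m]_x lebesgue_rV m (xsection S' x) =
    lebesgue_rV m A * lebesgue_rV m [set x | B (x *m Q)])%E.
  rewrite (indE _ mBQ) -ge0_integralZl//; last by apply/measurable_EFinP; exact: measurable_indic.
  apply: eq_integral => x _; rewrite indicE.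
  case: (asboolP (B (x *m Q))) => Bx.
    rewrite mem_set// mule1 -(lebesgue_rV_reflect (x *m Q) mA); congr (lebesgue_rV m _).
    by apply/seteqP; split => y; rewrite /xsection /= inE /S' /=; [case|].
  rewrite memNset// mule0 (_ : xsection _ _ = set0) ?measure0//.
  by apply/seteqP; split => y //; rewrite /xsection /= inE /S' /= => -[].
have : (\int[lebesgue_rV m]_x lebesgue_rV m (xsection S x) =
        \int[lebesgue_rV m]_x lebesgue_rV m (xsection S' x))%E.
  pose mu := @lebesgue_rV R m.
  have F := @fubini_sets _ _ _ _ mu mu S mS; have F' := @fubini_sets _ _ _ _ mu mu S' mS'.
  rewrite F F'.
  apply: eq_integral => y _.
  rewrite -(lebesgue_rV_translate (- (y *m Q^T)) (A := ysection S y)); last exact: measurable_ysection.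
  congr (lebesgue_rV m _); apply/seteqP; split => x;
    by rewrite /ysection /= !inE /S /S' /= mulmxDl mulNmx -mulmxA QQ' mulmx1 (addrC y) subrK.
rewrite E1 E2 (_ : [set x | B (x *m Q)] = B); last first.
  by apply/seteqP; split => x; rewrite /B /cball /= enorm_mulmx.
rewrite -(@fineK _ (lebesgue_rV m B)); last by rewrite ge0_fin_numE// lebesgue_cball_fin.
by apply: mule_cancelr; rewrite gt_eqF// fine_gt0// lebesgue_cball_gt0 lebesgue_cball_fin.
Qed.

End euclid.

(** * Polar coordinates *)

Section polar.
Context {R : realType}.
Local Notation leb := (@lebesgue_measure R).

Lemma normalizeZ m (t : R) (x : 'rV[R]_m) : 0 < t -> normalize (t *: x) = normalize x.
Proof.
move=> t0; rewrite /normalize enormZ gtr0_norm// scalerA invfM mulrAC mulVf ?mul1r//.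
by rewrite gt_eqF.
Qed.

Lemma normalize_mulmx m (x : 'rV[R]_m) (Q : 'M[R]_m) : Q *m Q^T = 1%:M ->
  normalize (x *m Q) = normalize x *m Q.
Proof. by move=> QQ; rewrite /normalize enorm_mulmx// scalemxAl. Qed.

Lemma enorm_normalize m (x : 'rV[R]_m) : x != 0 -> enorm (normalize x) = 1.
Proof.
by move=> x0; rewrite /normalize enormZ ger0_norm ?invr_ge0 ?enorm_ge0// mulVf// enorm_eq0.
Qed.

Definition solid_sector m (A : set 'rV[R]_m) : set 'rV[R]_m :=
  (@normalize R m) @^-1` A `&` @punctured_ball R m.

Lemma measurable_solid_sector m (A : set 'rV[R]_m) : measurable A ->
  measurable (solid_sector A).
Proof.
move=> mA; apply: measurableI; last exact: (@measurable_punctured_ball R m).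
exact: (measurable_preimage (@measurable_normalize R m)).
Qed.

Lemma sphere_measureE m (A : set 'rV[R]_m) :
  sphere_measure A = (m%:R%:E * lebesgue_rV m (solid_sector A))%E.
Proof. by []. Qed.

Lemma lebesgue_solid_sector_fin m (A : set 'rV[R]_m) : measurable A ->
  (lebesgue_rV m (solid_sector A) < +oo)%E.
Proof.
move=> mA; apply: (le_lt_trans _ (lebesgue_cball_fin m)).
apply: le_measure; rewrite ?inE.
- exact: measurable_solid_sector.
- exact: measurable_cball.
- by move=> x [_ /andP[]].
Qed.

Lemma measurable_rV_set0 m : measurable [set (0 : 'rV[R]_m)].
Proof.
rewrite (_ : [set 0] = cball 0); first exact: measurable_cball.
apply/seteqP; split => x /=; rewrite /cball /=.
  by move=> ->; rewrite enorm0.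
by move=> x0; apply/eqP; rewrite -enorm_eq0 eq_le x0 enorm_ge0.
Qed.

Lemma lebesgue_rV_set0 m : lebesgue_rV m.+1 [set (0 : 'rV[R]_m.+1)] = 0%E.
Proof.
apply/eqP; rewrite eq_le measure_ge0 andbT lebesgue_rVS.
have <- : ((leb \x lebesgue_rV m) ([set 0%R] `*` setT) = 0)%E.
  rewrite lebesgue_rV_rect//.
  by rewrite lebesgue_measure_set1 mul0e.
have m0 := @measurable_rV_set0 m.+1.
apply: le_measure; rewrite ?inE.
- exact: (measurable_preimage (@measurable_cons_rV _ _)).
- exact: measurableX.
- by move=> [t y] /= ty; split => //=; rewrite -(cons_rV0 t y) ty mxE.
Qed.

Lemma solid_sectorT m : solid_sector setT `|` [set (0 : 'rV[R]_m)] = cball 1.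
Proof.
apply/seteqP; split => x; rewrite /cball /=.
  by move=> [[_ /andP[]]//|->]; rewrite enorm0.
move=> x1; have [->|x0] := eqVneq x 0; [by right|left; split => //].
by apply/andP; split => //; rewrite enorm_gt0.
Qed.

Lemma lebesgue_solid_sectorT m :
  lebesgue_rV m.+1 (solid_sector [set: 'rV[R]_m.+1]) = lebesgue_rV m.+1 (cball 1).
Proof.
rewrite -solid_sectorT measureU0//.
- exact: measurable_solid_sector.
- exact: measurable_rV_set0.
- exact: lebesgue_rV_set0.
Qed.

(** Scaling by rho maps the sector onto its intersection with the ball of radius rho. *)
Lemma lebesgue_sector_shell m (A : set 'rV[R]_m) (rho : R) : measurable A -> 0 < rho <= 1 ->
  lebesgue_rV m (solid_sector A `&` cball rho) =
  ((rho ^+ m)%:E * lebesgue_rV m (solid_sector A))%E.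
Proof.
move=> mA /andP[r0 r1]; rewrite -(@lebesgue_rV_linear R m rho^-1 (solid_sector A)); last 2 first.
- by rewrite invr_neq0 ?gt_eqF.
- exact: measurable_solid_sector.
rewrite muleA -EFinM normfV gtr0_norm// -exprMn divff ?gt_eqF// expr1n mul1e.
congr (lebesgue_rV m _); apply/seteqP; split => x /=; rewrite /cball /solid_sector /punctured_ball /=.
  rewrite normalizeZ ?invr_gt0// enormZ gtr0_norm ?invr_gt0// => -[[Ax /andP[x0 x1]] xr].
  by split => //; apply/andP; split; rewrite ?mulr_gt0 ?invr_gt0// ler_pdivrMl// mulr1.
rewrite normalizeZ ?invr_gt0// enormZ gtr0_norm ?invr_gt0// => -[Ax].
rewrite pmulr_rgt0 ?invr_gt0// ler_pdivrMl// mulr1 => /andP[x0 x1].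
by rewrite x0 (le_trans x1).
Qed.

(** Norm and direction are independent in the unit ball. Both sides are finite measures
in T, and for a half-line T the claim is the scaling law of sectors. *)
Lemma lebesgue_polar m (A : set 'rV[R]_m.+1) (T : set (measurableTypeR R)) :
  measurable A -> measurable T ->
  (lebesgue_rV m.+1 (solid_sector A `&` (@enorm R m.+1) @^-1` T) * lebesgue_rV m.+1 (cball 1) =
   lebesgue_rV m.+1 (solid_sector setT `&` (@enorm R m.+1) @^-1` T) *
     lebesgue_rV m.+1 (solid_sector A))%E.
Proof.
move=> mA.
set L := lebesgue_rV m.+1.
have msA := measurable_solid_sector mA.
have fin C : measurable C -> (L (solid_sector C) \is a fin_num).
  by move=> mC; rewrite ge0_fin_numE//; exact: lebesgue_solid_sector_fin.
have dec C (x : R) : measurable C ->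
    L (solid_sector C `&` (@enorm R m.+1) @^-1` `]x, +oo[) =
    ((if x <= 0 then 1 else if x <= 1 then 1 - x ^+ m.+1 else 0)%:E * L (solid_sector C))%E.
  move=> mC; have msC := measurable_solid_sector mC.
  case: (lerP x 0) => x0.
    rewrite mul1e; congr (L _); apply/seteqP; split => y; first by case.
    move=> sy; split => //=; case: sy => _ /andP[y0 _].
    by rewrite in_itv /= andbT (le_lt_trans x0).
  case: (lerP x 1) => x1; last first.
    rewrite mul0e (_ : _ `&` _ = set0) ?measure0//.
    apply/seteqP; split => y // -[[_ /andP[_ y1]]] /=; rewrite in_itv /= andbT => y2.
    by have := lt_trans x1 (lt_le_trans y2 y1); rewrite ltxx.
  have x01 : 0 < x <= 1 by rewrite x0.
  have mE : measurable ((@enorm R m.+1) @^-1` `]x, +oo[%classic).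
    exact: (measurable_preimage (@measurable_enorm R m.+1)).
  have := lebesgue_sector_shell mC x01; rewrite -/L => sh.
  have : (L (solid_sector C) = L (solid_sector C `&` cball x) +
       L (solid_sector C `&` (@enorm R m.+1) @^-1` `]x, +oo[))%E.
    rewrite -measureU; last 3 first.
    - by apply: measurableI => //; exact: measurable_cball.
    - exact: measurableI.
    - apply/seteqP; split => y // -[[_ +] [_]]; rewrite /cball /= in_itv /= andbT => h1 h2.
      by have := lt_le_trans h2 h1; rewrite ltxx.
    congr (L _); rewrite -setIUr; apply/seteqP; split => y; last by case.
    move=> sy; split => //; rewrite /cball /= in_itv /= andbT.
    by case: (leP (enorm y) x) => _; [left|right].
  rewrite sh.
  have : L (solid_sector C `&` enorm (m:=m.+1) @^-1` `]x, +oo[) \is a fin_num.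
    rewrite ge0_fin_numE//; apply: le_lt_trans (lebesgue_solid_sector_fin mC).
    by apply: le_measure; rewrite ?inE//; exact: measurableI.
  have := fin C mC.
  case: (L (solid_sector C)) => // u _.
  case: (L _) => // v _; rewrite -!EFinM -EFinD => -[uv]; congr EFin; lra.
move=> mT.
have mE : measurable_fun setT (@enorm R m.+1 : _ -> measurableTypeR R) := @measurable_enorm R m.+1.
have msT : measurable (solid_sector [set: 'rV[R]_m.+1]) by exact: measurable_solid_sector.
pose mu C (mC : measurable (solid_sector C)) : {measure set (measurableTypeR R) -> \bar R} :=
  image_measure (mrestr L mC) mE.
pose c1 : {nonneg R} := NngNum (fine_ge0 (measure_ge0 L (cball 1))).
pose c2 : {nonneg R} := NngNum (fine_ge0 (measure_ge0 L (solid_sector A))).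
have := @measure_unique _ R (measurableTypeR R) (@RGenOInfty.G R) (fun k => `](- k%:R : R), +oo[%classic)
  (RGenOInfty.measurableE R) _ _ _ (mscale c1 (mu A msA)) (mscale c2 (mu _ msT)).
have fc1 : (fine (L (cball 1)))%:E = L (cball 1).
  by rewrite fineK// ge0_fin_numE// lebesgue_cball_fin.
have fc2 : (fine (L (solid_sector A)))%:E = L (solid_sector A) by rewrite fineK// fin.
have H C mC X : mu C mC X = L (solid_sector C `&` (@enorm R m.+1) @^-1` X).
  by rewrite /mu /= /pushforward /mrestr setIC.
have H1 X : mscale c1 (mu A msA) X = (L (solid_sector A `&` (@enorm R m.+1) @^-1` X) * L (cball 1))%E.
  by rewrite /mscale H /= fc1 muleC.
have H2 X : mscale c2 (mu _ msT) X = (L (solid_sector setT `&` (@enorm R m.+1) @^-1` X) * L (solid_sector A))%E.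
  by rewrite /mscale H /= fc2 muleC.
move=> MU; apply: etrans (esym (H1 T)) (etrans _ (H2 T)).
apply: MU mT.
- move=> _ _ [x ->] [y ->]; exists (Num.max x y).
  by apply/seteqP; split => z /=; rewrite !in_itv /= !andbT gt_max => /andP.
- by move=> i; exists (- i%:R).
- apply/seteqP; split => // x _; exists (Num.truncn `|x|).+1 => //=; rewrite in_itv /= andbT.
  rewrite ltrNl (le_lt_trans (ler_norm (- x)))// normrN; exact: truncnS_gt.
- move=> _ [x ->]; apply: etrans (H1 _) (etrans _ (esym (H2 _))).
  rewrite !dec// lebesgue_solid_sectorT.
  by rewrite -!muleA; congr (_ * _)%E; rewrite muleC.
- move=> k; rewrite [X in (X < _)%E](H1 _) lte_mul_pinfty//; last exact: lebesgue_cball_fin.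
  + rewrite ge0_fin_numE//; apply: le_lt_trans (lebesgue_solid_sector_fin mA).
    apply: le_measure; rewrite ?inE//; first by apply: measurableI => //; exact: measurable_preimage.
Qed.

End polar.

(** * Latitude and longitude on the sphere *)

Section latitude.
Context {R : realType}.
Local Notation leb := (@lebesgue_measure R).

Lemma lebesgue_rV_slices m (S : set 'rV[R]_m.+1) :
  lebesgue_rV m.+1 S = (\int[leb]_t lebesgue_rV m [set y | S (cons_rV (t, y))])%E.
Proof.
rewrite lebesgue_rVS /=; apply: eq_integral => t _ /=; congr (lebesgue_rV m _).
by apply/seteqP; split => y; rewrite /xsection /= inE.
Qed.

Lemma measurable_slice m (S : set 'rV[R]_m.+1) (t : R) : measurable S ->
  measurable [set y : 'rV[R]_m | S (cons_rV (t, y))].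
Proof.
move=> mS; have mS' := measurable_preimage (@measurable_cons_rV R m) mS.
rewrite (_ : [set y | _] = xsection (cons_rV (m:=m) @^-1` S) t); first exact: measurable_xsection.
by apply/seteqP; split => y; rewrite /xsection /= inE.
Qed.

Lemma measurable_slice_fun m (S : set 'rV[R]_m.+1) : measurable S ->
  measurable_fun setT (fun t : measurableTypeR R =>
    lebesgue_rV m [set y : 'rV[R]_m | S (cons_rV (t, y))]).
Proof.
move=> mS; have mS' := measurable_preimage (@measurable_cons_rV R m) mS.
rewrite (_ : (fun t => _) = lebesgue_rV m \o xsection (cons_rV (m:=m) @^-1` S)).
  exact: measurable_fun_xsection.
apply/funext => t /=; congr (lebesgue_rV m _).
by apply/seteqP; split => y; rewrite /xsection /= inE.
Qed.

Lemma lebesgue_rV_D0 m (S : set 'rV[R]_m.+1) : measurable S ->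
  lebesgue_rV m.+1 S = lebesgue_rV m.+1 (S `\` [set 0]).
Proof.
move=> mS; have m0 := @measurable_rV_set0 R m.+1.
have mSD : measurable (S `\` [set 0]) by exact: measurableD.
apply/eqP; rewrite eq_le; apply/andP; split; last first.
  by apply: le_measure; rewrite ?inE// => x [].
rewrite -(@measureU0 _ _ _ (lebesgue_rV m.+1) _ [set 0] mSD m0 (lebesgue_rV_set0 m)).
apply: le_measure; rewrite ?inE//; first exact: measurableU.
by move=> x Sx; have [->|x0] := eqVneq x 0; [right|left; split => //; exact/eqP].
Qed.

Lemma cons_rVZ m (a t : R) (y : 'rV[R]_m) : a *: cons_rV (t, y) = cons_rV (a * t, a *: y).
Proof.
apply/rowP => i; rewrite scale_rVE; case: (split_ordP (i : 'I_(1 + m))) => j ->; first by rewrite !cons_rVl.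
by rewrite !cons_rVS scale_rVE.
Qed.

(** The longitude of the poles, where the other coordinates vanish, is the value 0 of
normalize at 0. *)
Definition latlong m (x : 'rV[R]_m.+1) : measurableTypeR R * 'rV[R]_m :=
  (x ord0 ord0, normalize (uncons_rV x).2).

Lemma measurable_latlong m : measurable_fun setT (@latlong m).
Proof.
apply: measurable_fun_pair; first exact: measurable_coord.
apply: (measurableT_comp (@measurable_normalize R m)).
exact: (measurableT_comp measurable_snd (@measurable_uncons_rV R m)).
Qed.

(** If x = (t, y) is a unit vector, the second coordinate of x is that of its
longitude scaled by the distance of x to the axis. *)
Lemma sqr_coord_direction m (t : R) (y : 'rV[R]_m.+1) : t ^+ 2 + enorm y ^+ 2 = 1 ->
  y ord0 ord0 ^+ 2 = (1 - t ^+ 2) * normalize y ord0 ord0 ^+ 2.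
Proof.
move=> ty1; have [->|y0] := eqVneq y 0.
  by rewrite /normalize scaler0 mxE expr0n mulr0.
have -> : 1 - t ^+ 2 = enorm y ^+ 2 by lra.
by rewrite /normalize scale_rVE exprMn mulrA -exprMn divff ?enorm_eq0// expr1n mul1r.
Qed.

Lemma latlong_cons m (t : R) (y : 'rV[R]_m) : cons_rV (t, y) != 0 ->
  latlong (normalize (cons_rV (t, y))) = (t / Num.sqrt (t ^+ 2 + enorm y ^+ 2), normalize y).
Proof.
move=> ty0; rewrite /latlong.
have -> : normalize (cons_rV (t, y)) =
    cons_rV ((enorm (cons_rV (t, y)))^-1 * t, (enorm (cons_rV (t, y)))^-1 *: y).
  by rewrite -cons_rVZ.
rewrite cons_rVK cons_rV0 normalizeZ ?invr_gt0 ?enorm_gt0//.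
by rewrite mulrC -enorm_cons sqrtr_sqr ger0_norm// enorm_ge0.
Qed.

(** The norms of y for which (t, y) is in the unit ball and has its latitude in I. *)
Definition radii (I : set R) (t : R) : set (measurableTypeR R) :=
  [set tau | t ^+ 2 + tau ^+ 2 <= 1 /\ I (t / Num.sqrt (t ^+ 2 + tau ^+ 2))].

Lemma measurable_radii (I : set (measurableTypeR R)) t : measurable I -> measurable (radii I t).
Proof.
move=> mI.
have m1 : measurable_fun setT (fun tau : measurableTypeR R => t ^+ 2 + tau ^+ 2 : measurableTypeR R).
  by apply: measurable_funD => //; exact: measurable_funX.
have m2 : measurable_fun setT (fun tau : measurableTypeR R =>
    t / Num.sqrt (t ^+ 2 + tau ^+ 2) : measurableTypeR R).
  rewrite (_ : (fun _ => _) = (fun tau => t * (Num.sqrt (t ^+ 2 + tau ^+ 2)) `^ (-1))).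
    apply: measurable_funM => //; apply: (measurableT_comp (measurable_powR (-1))).
    apply: measurableT_comp m1; apply: continuous_measurable_fun; exact: sqrt_continuous.
  by apply/funext => tau; rewrite powR_inv1// sqrtr_ge0.
rewrite (_ : radii I t =
    ((fun tau : measurableTypeR R => t ^+ 2 + tau ^+ 2 : measurableTypeR R) @^-1` `]-oo, 1%R]) `&`
    ((fun tau : measurableTypeR R => t / Num.sqrt (t ^+ 2 + tau ^+ 2) : measurableTypeR R) @^-1` I)).
  by apply: measurableI; [exact: (measurable_preimage m1)|exact: (measurable_preimage m2)].
by apply/seteqP; split => x; rewrite /= in_itv.
Qed.

(** At a fixed first coordinate, the conditions on latitude and longitude constrain
the norm and the direction of the other coordinates separately. *)
Lemma slice_latlong m (I : set (measurableTypeR R)) (A : set 'rV[R]_m.+1) (t : R) :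
  measurable I -> measurable A ->
  lebesgue_rV m.+1 [set y | solid_sector (latlong (m:=m.+1) @^-1` (I `*` A)) (cons_rV (t, y))] =
  lebesgue_rV m.+1 (solid_sector A `&` enorm (m:=m.+1) @^-1` (radii I t)).
Proof.
move=> mI mA; rewrite lebesgue_rV_D0; last first.
  apply: measurable_slice; apply: measurable_solid_sector.
  by apply: (measurable_preimage (@measurable_latlong m.+1)); exact: measurableX.
congr (lebesgue_rV _ _); apply/seteqP; split => y.
- move=> [[lat /andP[n0 n1]] y0]; rewrite enorm_gt0 in n0.
  have : (I `*` A) (latlong (normalize (cons_rV (t, y)))) := lat.
  rewrite latlong_cons// => -[/= It Ay].
  have h : t ^+ 2 + enorm y ^+ 2 <= 1 by rewrite -enorm_cons expr_le1// enorm_ge0.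
  split; last by split.
  split => //; rewrite /punctured_ball /= enorm_gt0; apply/andP; split; first exact/eqP.
  by rewrite -(@expr_le1 _ 2)// ?enorm_ge0//; have := sqr_ge0 t; lra.
- move=> [[Ay /andP[y0 y1]] [h It]]; split; last by apply/eqP; rewrite -enorm_gt0.
  have n0 : cons_rV (t, y) != 0.
    rewrite -enorm_gt0 lt_def enorm_ge0 andbT -sqrf_eq0 enorm_cons gt_eqF//.
    by rewrite ltr_wpDl ?sqr_ge0 ?exprn_gt0.
  split; first by change ((I `*` A) (latlong (normalize (cons_rV (t, y))))); rewrite latlong_cons.
  rewrite /punctured_ball /= enorm_gt0 n0/= -(@expr_le1 _ 2)// ?enorm_ge0//.
  by rewrite enorm_cons.
Qed.

Lemma integralZr_real d (T : measurableType d) (mu : {measure set T -> \bar R})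
   (f : T -> \bar R) (k : R) :
  measurable_fun setT f -> (forall x, 0 <= f x)%E -> 0 <= k ->
  (\int[mu]_x (f x * k%:E) = (\int[mu]_x f x) * k%:E)%E.
Proof. by move=> mf f0 k0; apply: ge0_integralZr. Qed.

Lemma lebesgue_rV_slicesZ m (S : set 'rV[R]_m.+1) (k : R) : measurable S -> 0 <= k ->
  (lebesgue_rV m.+1 S * k%:E =
   \int[leb]_t (lebesgue_rV m [set y | S (cons_rV (t, y))] * k%:E))%E.
Proof.
move=> mS k0; rewrite lebesgue_rV_slices integralZr_real//.
exact: measurable_slice_fun.
Qed.

(** Latitude and longitude are independent: the solid sector is sliced by the first
coordinate, and norm and direction are independent in each slice. *)
Lemma sphere_latlong m (I : set (measurableTypeR R)) (A : set 'rV[R]_m.+1) :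
  measurable I -> measurable A ->
  (sphere_measure (latlong (m:=m.+1) @^-1` (I `*` A)) * sphere_measure [set: 'rV[R]_m.+1] =
   sphere_measure ((fun x : 'rV[R]_m.+2 => x ord0 ord0) @^-1` I) * sphere_measure A)%E.
Proof.
move=> mI mA.
have -> : (fun x : 'rV[R]_m.+2 => x ord0 ord0) @^-1` I = latlong (m:=m.+1) @^-1` (I `*` setT).
  by apply/seteqP; split => x //= -[].
rewrite !sphere_measureE lebesgue_solid_sectorT.
set L := lebesgue_rV m.+1; set L' := lebesgue_rV m.+2.
have mS B : measurable B -> measurable (solid_sector (latlong (m:=m.+1) @^-1` (I `*` B))).
  move=> mB; apply: measurable_solid_sector.
  by apply: (measurable_preimage (@measurable_latlong m.+1)); exact: measurableX.
have fS B : measurable B ->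
    exists x : R, L' (solid_sector (latlong (m:=m.+1) @^-1` (I `*` B))) = x%:E.
  move=> mB; exists (fine (L' (solid_sector (latlong (m:=m.+1) @^-1` (I `*` B))))).
  rewrite fineK// ge0_fin_numE// lebesgue_solid_sector_fin//.
  by apply: (measurable_preimage (@measurable_latlong m.+1)); exact: measurableX.
have [c1 c10 fL] : exists2 c : R, 0 <= c & L (cball 1) = c%:E.
  exists (fine (L (cball 1))); first exact: fine_ge0.
  by rewrite fineK// ge0_fin_numE// lebesgue_cball_fin.
have [c2 c20 fA] : exists2 c : R, 0 <= c & L (solid_sector A) = c%:E.
  exists (fine (L (solid_sector A))); first exact: fine_ge0.
  by rewrite fineK// ge0_fin_numE// lebesgue_solid_sector_fin.
suff key : (L' (solid_sector (latlong (m:=m.+1) @^-1` (I `*` A))) * c1%:E =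
   L' (solid_sector (latlong (m:=m.+1) @^-1` (I `*` setT))) * c2%:E)%E.
  move: key; rewrite fL fA; clearbody L L'.
  have [x ->] : exists x : R, L' (solid_sector (latlong (m:=m.+1) @^-1` (I `*` A))) = x%:E by exact: fS.
  have [y ->] : exists x : R, L' (solid_sector (latlong (m:=m.+1) @^-1` (I `*` setT))) = x%:E by exact: fS.
  move=> [xy]; rewrite -!EFinM; congr EFin.
  by rewrite mulrACA xy mulrACA.
apply: etrans (lebesgue_rV_slicesZ (mS _ mA) c10) _.
apply: etrans _ (esym (lebesgue_rV_slicesZ (mS _ measurableT) c20)).
apply: eq_integral => t _.
apply: etrans (congr1 (fun z => z * c1%:E)%E (slice_latlong t mI mA)) _.
apply: etrans _ (esym (congr1 (fun z => z * c2%:E)%E (slice_latlong t mI measurableT))).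
rewrite -fL -fA; exact: (lebesgue_polar mA (measurable_radii t mI)).
Qed.

End latitude.

(** * The area of a cap as a function of its height *)

Section cap_profile.
Context {R : realType}.
Local Notation leb := (@lebesgue_measure R).
Implicit Types (p q : nat) (c t : R).

(** Distance to the axis of a point at height t of the unit sphere. *)
Definition axdist t : R := Num.sqrt (1 - t ^+ 2).

Definition axdist_int p c : R := \int[leb]_(t in `[c, 1]) axdist t ^+ p.

(** Area of the cap {x_0 >= c} of the unit sphere of R^(p+1), divided by the area of the
unit sphere of R^p; see [sphere_cap]. The expression is the one obtained from the
solid sector over the cap, cut at height c into a cone and a segment of the ball.
For p > 1 it is the integral of axdist ^+ (p - 2) over [c, 1], by
[is_derive_cap_area]. *)
Definition cap_area p c : R := (c * axdist c ^+ p + p.+1%:R * axdist_int p c) / p%:R.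

Lemma axdist_ge0 t : 0 <= axdist t. Proof. exact: sqrtr_ge0. Qed.

Lemma axdist_sqr c : 0 <= c <= 1 -> axdist c ^+ 2 = 1 - c ^+ 2.
Proof. by move=> /andP[c0 c1]; rewrite sqr_sqrtr// subr_ge0 expr_le1. Qed.

Lemma axdist_gt0 c : 0 <= c < 1 -> 0 < axdist c.
Proof. by move=> /andP[c0 c1]; rewrite sqrtr_gt0 subr_gt0 expr_lt1. Qed.

Lemma axdist_le1 c : axdist c <= 1.
Proof. by rewrite -sqrtr1 ler_wsqrtr// gerBl sqr_ge0. Qed.

Lemma continuous_axdist : continuous axdist.
Proof.
move=> t; apply: (@cvg_comp _ _ _ (fun x : R => 1 - x ^+ 2) (@Num.sqrt R) _ (nbhs (1 - t ^+ 2))).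
  by apply: cvgB; [exact: cvg_cst|exact: exprn_continuous].
exact: sqrt_continuous.
Qed.

Lemma continuous_axdistX p : continuous (fun t => axdist t ^+ p).
Proof.
move=> t; apply: (@cvg_comp _ _ _ axdist (fun x : R => x ^+ p) _ (nbhs (axdist t))).
  exact: continuous_axdist.
exact: exprn_continuous.
Qed.

Lemma integrable_axdistX p a b : leb.-integrable `[a, b] (EFin \o (fun t => axdist t ^+ p)).
Proof.
apply: continuous_compact_integrable; first exact: segment_compact.
exact/continuous_subspaceT/continuous_axdistX.
Qed.

Lemma is_derive_axdist c : 0 < c < 1 -> is_derive c 1 axdist (- (c / axdist c)).
Proof.
move=> /andP[c0 c1].
have h : 0 < 1 - c ^+ 2 by rewrite subr_gt0 expr_lt1// ltW.
have hs := is_derive1_sqrt h.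
have hg : is_derive c 1 (fun x : R => 1 - x ^+ 2) (- (2 * c)).
  by apply: is_derive_eq; rewrite /GRing.scale /=; ring.
rewrite (_ : axdist = @Num.sqrt R \o (fun x : R => 1 - x ^+ 2))//.
apply: (is_derive_eq (@is_derive1_comp _ (@Num.sqrt R) (fun x : R => 1 - x ^+ 2) _ _ _ hs hg)).
have s0 : axdist c != 0 by rewrite gt_eqF// sqrtr_gt0.
by rewrite /axdist in s0; rewrite /=; field.
Qed.

Lemma is_derive_axdistX p c : 0 < c < 1 ->
  is_derive c 1 (fun t => axdist t ^+ p.+2) (- (p.+2%:R * c * axdist c ^+ p)).
Proof.
move=> c01; have hs := is_derive_axdist c01.
rewrite (_ : (fun t => axdist t ^+ p.+2) = axdist ^+ p.+2); last first.
  by apply/funext => t; rewrite exprfctE.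
apply: is_derive_eq; rewrite /GRing.scale /=.
have s0 : axdist c != 0.
  by rewrite gt_eqF// axdist_gt0//; case/andP: c01 => /ltW -> ->.
by rewrite exprS; field.
Qed.

Lemma axdist_int_split p c : 0 < c < 1 ->
  axdist_int p c = \int[leb]_(t in `[0, 1]) axdist t ^+ p - \int[leb]_(t in `[0, c]) axdist t ^+ p.
Proof.
move=> /andP[c0 c1]; rewrite Rintegral_itvB; last 3 first.
- exact: integrable_axdistX.
- by rewrite bnd_simp ltW.
- by rewrite bnd_simp ltW.
rewrite Rintegral_itv_obnd_cbnd//.
apply: (integrableS _ _ _ (integrable_axdistX p c 1)) => //.
exact: subset_itv_oc_cc.
Qed.

Lemma is_derive_axdist_int p c : 0 < c < 1 ->
  is_derive c 1 (axdist_int p) (- axdist c ^+ p).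
Proof.
move=> /andP[c0 c1].
have [dF FE] := continuous_FTC1_closed c1 (integrable_axdistX p 0 1) c0 (@continuous_axdistX p c).
have hF : is_derive c 1 (fun x => \int[leb]_(t in `[0, x]) axdist t ^+ p) (axdist c ^+ p).
  exact: (DeriveDef dF (etrans (esym (derive1E _ _)) FE)).
have hG : is_derive c 1 (fun x => \int[leb]_(t in `[0, 1]) axdist t ^+ p -
    \int[leb]_(t in `[0, x]) axdist t ^+ p) (- axdist c ^+ p).
  by apply: is_derive_eq; rewrite add0r mul1r.
apply: near_eq_is_derive hG; near=> x.
rewrite -axdist_int_split//; apply/andP; split.
- by near: x; exact: lt_nbhsr.
- by near: x; exact: lt_nbhsl.
Unshelve. all: by end_near. Qed.

Lemma axdist_homo x y : 0 <= x -> x <= y -> axdist y <= axdist x.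
Proof. by move=> x0 xy; rewrite ler_wsqrtr// lerB// ler_sqr// ?nnegrE// (le_trans x0). Qed.

Lemma axdist_int_ge0 p c : 0 <= axdist_int p c.
Proof. by apply: Rintegral_ge0 => t _; rewrite exprn_ge0// axdist_ge0. Qed.

Lemma axdist_int_le p c : 0 <= c <= 1 -> axdist_int p c <= (1 - c) * axdist c ^+ p.
Proof.
move=> /andP[c0 c1].
apply: (@le_trans _ _ (\int[leb]_(t in `[c, 1]) (axdist c ^+ p))).
  apply: le_Rintegral => //.
  - exact: integrable_axdistX.
  - apply: continuous_compact_integrable; first exact: segment_compact.
    by apply: continuous_subspaceT => x; exact: cvg_cst.
  - move=> t; rewrite /= in_itv /= => /andP[ct t1].
    by rewrite lerXn2r// ?nnegrE ?axdist_ge0// axdist_homo.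
rewrite Rintegral_cst// mulrC [X in X * _](_ : _ = 1 - c)//.
transitivity (fine (lebesgue_measure (`[c, 1]%classic : set R))) => //.
rewrite lebesgue_measure_itv /= lte_fin; case: ifPn => [_|]; rewrite -?EFinD//=.
by rewrite -leNgt => h; lra.
Qed.

Lemma is_derive_cap_area q c : 0 < c < 1 ->
  is_derive c 1 (cap_area q.+2) (- axdist c ^+ q).
Proof.
move=> c01; have h1 := is_derive_axdistX q c01; have h2 := is_derive_axdist_int q.+2 c01.
have h : is_derive c 1 (fun c => (c * axdist c ^+ q.+2 + q.+3%:R * axdist_int q.+2 c) * q.+2%:R^-1)
   (- axdist c ^+ q).
  apply: is_derive_eq; rewrite /GRing.scale /=.
  have sq : axdist c ^+ 2 = 1 - c ^+ 2.
    by rewrite axdist_sqr//; case/andP: c01 => /ltW -> /ltW ->.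
  have -> : axdist c ^+ q.+2 = axdist c ^+ q * (1 - c ^+ 2) by rewrite -addn2 exprD sq.
  have : q.+2%:R != 0 :> R by rewrite pnatr_eq0.
  rewrite -[in q.+3%:R]addn1 natrD.
  move: (q.+2%:R : R) => Q Q0; field.
  exact: Q0.
exact: h.
Qed.

Lemma cap_area_ge p c : (0 < p)%N -> c * axdist c ^+ p / p%:R <= cap_area p c.
Proof.
move=> p0; rewrite /cap_area ler_pM2r ?invr_gt0 ?ltr0n// lerDl mulr_ge0//.
exact: axdist_int_ge0.
Qed.

Lemma cap_area_le p c : (0 < p)%N -> 0 <= c <= 1 -> cap_area p c <= 2 * axdist c ^+ p.
Proof.
move=> p0 c01; have := axdist_int_le p c01; rewrite /cap_area ler_pdivrMr ?ltr0n//.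
have := exprn_ge0 p (axdist_ge0 c); have := axdist_int_ge0 p c.
have : 1 <= p%:R :> R by rewrite ler1n.
rewrite -addn1 natrD; case/andP: c01 => c0 c1.
move: (p%:R : R) (axdist_int p c) (axdist c ^+ p) => P I X P1 I0 X0 IX.
have : (P + 1) * I <= (P + 1) * ((1 - c) * X) by rewrite ler_wpM2l//; lra.
have : 0 <= c * X by rewrite mulr_ge0.
nra.
Qed.

(** As c <= t on [c, 1], the left-hand side is at most the integral of
t * axdist t ^+ p, which has an elementary primitive. *)
Lemma mul_axdist_int_le p c : 0 <= c < 1 -> c * axdist_int p c <= axdist c ^+ p.+2 / p.+2%:R.
Proof.
move=> /andP[c0 c1].
have E : (\int[leb]_(t in `[c, 1%R]) (t * axdist t ^+ p)%:E = (axdist c ^+ p.+2 / p.+2%:R)%:E)%E.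
  have cX q : continuous (fun t => - (axdist t ^+ q) / q%:R).
    move=> t; apply: cvgM; last exact: cvg_cst.
    by apply: cvgN; exact: continuous_axdistX.
  rewrite (@continuous_FTC2 _ _ (fun t => - (axdist t ^+ p.+2) / p.+2%:R))//.
  - rewrite -EFinB; congr EFin.
    have -> : axdist 1 = 0 by rewrite /axdist expr1n subrr sqrtr0.
    by rewrite expr0n /= oppr0 mul0r sub0r mulNr opprK.
  - apply: continuous_subspaceT => t; apply: cvgM; first exact: cvg_id.
    exact: continuous_axdistX.
  - split.
    + move=> t; rewrite in_itv /= => /andP[ct t1].
      have t01 : 0 < t < 1 by rewrite t1 (le_lt_trans c0).
      by have h := is_derive_axdistX p t01; apply: ex_derive.
    + by apply: cvg_at_right_filter; exact: cX.
    + by apply: cvg_at_left_filter; exact: cX.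
  - move=> t; rewrite in_itv /= => /andP[ct t1].
    have t01 : 0 < t < 1 by rewrite t1 (le_lt_trans c0).
    have h := is_derive_axdistX p t01.
    rewrite derive1E; apply: derive_val.
    apply: is_derive_eq; rewrite /GRing.scale /=.
    have : p.+2%:R != 0 :> R by rewrite pnatr_eq0.
    by move: (p.+2%:R : R) => Q Q0; field; exact: Q0.
rewrite -RintegralZl//; last exact: integrable_axdistX.
rewrite -lee_fin -E /Rintegral fineK; last first.
  apply: integrable_fin_num => //.
  apply: (continuous_compact_integrable (f := fun t => c * axdist t ^+ p)).
    exact: segment_compact.
  apply: continuous_subspaceT => t; apply: cvgM; first exact: cvg_cst.
  exact: continuous_axdistX.
apply: ge0_le_integral => //.
- by move=> t _; rewrite lee_fin mulr_ge0// exprn_ge0// axdist_ge0.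
- apply/measurable_EFinP/measurable_funTS; apply: measurable_funM => //.
  by apply: continuous_measurable_fun; exact: continuous_axdistX.
- apply/measurable_EFinP/measurable_funTS; apply: measurable_funM => //.
  by apply: continuous_measurable_fun; exact: continuous_axdistX.
- move=> t; rewrite /= in_itv /= => /andP[ct t1]; rewrite lee_fin ler_wpM2r//.
  by rewrite exprn_ge0// axdist_ge0.
Qed.

(** The comparison of constants that makes the ellipsoids beat the ball. *)
Lemma cap_area_lt q c : 0 < c < 1 -> q.+2%:R * c * cap_area q.+2 c < axdist c ^+ q.+2.
Proof.
move=> /andP[c0 c1]; have c01 : 0 <= c < 1 by rewrite ltW.
have := mul_axdist_int_le q.+2 c01.
have s0 := axdist_gt0 c01.
have sq : axdist c ^+ 2 = 1 - c ^+ 2 by rewrite axdist_sqr// !ltW.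
have -> : q.+2%:R * c * cap_area q.+2 c = c * (c * axdist c ^+ q.+2 + q.+3%:R * axdist_int q.+2 c).
  rewrite /cap_area; have : q.+2%:R != 0 :> R by rewrite pnatr_eq0.
  by move: (q.+2%:R : R) => Q Q0; field; exact: Q0.
rewrite ler_pdivlMr ?ltr0n// -[q.+4]addn2 (exprD _ q.+2 2) sq.
have : 0 < axdist c ^+ q.+2 * (1 - c ^+ 2) by rewrite mulr_gt0 ?exprn_gt0// subr_gt0 expr_lt1// ltW.
have : 0 <= axdist_int q.+2 c := axdist_int_ge0 _ _.
have -> : (q.+2 + 2)%:R = q.+2%:R + 2 :> R by rewrite natrD.
have -> : q.+3%:R = q.+2%:R + 1 :> R by rewrite -natr1.
have : 0 <= q.+2%:R :> R by [].
move: (axdist c ^+ _) (axdist_int _ _) (q.+2%:R) => X I Q Q0 I0 X0 h.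
have : c * I * (Q + 1) <= (c * I * (Q + 2)) * ((Q + 1) / (Q + 2)).
  by rewrite le_eqVlt; apply/orP; left; apply/eqP; field; lra.
have : (c * I * (Q + 2)) * ((Q + 1) / (Q + 2)) <= (X * (1 - c ^+ 2)) * ((Q + 1) / (Q + 2)).
  by rewrite ler_wpM2r// divr_ge0; lra.
have : (X * (1 - c ^+ 2)) * ((Q + 1) / (Q + 2)) < X * (1 - c ^+ 2).
  by rewrite gtr_pMr// ltr_pdivrMr ?mul1r; lra.
nra.
Qed.

End cap_profile.

(** * The area of a cap of the sphere *)

Section sphere_finite.
Context {R : realType} (m : nat).

Let sphere_measure_fin : fin_num_fun (@sphere_measure R m).
Proof.
move=> A mA; rewrite sphere_measureE fin_numM// ge0_fin_numE//.
exact: lebesgue_solid_sector_fin.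
Qed.

HB.instance Definition _ := Measure_isFinite.Build _ _ _ (@sphere_measure R m) sphere_measure_fin.

End sphere_finite.

Section cap.
Context {R : realType}.
Local Notation leb := (@lebesgue_measure R).

Definition sphere_mass m : R := fine (@sphere_measure R m setT).

Lemma sphere_massE m : (sphere_mass m)%:E = @sphere_measure R m setT.
Proof. by rewrite fineK//; exact: fin_num_measure. Qed.

Lemma sphere_mass_cball m :
  sphere_mass m.+1 = m.+1%:R * fine (lebesgue_rV m.+1 (@cball R m.+1 1)).
Proof.
rewrite /sphere_mass sphere_measureE lebesgue_solid_sectorT fineM//.
by rewrite ge0_fin_numE// lebesgue_cball_fin.
Qed.

Lemma sphere_mass_gt0 m : 0 < sphere_mass m.+1.
Proof.
by rewrite sphere_mass_cball mulr_gt0// fine_gt0// lebesgue_cball_gt0 lebesgue_cball_fin.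
Qed.

Lemma lebesgue_cball m (r : R) : 0 <= r ->
  lebesgue_rV m.+1 (cball r) = ((r ^+ m.+1)%:E * lebesgue_rV m.+1 (cball 1))%E.
Proof.
rewrite le_eqVlt => /predU1P[<-|]; last exact: lebesgue_cball_scale.
rewrite expr0n mul0e -(@lebesgue_rV_set0 R m); congr (lebesgue_rV _ _).
apply/seteqP; split => x; rewrite /cball /=; last by move=> ->; rewrite enorm0.
by move=> x0; apply/eqP; rewrite -enorm_eq0 eq_le x0 enorm_ge0.
Qed.

Lemma int_pow_cap m (c s : R) : 0 < c -> 0 <= s ->
  (\int[leb]_(t in `[0%R, c]) ((t * s / c) ^+ m)%:E = (c * s ^+ m / m.+1%:R)%:E)%E.
Proof.
move=> c0 s0.
have m0 : m.+1%:R != 0 :> R by rewrite pnatr_eq0.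
have E t : (t * s / c) ^+ m = (s / c) ^+ m * t ^+ m by rewrite -exprMn -mulrA mulrC.
have cX k : continuous (fun t : R => (s / c) ^+ m * t ^+ k).
  by move=> t; apply: cvgM; [exact: cvg_cst|exact: exprn_continuous].
have dX (t : R) : is_derive t 1 (fun t : R => (s / c) ^+ m / m.+1%:R * t ^+ m.+1) ((s / c) ^+ m * t ^+ m).
  rewrite (_ : (fun t : R => _) = (fun t : R => (s / c) ^+ m / m.+1%:R * (id ^+ m.+1) t)).
    apply: is_derive_eq; rewrite /GRing.scale /=.
    move: (m.+1%:R : R) m0 ((s / c) ^+ m) (t ^+ m) => Q Q0 X T; field.
    exact: Q0.
  by apply/funext => u; rewrite exprfctE.
have cF : continuous (fun t : R => (s / c) ^+ m / m.+1%:R * t ^+ m.+1).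
  by move=> t; apply: cvgM; [exact: cvg_cst|exact: exprn_continuous].
under eq_integral do rewrite E.
rewrite (@continuous_FTC2 _ _ (fun t => (s / c) ^+ m / m.+1%:R * t ^+ m.+1))//.
- rewrite -EFinB expr0n mulr0 subr0; congr EFin.
  rewrite expr_div_n exprS.
  have : c ^+ m != 0 by rewrite expf_neq0// gt_eqF.
  move: (m.+1%:R : R) m0 (c ^+ m) (s ^+ m) => Q Q0 C S C0; field.
  by rewrite Q0 C0.
- exact/continuous_subspaceT/cX.
- split.
  + by move=> t _; have h := dX t; exact: ex_derive.
  + by apply: cvg_at_right_filter; exact: cF.
  + by apply: cvg_at_left_filter; exact: cF.
- by move=> t _; have h := dX t; rewrite derive1E; exact: derive_val.
Qed.

Lemma measurable_coord0_ge m (c : R) : measurable [set x : 'rV[R]_m.+1 | c <= x ord0 ord0].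
Proof.
rewrite (_ : [set x | _] = (fun x : 'rV[R]_m.+1 => x ord0 ord0 : measurableTypeR R) @^-1` `[c, +oo[).
  exact: (measurable_preimage (measurable_coord ord0)).
by apply/seteqP; split => x; rewrite /= in_itv /= andbT.
Qed.

Lemma cap_sliceP m (c t : R) (y : 'rV[R]_m) : 0 < c ->
  solid_sector [set x : 'rV[R]_m.+1 | c <= x ord0 ord0] (cons_rV (t, y)) <->
  [/\ 0 < t, c ^+ 2 * (t ^+ 2 + enorm y ^+ 2) <= t ^+ 2 & t ^+ 2 + enorm y ^+ 2 <= 1].
Proof.
move=> c0; rewrite /solid_sector /punctured_ball /=.
have -> : normalize (cons_rV (t, y)) ord0 ord0 = t / enorm (cons_rV (t, y)).
  by rewrite /normalize scale_rVE cons_rV0 mulrC.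
rewrite -enorm_cons; set e := enorm _; have e0 : 0 <= e := enorm_ge0 _; split.
- move=> [ct /andP[e1 e2]]; move: ct; rewrite ler_pdivlMr// => ct.
  have t0 : 0 < t by rewrite (lt_le_trans _ ct)// mulr_gt0.
  split => //; last by rewrite expr_le1.
  by rewrite -exprMn ler_sqr// nnegrE ?mulr_ge0// ltW.
- move=> [t0 h]; rewrite expr_le1// => e1.
  have ep : 0 < e.
    by rewrite lt_def e0 andbT -sqrf_eq0 enorm_cons gt_eqF// ltr_wpDr ?sqr_ge0 ?exprn_gt0.
  split; last by rewrite ep.
  rewrite ler_pdivlMr//; move: h; rewrite -exprMn ler_sqr// nnegrE; last exact: ltW.
  by rewrite mulr_ge0// ltW.
Qed.

(** Up to height c the slices of the solid sector are those of a cone, above it those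
of the ball. *)
Lemma cap_slice m (c t : R) : 0 < c < 1 ->
  lebesgue_rV m.+1 [set y | solid_sector [set x : 'rV[R]_m.+2 | c <= x ord0 ord0] (cons_rV (t, y))] =
  ((((fun t => ((t * axdist c / c) ^+ m.+1)%:E) \_ `[0%R, c]) t +
   ((fun t => (axdist t ^+ m.+1)%:E) \_ `]c, 1%R]) t) * lebesgue_rV m.+1 (cball 1))%E.
Proof.
move=> /andP[c0 c1]; set Y := [set y | _]; rewrite !patchE !mem_setE !in_itv /=.
have YP y : Y y <-> [/\ 0 < t, c ^+ 2 * (t ^+ 2 + enorm y ^+ 2) <= t ^+ 2 & t ^+ 2 + enorm y ^+ 2 <= 1].
  exact: cap_sliceP.
have sc : axdist c ^+ 2 = 1 - c ^+ 2 by rewrite axdist_sqr// !ltW.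
have [t0|t0] := lerP t 0.
  have -> : Y = set0 by apply/seteqP; split => y // /YP[]; rewrite ltNge t0.
  rewrite measure0 [X in (_ + X)%E](_ : _ = 0%E); last first.
    by rewrite (ltNge c t) (le_trans t0 (ltW c0)).
  case: ifPn => [/andP[t0' _]|_]; last by rewrite adde0 mul0e.
  have -> : t = 0 by apply/eqP; rewrite eq_le t0.
  by rewrite !mul0r expr0n /= adde0 mul0e.
have [tc|tc] := lerP t c.
  rewrite (ltW t0) /= adde0 -lebesgue_cball; last first.
    by rewrite divr_ge0 ?mulr_ge0 ?axdist_ge0// ltW.
  congr (lebesgue_rV _ _); apply/seteqP; split => y.
    move=> /YP[_ h _]; rewrite /cball /= ler_pdivlMr// mulrC.
    rewrite -ler_sqr ?nnegrE ?mulr_ge0 ?enorm_ge0 ?axdist_ge0//; try exact: ltW.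
    by rewrite !exprMn sc; lra.
  rewrite /cball /= ler_pdivlMr// mulrC.
  rewrite -ler_sqr ?nnegrE ?mulr_ge0 ?enorm_ge0 ?axdist_ge0//; try exact: ltW.
  rewrite !exprMn sc => h; apply/YP; split => //; first lra.
  have : t ^+ 2 <= c ^+ 2 by rewrite ler_sqr// ?nnegrE ltW.
  have : 0 < c ^+ 2 by rewrite exprn_gt0.
  move: (t ^+ 2) (c ^+ 2) (enorm y ^+ 2) h => T C E h C0 TC.
  rewrite -(ler_pM2l C0) mulr1; lra.
have [t1|t1] := lerP t 1; rewrite (ltW t0)/= add0e.
  have st : axdist t ^+ 2 = 1 - t ^+ 2 by rewrite axdist_sqr// t1 ltW.
  rewrite -lebesgue_cball ?axdist_ge0//; congr (lebesgue_rV _ _); apply/seteqP; split => y.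
    move=> /YP[_ _ h]; rewrite /cball /=.
    by rewrite -ler_sqr ?nnegrE ?enorm_ge0 ?axdist_ge0// st; lra.
  rewrite /cball /= -ler_sqr ?nnegrE ?enorm_ge0 ?axdist_ge0// st => h.
  have h1 : t ^+ 2 + enorm y ^+ 2 <= 1 by lra.
  apply/YP; split => //.
  have : c ^+ 2 <= t ^+ 2 by rewrite ler_sqr// ?nnegrE ltW.
  apply: le_trans; rewrite -[X in _ <= X]mulr1 ler_wpM2l// sqr_ge0//.
have -> : Y = set0; last by rewrite measure0 mul0e.
apply/seteqP; split => y // /YP[_ _]; have := sqr_ge0 (enorm y).
have : 1 < t ^+ 2 by rewrite exprn_egt1// ltW.
lra.
Qed.

Lemma sphere_cap m (c : R) : 0 < c < 1 ->
  sphere_measure [set x : 'rV[R]_m.+2 | c <= x ord0 ord0] =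
  (sphere_mass m.+1 * cap_area m.+1 c)%:E.
Proof.
move=> c01; rewrite sphere_measureE lebesgue_rV_slices.
under eq_integral do rewrite (cap_slice _ _ c01).
have [L L0 fL] : exists2 L : R, 0 <= L & lebesgue_rV m.+1 (cball 1) = L%:E.
  exists (fine (lebesgue_rV m.+1 (@cball R m.+1 1))); first exact: fine_ge0.
  by rewrite fineK// ge0_fin_numE// lebesgue_cball_fin.
rewrite sphere_mass_cball fL.
have mg1 : measurable_fun setT
    ((fun t : measurableTypeR R => ((t * axdist c / c) ^+ m.+1)%:E) \_ `[0%R, c]).
  apply/(measurable_restrictT _ _).1 => //; apply/measurable_EFinP/measurable_funTS.
  apply: measurable_funX; apply: measurable_funM => //; exact: measurable_funM.
have mg2 : measurable_fun setT ((fun t : measurableTypeR R => (axdist t ^+ m.+1)%:E) \_ `]c, 1%R]).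
  apply/(measurable_restrictT _ _).1 => //; apply/measurable_EFinP/measurable_funTS.
  by apply: continuous_measurable_fun; exact: continuous_axdistX.
have g10 (t : R) : (0 <= ((fun t : measurableTypeR R => ((t * axdist c / c) ^+ m.+1)%:E) \_ `[0%R, c]) t)%E.
  rewrite patchE; case: ifPn => //; rewrite inE /= in_itv /= => /andP[t0 _].
  by rewrite lee_fin exprn_ge0// !mulr_ge0// ?axdist_ge0// invr_ge0 ltW//; case/andP: c01.
have g20 (t : R) : (0 <= ((fun t : measurableTypeR R => (axdist t ^+ m.+1)%:E) \_ `]c, 1%R]) t)%E.
  by rewrite patchE; case: ifPn => // _; rewrite lee_fin exprn_ge0// axdist_ge0.
rewrite integralZr_real//; last 2 first.
- exact: emeasurable_funD.
- by move=> t; rewrite adde_ge0.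
rewrite ge0_integralD// -!integral_mkcond int_pow_cap ?axdist_ge0//; last by case/andP: c01.
rewrite integral_itv_obnd_cbnd; last first.
  apply/measurable_EFinP/measurable_funTS.
  by apply: continuous_measurable_fun; exact: continuous_axdistX.
have -> : (\int[leb]_(t in `[c, 1%R]) (axdist t ^+ m.+1)%:E = (axdist_int m.+1 c)%:E)%E.
  rewrite /axdist_int /Rintegral fineK//.
  by apply: integrable_fin_num => //; exact: integrable_axdistX.
rewrite -EFinD -!EFinM; congr EFin; rewrite /cap_area.
have : m.+1%:R != 0 :> R by rewrite pnatr_eq0.
have : m.+2%:R != 0 :> R by rewrite pnatr_eq0.
move: (m.+1%:R : R) (m.+2%:R : R) (axdist c ^+ _) (axdist_int _ _) => Q Q1 X I Q10 Q0.
by rewrite /=; field; rewrite Q0 Q10.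
Qed.

End cap.

(** * Integration in latitude and longitude *)

Section axis_law.
Context {R : realType} (m : nat).

(** Law of a coordinate under the surface measure of the unit sphere of R^(m+1). *)
Definition axis_law : set (measurableTypeR R) -> \bar R :=
  pushforward (@sphere_measure R m.+1) (fun x => x ord0 ord0).

Let image_law : {measure set (measurableTypeR R) -> \bar R} :=
  image_measure (@sphere_measure R m.+1) (@measurable_coord R m.+1 ord0).

HB.instance Definition _ := isMeasure.Build _ _ _ axis_law
  (measure0 image_law) (measure_ge0 image_law)
  (@measure_semi_sigma_additive _ _ _ image_law).

Let axis_law_fin : fin_num_fun axis_law.
Proof.
move=> A mA; rewrite /axis_law /pushforward; apply: fin_num_measure.
exact: (measurable_preimage (@measurable_coord R m.+1 ord0)).
Qed.

HB.instance Definition _ := Measure_isFinite.Build _ _ _ axis_law axis_law_fin.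

Lemma axis_lawE A : axis_law A = sphere_measure ((fun x : 'rV[R]_m.+1 => x ord0 ord0) @^-1` A).
Proof. by []. Qed.

Lemma integral_axis_law (f : R -> \bar R) : measurable_fun setT f -> (forall t, 0 <= f t)%E ->
  (\int[axis_law]_t f t = \int[@sphere_measure R m.+1]_x f (x ord0 ord0))%E.
Proof.
move=> mf f0.
by rewrite (@ge0_integral_pushforward _ _ _ _ R _ (@measurable_coord R m.+1 ord0) (@sphere_measure R m.+1)).
Qed.

End axis_law.

Section zonal.
Context {R : realType}.

Lemma measurable_usphere m : measurable (@usphere R m).
Proof.
rewrite (_ : usphere = (@enorm R m : 'rV[R]_m -> measurableTypeR R) @^-1` [set 1]).
  exact: (measurable_preimage (@measurable_enorm R m)).
by [].
Qed.

(** The surface measure is defined on all sets, and depends on their trace on the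
sphere only. *)
Lemma sphere_measureIusphere m (A : set 'rV[R]_m) :
  sphere_measure A = sphere_measure (usphere `&` A).
Proof.
rewrite !sphere_measureE; congr (_ * lebesgue_rV m _)%E; apply/seteqP; split => x [].
  move=> Ax px; split => //; split => //; apply: enorm_normalize.
  by rewrite -enorm_gt0; case/andP: px.
by move=> [].
Qed.

Lemma eq_sphere_measure m (A B : set 'rV[R]_m) :
  (forall x, enorm x = 1 -> A x <-> B x) -> sphere_measure A = sphere_measure B.
Proof.
move=> AB; rewrite sphere_measureIusphere [RHS]sphere_measureIusphere.
congr (sphere_measure _); apply/seteqP; split => x [x1 Ax]; split => //; exact/AB.
Qed.

Lemma integral_usphere m (f : 'rV[R]_m -> \bar R) :
  measurable_fun setT f -> (forall x, 0 <= f x)%E ->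
  (\int[sphere_measure]_x f x = \int[sphere_measure]_(x in usphere) f x)%E.
Proof.
move=> mf f0.
have Z : @sphere_measure R m (~` usphere) = 0%E.
  by rewrite sphere_measureIusphere setICr; exact: measure0.
have mU : measurable (~` @usphere R m) by apply: measurableC; exact: (@measurable_usphere m).
have -> := @ge0_negligible_integral _ _ R (@sphere_measure R m) setT (~` usphere) f
  mU measurableT mf (fun x _ => f0 x) Z.
by rewrite setDE setCK setTI.
Qed.

Lemma eq_integral_sphere m (f g : 'rV[R]_m -> \bar R) :
  measurable_fun setT f -> (forall x, 0 <= f x)%E ->
  measurable_fun setT g -> (forall x, 0 <= g x)%E ->
  (forall x, enorm x = 1 -> f x = g x) ->
  (\int[sphere_measure]_x f x = \int[sphere_measure]_x g x)%E.
Proof.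
move=> mf f0 mg g0 fg; rewrite integral_usphere// [RHS]integral_usphere//.
by apply: eq_integral => x; rewrite inE => /fg.
Qed.

Lemma sphere_measure_rotate m (Q : 'M[R]_m) (A : set 'rV[R]_m) :
  Q *m Q^T = 1%:M -> measurable A ->
  sphere_measure [set x | A (x *m Q)] = sphere_measure A.
Proof.
move=> QQ mA; rewrite !sphere_measureE; congr (_ * _)%E.
rewrite -(lebesgue_rV_rotate QQ (measurable_solid_sector mA)).
congr (lebesgue_rV m _); apply/seteqP; split => x; rewrite /solid_sector /punctured_ball /=;
  by rewrite normalize_mulmx// enorm_mulmx.
Qed.

Lemma integral_sphere_rotate m (Q : 'M[R]_m) (f : 'rV[R]_m -> \bar R) :
  Q *m Q^T = 1%:M -> measurable_fun setT f -> (forall x, 0 <= f x)%E ->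
  (\int[sphere_measure]_x f (x *m Q) = \int[sphere_measure]_x f x)%E.
Proof.
move=> QQ mf f0.
rewrite [RHS](@eq_measure_integral _ _ _ setT (image_measure (@sphere_measure R m) (measurable_mulmxr Q))).
  by rewrite (@ge0_integral_pushforward _ _ _ _ R _ (measurable_mulmxr Q) (@sphere_measure R m)).
move=> A mA _; exact/esym/sphere_measure_rotate.
Qed.

(** The product formula on rectangles, [sphere_latlong], extended to all measurable
sets by uniqueness of the product measure. *)
Lemma latlong_product m (P : set (measurableTypeR R * 'rV[R]_m.+1)) : measurable P ->
  (axis_law m.+1 \x @sphere_measure R m.+1)%E P =
  ((sphere_mass m.+1)%:E * sphere_measure (latlong (m:=m.+1) @^-1` P))%E.
Proof.
move=> mP.
pose mu' : {measure set _ -> \bar R} := mscale (NngNum (ltW (sphere_mass_gt0 m)))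
  (image_measure (@sphere_measure R m.+2) (@measurable_latlong R m.+1)).
apply: (@product_measure_unique _ _ _ _ _ (axis_law m.+1) (@sphere_measure R m.+1) mu') => //.
move=> I A mI mA; have h := sphere_latlong mI mA.
rewrite -sphere_massE -axis_lawE in h.
transitivity ((sphere_mass m.+1)%:E * sphere_measure (latlong (m:=m.+1) @^-1` (I `*` A)))%E.
  by [].
by rewrite muleC; exact: h.
Qed.

Lemma integral_latlong m (f : measurableTypeR R * 'rV[R]_m.+1 -> \bar R) :
  measurable_fun setT f -> (forall x, 0 <= f x)%E ->
  (\int[axis_law m.+1]_t \int[sphere_measure]_v f (t, v) =
   (sphere_mass m.+1)%:E * \int[sphere_measure]_x f (latlong (m:=m.+1) x))%E.
Proof.
move=> mf f0.
rewrite -(fubini_tonelli1 f)//.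
pose mu' : {measure set _ -> \bar R} := mscale (NngNum (ltW (sphere_mass_gt0 m)))
  (image_measure (@sphere_measure R m.+2) (@measurable_latlong R m.+1)).
rewrite (@eq_measure_integral _ _ _ setT mu'); last first.
  by move=> A mA _; exact: latlong_product.
rewrite ge0_integral_mscale//; congr (_ * _)%E.
by rewrite (@ge0_integral_pushforward _ _ _ _ R _ (@measurable_latlong R m.+1) (@sphere_measure R m.+2)).
Qed.

(** At a fixed longitude v, the latitudes of the region are those of the cap of height
g v. *)
Lemma sphere_zonal m (g : 'rV[R]_m.+1 -> measurableTypeR R) :
  measurable_fun setT g -> (forall v, 0 < g v < 1) ->
  sphere_measure [set x : 'rV[R]_m.+2 | g (latlong (m:=m.+1) x).2 <= x ord0 ord0] =
  (\int[sphere_measure]_v (cap_area m.+1 (g v))%:E)%E.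
Proof.
move=> mg g01.
pose P := [set p : measurableTypeR R * 'rV[R]_m.+1 | g p.2 <= p.1].
have mP : measurable P.
  rewrite (_ : P = (fun p : measurableTypeR R * 'rV[R]_m.+1 => p.1 - g p.2 : measurableTypeR R) @^-1` `[0, +oo[).
    apply: measurable_preimage => //; apply: measurable_funB; first exact: measurable_fst.
    exact: (measurableT_comp mg measurable_snd).
  by apply/seteqP; split => p; rewrite /P /= in_itv /= andbT subr_ge0.
have E : (\int[sphere_measure]_v axis_law m.+1 (ysection P v) =
    (sphere_mass m.+1)%:E * sphere_measure (latlong (m:=m.+1) @^-1` P))%E.
  rewrite -latlong_product//.
  exact: (esym (fubini_sets (axis_law m.+1) (@sphere_measure R m.+1) mP)).
have M0 : sphere_mass m.+1 != 0 :> R by rewrite gt_eqF// sphere_mass_gt0.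
have capE v : (cap_area m.+1 (g v))%:E = ((sphere_mass m.+1)^-1%:E * axis_law m.+1 (ysection P v))%E.
  have -> : axis_law m.+1 (ysection P v) = (sphere_mass m.+1 * cap_area m.+1 (g v))%:E.
    rewrite axis_lawE -(@sphere_cap R m (g v) (g01 v)); apply: congr1.
    by apply/seteqP; split => x; rewrite /ysection /= inE.
  by rewrite -EFinM mulrA mulVf// mul1r.
under eq_integral do rewrite capE.
rewrite ge0_integralZl//.
- by rewrite E muleA -EFinM mulVf// mul1e.
- exact: (measurable_fun_ysection (axis_law m.+1) mP).
- by rewrite lee_fin invr_ge0 ltW// sphere_mass_gt0.
Qed.

End zonal.

(** * Areas cut out by quadratic cones *)

Section reflection.
Context {R : realType}.

(** The reflection in the hyperplane orthogonal to a - e exchanges a and e. *)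
Lemma exists_reflection m (a e : 'rV[R]_m) : dotp a a = dotp e e ->
  exists Q : 'M[R]_m, [/\ Q *m Q^T = 1%:M, a *m Q = e &
    forall x, dotp x a = 0 -> dotp x e = 0 -> x *m Q = x].
Proof.
move=> ae; have [->|ane] := eqVneq a e.
  by exists 1%:M; split; rewrite ?trmx1 ?mulmx1// => x _ _; rewrite mulmx1.
pose v := a - e; have v0 : dotp v v != 0.
  by rewrite -enorm_sqr sqrf_eq0 enorm_eq0 subr_eq0.
have vE x : dotp x v = dotp x a - dotp x e.
  by rewrite /v dotpDr -scaleN1r dotpZr mulN1r.
have vv : dotp v v = 2 * (dotp a a - dotp a e).
  rewrite vE !(dotpC v) !vE ae (dotpC e a); ring.
pose k := 2 / dotp v v; pose Q : 'M[R]_m := 1%:M - k *: (v^T *m v).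
have QE p (x : 'M[R]_(p, m)) : x *m Q = x - k *: (x *m v^T *m v).
  by rewrite /Q mulmxBr mulmx1 -scalemxAr mulmxA.
have dvE (x : 'rV[R]_m) : x *m v^T = (dotp x v)%:M by rewrite [LHS]mx11_scalar.
have xQ (x : 'rV[R]_m) : x *m Q = x - (k * dotp x v) *: v.
  by rewrite QE dvE mul_scalar_mx scalerA.
exists Q; split.
- have -> : Q^T = Q.
    by rewrite /Q linearB /= trmx1 linearZ /= trmx_mul trmxK.
  have Qv : Q *m v^T = - v^T.
    rewrite /Q mulmxBl mul1mx -scalemxAl -mulmxA dvE mul_mx_scalar scalerA.
    rewrite (_ : k * _ = 2); last by rewrite /k divfK.
    by rewrite scaler_nat mulr2n opprD addrA subrr sub0r.
  by rewrite QE Qv mulNmx scalerN opprK /Q subrK.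
- rewrite xQ vE /k vv mulrAC divff ?scale1r; last by rewrite -vv.
  by rewrite opprB addrC subrK.
- by move=> x xa xe; rewrite xQ vE xa xe subrr mulr0 scale0r subr0.
Qed.

Lemma dotp_delta m (x : 'rV[R]_m) i : dotp x (delta_mx ord0 i) = x ord0 i.
Proof.
rewrite dotpE (bigD1 i)//= mxE !eqxx mulr1 big1 ?addr0// => j ji.
by rewrite mxE (negbTE ji) andbF mulr0.
Qed.

Lemma delta_dotp m (i j : 'I_m) :
  dotp (delta_mx ord0 i : 'rV[R]_m) (delta_mx ord0 j) = (i == j)%:R.
Proof. by rewrite dotp_delta mxE eqxx /= eq_sym. Qed.

(** One reflection takes a to its place, and a second one takes the image of b to its
own; the latter fixes the image of a, which is orthogonal to both vectors. *)
Lemma exists_rotation2 m (a b : 'rV[R]_m) (i j : 'I_m) : i != j ->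
  dotp a a = 1 -> dotp a b = 0 ->
  exists Q : 'M[R]_m, [/\ Q *m Q^T = 1%:M, a *m Q = delta_mx ord0 i &
    b *m Q = enorm b *: delta_mx ord0 j].
Proof.
move=> ij a1 ab.
have [|Q1 [Q1Q1 aQ1 _]] := @exists_reflection m a (delta_mx ord0 i).
  by rewrite a1 delta_dotp eqxx.
have [|Q2 [Q2Q2 bQ2 fix2]] := @exists_reflection m (b *m Q1) (enorm b *: delta_mx ord0 j).
  by rewrite dotp_mulmx// dotpZl dotpZr delta_dotp eqxx mulr1 -expr2 enorm_sqr.
exists (Q1 *m Q2); split.
- by rewrite trmx_mul mulmxA -(mulmxA Q1) Q2Q2 mulmx1.
- rewrite mulmxA aQ1 fix2//; last by rewrite dotpZr delta_dotp (negbTE ij) mulr0.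
  by rewrite -aQ1 dotp_mulmx.
- by rewrite mulmxA.
Qed.

End reflection.

Section qcone.
Context {R : realType}.

(** For a unit vector a and b orthogonal to a, the cone around a whose squared slope in
the direction of a unit vector u orthogonal to a is Num.max A (A' + B (u.b)^2). *)
Definition qcone m (a b : 'rV[R]_m) (A A' B : R) : set 'rV[R]_m :=
  [set x | [/\ 0 <= dotp x a,
    A * (dotp x x - dotp x a ^+ 2) <= dotp x a ^+ 2 &
    A' * (dotp x x - dotp x a ^+ 2) + B * dotp x b ^+ 2 <= dotp x a ^+ 2]].

Lemma measurable_dotpl m (a : 'rV[R]_m) :
  measurable_fun setT (fun x : 'rV[R]_m => dotp x a : measurableTypeR R).
Proof.
rewrite (_ : (fun x => _) = (fun x : 'rV[R]_m => \sum_i x ord0 i * a ord0 i)).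
  by apply: measurable_sum => i; apply: measurable_funM => //; exact: measurable_coord.
by apply/funext => x; rewrite dotpE.
Qed.

Lemma measurable_dotpp m :
  measurable_fun setT (fun x : 'rV[R]_m => dotp x x : measurableTypeR R).
Proof.
rewrite (_ : (fun x => _) = (fun x : 'rV[R]_m => \sum_i x ord0 i * x ord0 i)).
  by apply: measurable_sum => i; apply: measurable_funM => //; exact: measurable_coord.
by apply/funext => x; rewrite dotpE.
Qed.

Lemma measurable_ge0 d (T : measurableType d) (f : T -> measurableTypeR R) :
  measurable_fun setT f -> measurable [set x | 0 <= f x].
Proof.
move=> mf; rewrite (_ : [set x | _] = f @^-1` `[0, +oo[); first exact: measurable_preimage.
by apply/seteqP; split => x; rewrite /= in_itv /= andbT.
Qed.

Lemma measurable_qcone m (a b : 'rV[R]_m) A A' B : measurable (qcone a b A A' B).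
Proof.
have ma := measurable_dotpl a; have mb := measurable_dotpl b.
have mx := @measurable_dotpp m.
have ma2 : measurable_fun setT (fun x : 'rV[R]_m => dotp x a ^+ 2 : measurableTypeR R).
  exact: measurable_funX.
have mb2 : measurable_fun setT (fun x : 'rV[R]_m => dotp x b ^+ 2 : measurableTypeR R).
  exact: measurable_funX.
have md : measurable_fun setT (fun x : 'rV[R]_m => dotp x x - dotp x a ^+ 2 : measurableTypeR R).
  exact: measurable_funB.
rewrite (_ : qcone a b A A' B = [set x | 0 <= dotp x a] `&`
  [set x | 0 <= dotp x a ^+ 2 - A * (dotp x x - dotp x a ^+ 2)] `&`
  [set x | 0 <= dotp x a ^+ 2 - (A' * (dotp x x - dotp x a ^+ 2) + B * dotp x b ^+ 2)]).
  apply: measurableI; first apply: measurableI.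
  - exact: measurable_ge0.
  - by apply: measurable_ge0; apply: measurable_funB => //; exact: measurable_funM.
  - apply: measurable_ge0; apply: measurable_funB => //.
    by apply: measurable_funD; exact: measurable_funM.
apply/seteqP; split => x; rewrite /qcone /= !subr_ge0; first by move=> [].
by move=> [[]].
Qed.

(** Height at which the round cone of squared slope w meets the unit sphere. *)
Definition coheight (w : R) : R := Num.sqrt (w / (1 + w)).

Lemma coheight_le (w t : R) : 0 < w ->
  (coheight w <= t) = (0 <= t) && (w * (1 - t ^+ 2) <= t ^+ 2).
Proof.
move=> w0; have w1 : 0 < 1 + w by rewrite addr_gt0.
have [t0|t0] := lerP 0 t; last first.
  by apply/negbTE; rewrite -ltNge (lt_le_trans t0)// sqrtr_ge0.
have -> : (coheight w <= t) = (w / (1 + w) <= t ^+ 2).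
  rewrite /coheight -{1}(ger0_norm t0) -sqrtr_sqr ler_sqrt//.
  by rewrite sqr_ge0.
rewrite ler_pdivrMr//=; apply/idP/idP; lra.
Qed.

Lemma coheight_gt0 w : 0 < w -> 0 < coheight w.
Proof. by move=> w0; rewrite sqrtr_gt0 divr_gt0// addr_gt0. Qed.

Lemma coheight_lt1 w : 0 < w -> coheight w < 1.
Proof.
move=> w0; rewrite -[ltRHS]sqrtr1 ltr_sqrt// ltr_pdivrMr ?addr_gt0// mul1r; lra.
Qed.

Lemma coheight01 w : 0 < w -> 0 < coheight w < 1.
Proof. by move=> w0; rewrite coheight_gt0// coheight_lt1. Qed.

Lemma continuous_coheight w : 0 < w -> {for w, continuous coheight}.
Proof.
move=> w0; apply: (@cvg_comp _ _ _ (fun x : R => x / (1 + x)) (@Num.sqrt R) _ (nbhs (w / (1 + w)))).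
  apply: cvgM; first exact: cvg_id.
  apply: cvgV; first by rewrite gt_eqF// addr_gt0.
  by apply: cvgD; [exact: cvg_cst|exact: cvg_id].
exact: sqrt_continuous.
Qed.

(** Height at which a [qcone] meets the unit sphere, in a direction u with
(u.b)^2 = t. *)
Definition qprofile (A A' B t : R) : R := coheight (Num.max A (A' + B * t)).

Lemma qprofile01 A A' B t : 0 < A -> 0 < qprofile A A' B t < 1.
Proof. by move=> A0; apply: coheight01; rewrite lt_max A0. Qed.

Lemma continuous_qprofile A A' B : 0 < A -> continuous (fun x : R => qprofile A A' B (x ^+ 2)).
Proof.
move=> A0 x; rewrite /qprofile.
apply: (@cvg_comp _ _ _ (fun x : R => Num.max A (A' + B * x ^+ 2)) coheight _
  (nbhs (Num.max A (A' + B * x ^+ 2)))); last by apply: continuous_coheight; rewrite lt_max A0.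
have c2 : {for x, continuous (fun x : R => A' + B * x ^+ 2)}.
  apply: cvgD; first exact: cvg_cst.
  by apply: cvgM; [exact: cvg_cst|exact: exprn_continuous].
by apply: (@continuous_max _ _ (cst A) (fun x : R => A' + B * x ^+ 2)) => //; exact: cvg_cst.
Qed.

Lemma continuous_cap_area p c : 0 < c < 1 -> {for c, continuous (@cap_area R p)}.
Proof.
move=> c01; apply: cvgM; last exact: cvg_cst.
apply: cvgD; first by apply: cvgM; [exact: cvg_id|exact: continuous_axdistX].
apply: cvgM; first exact: cvg_cst.
have h := is_derive_axdist_int p c01.
by apply: differentiable_continuous; apply/derivable1_diffP; exact: ex_derive.
Qed.

Lemma cap_area_ge0 p c : 0 < c < 1 -> 0 <= cap_area p c :> R.
Proof.
move=> /andP[c0 _]; rewrite /cap_area divr_ge0// addr_ge0// mulr_ge0//.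
- exact: ltW.
- by rewrite exprn_ge0// axdist_ge0.
- exact: axdist_int_ge0.
Qed.

Lemma continuous_cap_area_qprofile p A A' B : 0 < A ->
  continuous (fun x : R => cap_area p (qprofile A A' B (x ^+ 2))).
Proof.
move=> A0 x; apply: (@cvg_comp _ _ _ (fun x : R => qprofile A A' B (x ^+ 2)) (cap_area p) _
  (nbhs (qprofile A A' B (x ^+ 2)))); first exact: continuous_qprofile.
by apply: continuous_cap_area; exact: qprofile01.
Qed.

(** The cone is the region above a latitude which depends on one coordinate of the
longitude. *)
Lemma sphere_qcone_canonical m A A' B beta : 0 < A ->
  @sphere_measure R m.+2 (qcone (delta_mx ord0 ord0)
    (beta *: delta_mx ord0 (rshift 1 (ord0 : 'I_m.+1))) A A' B) =
  (\int[axis_law m]_v (cap_area m.+1 (qprofile A A' (B * beta ^+ 2) (v ^+ 2)))%:E)%E.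
Proof.
move=> A0; pose g (v : 'rV[R]_m.+1) : measurableTypeR R :=
  qprofile A A' (B * beta ^+ 2) (v ord0 ord0 ^+ 2).
have mg1 : measurable_fun setT (fun x : measurableTypeR R =>
    qprofile A A' (B * beta ^+ 2) (x ^+ 2) : measurableTypeR R).
  by apply: continuous_measurable_fun; exact: continuous_qprofile.
have mg : measurable_fun setT g.
  exact: (measurableT_comp mg1 (@measurable_coord R m.+1 ord0)).
have g01 v : 0 < g v < 1 by exact: qprofile01.
transitivity (\int[@sphere_measure R m.+1]_v (cap_area m.+1 (g v))%:E)%E; last first.
  apply: esym; apply: (@integral_axis_law R m (fun x : R => (cap_area m.+1 (qprofile A A' (B * beta ^+ 2) (x ^+ 2)))%:E)).
    apply/measurable_EFinP; apply: continuous_measurable_fun.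
    exact: continuous_cap_area_qprofile.
  by move=> x; rewrite lee_fin cap_area_ge0// qprofile01.
apply: etrans _ (sphere_zonal mg g01); apply: eq_sphere_measure => x x1.
rewrite -[x]uncons_rVK; case: (uncons_rV x) (uncons_rVK x) => t y xE.
have ty1 : t ^+ 2 + enorm y ^+ 2 = 1 by rewrite -enorm_cons xE x1 expr1n.
have lE : latlong (cons_rV (t, y)) = (t, normalize y) by rewrite /latlong cons_rVK cons_rV0.
rewrite /qcone /mkset lE !dotpZr !dotp_delta cons_rVS cons_rV0.
have -> : dotp (cons_rV (t, y)) (cons_rV (t, y)) = 1 by rewrite -enorm_sqr xE x1 expr1n.
have yE := sqr_coord_direction ty1.
have s0 : 0 <= 1 - t ^+ 2 by have := sqr_ge0 (enorm y); lra.
rewrite /g /= /qprofile coheight_le ?lt_max ?A0//.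
move: (normalize y ord0 ord0) yE => v yE.
rewrite exprMn yE maxr_pMl// ge_max.
have -> : (A' + B * beta ^+ 2 * v ^+ 2) * (1 - t ^+ 2) =
    A' * (1 - t ^+ 2) + B * (beta ^+ 2 * ((1 - t ^+ 2) * v ^+ 2)) by ring.
by split => [[-> -> ->]|/and3P[-> -> ->]].
Qed.

Lemma sphere_qcone m (a b : 'rV[R]_m.+2) A A' B : 0 < A -> dotp a a = 1 -> dotp a b = 0 ->
  sphere_measure (qcone a b A A' B) =
  (\int[axis_law m]_v (cap_area m.+1 (qprofile A A' (B * dotp b b) (v ^+ 2)))%:E)%E.
Proof.
move=> A0 a1 ab.
have [Q [QQ aQ bQ]] := @exists_rotation2 R m.+2 a b ord0 (rshift 1 (ord0 : 'I_m.+1)) isT a1 ab.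
rewrite -enorm_sqr; apply: etrans _ (@sphere_qcone_canonical m A A' B (enorm b) A0).
apply: etrans _ (sphere_measure_rotate QQ (measurable_qcone _ _ _ _ _)).
apply: eq_sphere_measure => x _.
by rewrite /mkset -aQ -bQ /qcone /= !dotp_mulmx.
Qed.

End qcone.

(** * Convexity and closedness of quadratic cones *)

Section bodies.
Context {R : realType}.

(** The triangle inequality for the seminorm of a positive semidefinite form. For
Cauchy-Schwarz, the form is expanded at t x - s y; as s and t may vanish, both are
enlarged by an arbitrarily small d. *)
Lemma psd_form_add_le (V : lmodType R) (q : V -> V -> R) (s t : R) (x y : V) :
  (forall u v, q u v = q v u) -> (forall u v w, q (u + v) w = q u w + q v w) ->
  (forall c u v, q (c *: u) v = c * q u v) -> (forall u, 0 <= q u u) ->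
  0 <= s -> 0 <= t -> q x x <= s ^+ 2 -> q y y <= t ^+ 2 ->
  q (x + y) (x + y) <= (s + t) ^+ 2.
Proof.
move=> qC qD qZ q0 s0 t0 qx qy.
suff qxy : q x y <= s * t.
  rewrite qD (qC x) (qC y) !qD (qC y x); have -> : (s + t) ^+ 2 = s ^+ 2 + t ^+ 2 + 2 * (s * t) by ring.
  lra.
have key d : 0 < d -> q x y <= (s + d) * (t + d).
  move=> d0; have := q0 ((t + d) *: x - (s + d) *: y).
  rewrite -scaleNr qD !qZ !(qC _ (_ + _)) !qD !qZ (qC y x) => h.
  have td : 0 < t + d by lra.
  have sd : 0 < s + d by lra.
  have h1 : (t + d) ^+ 2 * q x x <= (t + d) ^+ 2 * (s + d) ^+ 2.
    rewrite ler_wpM2l ?sqr_ge0// (le_trans qx)// ler_sqr ?nnegrE//; lra.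
  have h2 : (s + d) ^+ 2 * q y y <= (t + d) ^+ 2 * (s + d) ^+ 2.
    rewrite mulrC ler_wpM2r ?sqr_ge0// (le_trans qy)// ler_sqr ?nnegrE//; lra.
  have P : 0 < (s + d) * (t + d) by rewrite mulr_gt0.
  rewrite -(ler_pM2l P); move: h h1 h2; set X := q x x; set Y := q y y; set Z := q x y.
  move=> h h1 h2; nra.
apply/ler_addgt0Pr => e e0.
pose d := Num.min 1 (e / (s + t + 1)).
have st : 0 < s + t + 1 by lra.
have d0 : 0 < d by rewrite lt_min ltr01 divr_gt0.
have d1 : d <= 1 by rewrite ge_min lexx.
have de : d * (s + t + 1) <= e.
  by rewrite -ler_pdivlMr// ge_min lexx orbT.
have := key d d0; nra.
Qed.

Lemma dotp_proj_ge0 m (a x : 'rV[R]_m) : dotp a a = 1 -> 0 <= dotp x x - dotp x a ^+ 2.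
Proof.
move=> a1; have := dotp_ge0 (x - dotp x a *: a).
rewrite -scaleNr !dotpDl !dotpDr !dotpZl !dotpZr a1 (dotpC a x); congr (_ <= _); ring.
Qed.

(** Each inequality bounds a seminorm of x by the linear form dotp x a. *)
Lemma qcone_convex m (a b : 'rV[R]_m) A A' B : dotp a a = 1 ->
  0 <= A -> 0 <= A' -> 0 <= B ->
  convex_set (qcone a b A A' B : set (convex_lmodType 'rV[R]_m)) /\
  forall (t : R) x, 0 < t -> qcone a b A A' B x -> qcone a b A A' B (t *: x).
Proof.
move=> a1 A0 A'0 B0.
have scale (t : R) x : 0 <= t -> qcone a b A A' B x -> qcone a b A A' B (t *: x).
  move=> t0 [x0 x1 x2]; split; rewrite !(dotpZl, dotpZr).
  - by rewrite mulr_ge0.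
  - have := ler_wpM2l (sqr_ge0 t) x1; congr (_ <= _); ring.
  - have := ler_wpM2l (sqr_ge0 t) x2; congr (_ <= _); ring.
have add x y : qcone a b A A' B x -> qcone a b A A' B y -> qcone a b A A' B (x + y).
  pose q (A B : R) (u v : 'rV[R]_m) := A * (dotp u v - dotp u a * dotp v a) + B * (dotp u b * dotp v b).
  have qs C D s t : 0 <= C -> 0 <= D -> 0 <= s -> 0 <= t -> q C D x x <= s ^+ 2 -> q C D y y <= t ^+ 2 ->
      q C D (x + y) (x + y) <= (s + t) ^+ 2.
    move=> C0 D0; apply: psd_form_add_le => [u v|u v w|c u v|u]; rewrite /q.
    - by rewrite (dotpC v u); ring.
    - by rewrite !dotpDl; ring.
    - by rewrite !dotpZl; ring.
    - by rewrite addr_ge0// mulr_ge0// -?expr2 ?sqr_ge0// dotp_proj_ge0.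
  move=> [x0 x1 x2] [y0 y1 y2]; split.
  - by rewrite dotpDl addr_ge0.
  - have := qs A 0 _ _ A0 (lexx 0) x0 y0; rewrite /q !mul0r !addr0 -!expr2 -dotpDl; exact.
  - have := qs A' B _ _ A'0 B0 x0 y0; rewrite /q -!expr2 -dotpDl; exact.
split=> [x y l|t x t0]; last by apply: scale; exact: ltW.
rewrite !inE => xC yC.
by apply: add; apply: scale => //; rewrite subr_ge0.
Qed.

Lemma continuous_dotpl m (a : 'rV[R]_m) : continuous (fun x : 'rV[R]_m => dotp x a).
Proof.
rewrite (_ : (fun x => _) = (fun x : 'rV[R]_m => \sum_i x ord0 i * a ord0 i)).
  apply: continuous_big => [|i _ x]; first exact: add_continuous.
  apply: (@continuousM _ _ (fun x : 'rV[R]_m => x ord0 i) (cst (a ord0 i))).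
    exact: coord_continuous.
  exact: cst_continuous.
by apply/funext => y; rewrite dotpE.
Qed.

Lemma continuous_dotpp m : continuous (fun x : 'rV[R]_m => dotp x x).
Proof.
rewrite (_ : (fun x => _) = (fun x : 'rV[R]_m => \sum_i x ord0 i * x ord0 i)).
  apply: continuous_big => [|i _ x]; first exact: add_continuous.
  by apply: (@continuousM _ _ (fun x : 'rV[R]_m => x ord0 i) (fun x : 'rV[R]_m => x ord0 i)); exact: coord_continuous.
by apply/funext => y; rewrite dotpE.
Qed.

Lemma continuous_sqr (T : topologicalType) (f : T -> R) :
  continuous f -> continuous (fun x => f x ^+ 2).
Proof. by move=> cf x; apply: (@continuousM _ _ f f); exact: cf. Qed.

Lemma closed_ge0 (T : topologicalType) (f : T -> R) : continuous f -> closed [set x | 0 <= f x].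
Proof.
move=> cf; rewrite (_ : [set x | _] = f @^-1` [set y | 0 <= y]); last by [].
by apply: preimage_closed => [x _|]; [exact: cf|exact: closed_ge].
Qed.

Lemma closed_qcone m (a b : 'rV[R]_m) A A' B : closed (qcone a b A A' B).
Proof.
have ca := @continuous_dotpl m a; have cb := @continuous_dotpl m b; have cx := @continuous_dotpp m.
have ca2 := continuous_sqr ca; have cb2 := continuous_sqr cb.
have cd C : continuous (fun x : 'rV[R]_m => C * (dotp x x - dotp x a ^+ 2)).
  move=> x; apply: (@continuousM _ _ (cst C) (fun x : 'rV[R]_m => dotp x x - dotp x a ^+ 2)).
    exact: cst_continuous.
  by apply: (@continuousB _ _ _ (fun x : 'rV[R]_m => dotp x x)); [exact: cx|exact: ca2].
rewrite (_ : qcone a b A A' B = [set x | 0 <= dotp x a] `&`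
  [set x | 0 <= dotp x a ^+ 2 - A * (dotp x x - dotp x a ^+ 2)] `&`
  [set x | 0 <= dotp x a ^+ 2 - (A' * (dotp x x - dotp x a ^+ 2) + B * dotp x b ^+ 2)]).
  apply: closedI; first apply: closedI.
  - exact: closed_ge0.
  - apply: closed_ge0 => x; apply: (@continuousB _ _ _ (fun x : 'rV[R]_m => dotp x a ^+ 2)).
      exact: ca2.
    exact: cd.
  - apply: closed_ge0 => x; apply: (@continuousB _ _ _ (fun x : 'rV[R]_m => dotp x a ^+ 2)).
      exact: ca2.
    apply: (@continuousD _ _ _ (fun x : 'rV[R]_m => A' * (dotp x x - dotp x a ^+ 2))).
      exact: cd.
    apply: (@continuousM _ _ (cst B) (fun x : 'rV[R]_m => dotp x b ^+ 2)).
      exact: cst_continuous.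
    exact: cb2.
apply/seteqP; split => x; rewrite /qcone /= !subr_ge0; first by move=> [].
by move=> [[]].
Qed.

Lemma closed_usphere m : closed (@usphere R m).
Proof.
rewrite (_ : usphere = [set x | 0 <= dotp x x - 1] `&` [set x : 'rV[R]_m | 0 <= 1 - dotp x x]).
  apply: closedI; apply: closed_ge0 => x.
    apply: (@continuousB _ _ _ (fun x : 'rV[R]_m => dotp x x) (cst 1)).
      exact: continuous_dotpp.
    exact: cst_continuous.
  apply: (@continuousB _ R _ (fun=> 1 : R) (fun x : 'rV[R]_m => dotp x x)).
    exact: cst_continuous.
  exact: continuous_dotpp.
apply/seteqP; split => x; rewrite /usphere /= -enorm_sqr.
  by move=> ->; rewrite expr1n subrr.
rewrite !subr_ge0 => -[h1 h2]; apply/eqP.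
by rewrite -(@eqrXn2 _ 2)// ?enorm_ge0// expr1n eq_le h1 h2.
Qed.

End bodies.

(** * A family of bodies and their central sections *)

Section qbody.
Context {R : realType}.

Definition qaxis n : 'rV[R]_n.+1 := delta_mx ord0 ord0.

(** In the central projection from the center of the sphere to the tangent hyperplane
at the pole, A' = A gives ellipsoids of revolution (for B >= 0), and A' = 0 gives
balls cut by two parallel hyperplanes at the same distance from the origin. *)
Definition qbody n (A A' B : R) : set 'rV[R]_(1 + n.+1) :=
  @hemisphere R n.+1 `&` qcone (pole n.+1) (tangent (qaxis n)) A A' B.

Lemma dotp_row n (a b : R) (x y : 'rV[R]_n) :
  dotp (row_mx a%:M x : 'rV_(1 + n)) (row_mx b%:M y) = a * b + dotp x y.
Proof.
by rewrite /dotp tr_row_mx mul_row_col tr_scalar_mx -scalar_mxM !mxE eqxx mulr1n.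
Qed.

Lemma row_mx0_scalar n (y : 'rV[R]_n) : row_mx 0 y = row_mx 0%:M y :> 'rV_(1 + n).
Proof. by rewrite raddf0. Qed.

Lemma pole_pole n : dotp (pole n) (pole n) = 1 :> R.
Proof. by rewrite dotp_row mulr1 /dotp mul0mx mxE addr0. Qed.

Lemma pole_tangent n (xi : 'rV[R]_n) : dotp (pole n) (tangent xi) = 0.
Proof. by rewrite /tangent row_mx0_scalar dotp_row mulr0 /dotp mul0mx mxE addr0. Qed.

Lemma tangent_tangent n (x y : 'rV[R]_n) : dotp (tangent x) (tangent y) = dotp x y.
Proof. by rewrite /tangent !row_mx0_scalar dotp_row mulr0 add0r. Qed.

Lemma qaxis_qaxis n : dotp (qaxis n) (qaxis n) = 1.
Proof. by rewrite delta_dotp eqxx. Qed.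

Lemma qbody_sphereP n A A' B (x : 'rV[R]_(1 + n.+1)) : enorm x = 1 ->
  qbody A A' B x <-> qcone (pole n.+1) (tangent (qaxis n)) A A' B x.
Proof. by move=> x1; split => [[]//|q]; split => //; split => //; case: q. Qed.

Lemma vol_qbody n A A' B : 0 < A ->
  vol (@qbody n A A' B) =
  (\int[axis_law n]_v (cap_area n.+1 (qprofile A A' B (v ^+ 2)))%:E)%E.
Proof.
move=> A0.
have E := @sphere_qcone R n (pole n.+1) (tangent (qaxis n)) A A' B A0 (pole_pole _) (pole_tangent _).
rewrite tangent_tangent qaxis_qaxis mulr1 in E.
apply: etrans _ E; apply: eq_sphere_measure => x x1; exact: qbody_sphereP.
Qed.

(** The reflection that moves the tangent vector to the first basis vector is an
orthogonal matrix having that tangent vector as first row. *)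
Lemma exists_frame n (xi : 'rV[R]_n) : dotp xi xi = 1 -> exists Q, is_frame xi Q.
Proof.
move=> xi1.
have [|O [OO tO _]] := @exists_reflection R (1 + n) (tangent xi) (row_mx 1%:M 0).
  by rewrite tangent_tangent xi1 dotp_row mulr1 /dotp mul0mx mxE addr0.
pose P := O^T; have PP : P *m P^T = 1%:M by rewrite /P trmxK; exact: orthogonal_inv.
have tP : tangent xi = usubmx P.
  have -> : tangent xi = row_mx 1%:M 0 *m P by rewrite -tO -mulmxA OO mulmx1.
  by rewrite -{1}[P]vsubmxK mul_row_col mul1mx mul0mx addr0.
exists (dsubmx P).
move: PP; rewrite -{1 2}[P]vsubmxK tr_col_mx mul_col_row scalar_mx_block.
by move=> /eq_block_mx[_ h1 _ h2]; split => //; rewrite tP h1.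
Qed.

(** A frame completed by the tangent vector is an orthogonal matrix. *)
Lemma frame_complete n (xi : 'rV[R]_n) Q : dotp xi xi = 1 -> is_frame xi Q ->
  Q^T *m Q = 1%:M - (tangent xi)^T *m tangent xi.
Proof.
move=> xi1 [QQ tQ].
have PP : col_mx (tangent xi) Q *m (col_mx (tangent xi) Q)^T = 1%:M.
  rewrite tr_col_mx mul_col_row QQ tQ scalar_mx_block.
  have -> : Q *m (tangent xi)^T = 0 by rewrite -[LHS]trmxK trmx_mul trmxK tQ trmx0.
  congr block_mx; rewrite [LHS]mx11_scalar.
  by rewrite -[X in X%:M]/(dotp (tangent xi) (tangent xi)) tangent_tangent xi1.
have := orthogonal_inv PP; rewrite tr_col_mx mul_row_col => <-.
by rewrite addrAC subrr add0r.
Qed.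

Lemma dotp_frame n (xi : 'rV[R]_n) Q (x y : 'rV[R]_(1 + n)) :
  dotp xi xi = 1 -> is_frame xi Q ->
  dotp (x *m Q^T) (y *m Q^T) = dotp x y - dotp x (tangent xi) * dotp y (tangent xi).
Proof.
move=> xi1 fQ; rewrite {1}/dotp trmx_mul trmxK mulmxA -(mulmxA x) (frame_complete xi1 fQ).
have -> : x *m (1%:M - (tangent xi)^T *m tangent xi) = x - dotp x (tangent xi) *: tangent xi.
  rewrite mulmxBr mulmx1 mulmxA; congr (_ - _).
  by rewrite [x *m _]mx11_scalar mul_scalar_mx.
rewrite -/(dotp _ y) -scaleNr dotpDl dotpZl (dotpC _ y) mulNr.
by rewrite (dotpC (tangent xi) y) (dotpC y x).
Qed.

Lemma dotp_mulmx_tr m p (u : 'rV[R]_m) (Q : 'M[R]_(m, p)) (a : 'rV[R]_p) :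
  dotp (u *m Q) a = dotp u (a *m Q^T).
Proof. by rewrite /dotp trmx_mul trmxK mulmxA. Qed.

Lemma qprofileM (A A' B s t : R) : qprofile A A' (B * s) t = qprofile A A' B (s * t).
Proof. by rewrite /qprofile mulrA. Qed.

(** In the coordinates of a frame the section is again cut out by a [qcone], in which b is
the projection to the hyperplane, of squared length 1 - xi_0^2. *)
Lemma vol_perp_qbody n A A' B (xi : 'rV[R]_n.+2) : 0 < A -> enorm xi = 1 ->
  vol_perp xi (qbody A A' B `&` perp xi) =
  (\int[axis_law n]_v (cap_area n.+1 (qprofile A A' B ((1 - xi ord0 ord0 ^+ 2) * v ^+ 2)))%:E)%E.
Proof.
move=> A0 xi1; have xx : dotp xi xi = 1 by rewrite -enorm_sqr xi1 expr1n.
have [Q0 fQ0] := exists_frame xx; rewrite /vol_perp.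
have := getPex (ex_intro _ Q0 fQ0 : exists Q, is_frame xi Q); move: (get _) => Q fQ.
have [QQ tQ] := fQ.
have E := @sphere_qcone R n (pole n.+2 *m Q^T) (tangent (qaxis n.+1) *m Q^T) A A' B A0.
rewrite !(dotp_frame _ _ xx fQ) !tangent_tangent qaxis_qaxis pole_pole !pole_tangent in E.
rewrite mulr0 mul0r !subr0 (dotpC (qaxis _)) dotp_delta -expr2 in E.
apply: etrans (etrans _ (E erefl erefl)) _; last first.
  apply: eq_integral => v _; rewrite qprofileM; reflexivity.
apply: eq_sphere_measure => u u1.
have uQ : enorm (u *m Q) = 1 by rewrite enorm_mulmx.
have uu : dotp (u *m Q) (u *m Q) = dotp u u by rewrite dotp_mulmx.
rewrite /mkset; split.
  by move=> [/(qbody_sphereP _ _ _ uQ) + _]; rewrite /qcone /mkset uu !dotp_mulmx_tr.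
move=> h.
have hu : qcone (pole n.+2) (tangent (qaxis n.+1)) A A' B (u *m Q).
  by move: h; rewrite /qcone /mkset uu !dotp_mulmx_tr.
split; first exact/(qbody_sphereP _ _ _ uQ).
split; last by rewrite dotp_mulmx_tr tQ /dotp trmx0 mulmx0 mxE.
by split => //; case: hu.
Qed.

End qbody.

(** * Means of functions of a squared coordinate *)

Section sqlaw.
Context {R : realType}.

Lemma measurable_sqcoord n :
  measurable_fun setT (fun x : 'rV[R]_n.+1 => x ord0 ord0 ^+ 2 : measurableTypeR R).
Proof. by apply: measurable_funX; exact: measurable_coord. Qed.

(** Law of the square of a coordinate of a uniform unit vector of R^(n+1). *)
Definition sqlaw n : {measure set (measurableTypeR R) -> \bar R} :=
  mscale (NngNum (ltW (etrans (invr_gt0 _) (@sphere_mass_gt0 R n))))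
    (image_measure (@sphere_measure R n.+1) (@measurable_sqcoord n)).

Definition sqmean n (f : R -> R) : R := \int[sqlaw n]_(t in `[0, 1]) f t.

Lemma sqcoord_usphere n (x : 'rV[R]_n.+1) : enorm x = 1 -> x ord0 ord0 ^+ 2 <= 1.
Proof. by move=> x1; rewrite (le_trans (coord_le_enorm x ord0))// x1 expr1n. Qed.

Lemma sqlaw_integral_sphere n (f : R -> R) : measurable_fun setT f -> (forall t, 0 <= f t) ->
  (\int[sqlaw n]_(t in `[0%R, 1%R]) (f t)%:E =
   (sphere_mass n.+1)^-1%:E * \int[@sphere_measure R n.+1]_x (f (x ord0 ord0 ^+ 2))%:E)%E.
Proof.
move=> mf f0.
rewrite ge0_integral_mscale//; last 2 first.
- exact/measurable_EFinP/measurable_funTS.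
- by move=> t _; rewrite lee_fin.
congr (_ * _)%E.
rewrite (@ge0_integral_pushforward _ _ _ _ R _ (@measurable_sqcoord n) (@sphere_measure R n.+1))//; last 2 first.
- exact/measurable_EFinP/measurable_funTS.
- by move=> t _; rewrite lee_fin.
set D := _ @^-1` _.
have mD : measurable D by exact: (measurable_preimage (@measurable_sqcoord n)).
have mF : measurable_fun setT (fun x : 'rV[R]_n.+1 => (f (x ord0 ord0 ^+ 2))%:E).
  by apply/measurable_EFinP; exact: (measurableT_comp mf (@measurable_sqcoord n)).
have Z : @sphere_measure R n.+1 (~` D) = 0%E.
  rewrite (@eq_sphere_measure R n.+1 _ set0); first exact: measure0.
  move=> x x1; split => //; apply; rewrite /D /= in_itv /= sqr_ge0.
  exact: sqcoord_usphere.
have -> := @ge0_negligible_integral _ _ R (@sphere_measure R n.+1) setT (~` D) _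
  (measurableC mD) measurableT mF _ Z.
  by rewrite setDE setCK setTI.
by move=> x _; rewrite lee_fin.
Qed.

Lemma sqlaw_integral n (f : R -> R) : measurable_fun setT f -> (forall t, 0 <= f t) ->
  (\int[sqlaw n]_(t in `[0%R, 1%R]) (f t)%:E =
   (sphere_mass n.+1)^-1%:E * \int[axis_law n]_x (f (x ^+ 2))%:E)%E.
Proof.
move=> mf f0; rewrite sqlaw_integral_sphere//; congr (_ * _)%E.
apply: esym; apply: (@integral_axis_law R n (fun x : R => (f (x ^+ 2))%:E)).
  by apply/measurable_EFinP; apply: measurableT_comp mf _; exact: measurable_funX.
by move=> x; rewrite lee_fin.
Qed.

Lemma sqlaw01 n : sqlaw n `[0%R, 1%R]%classic = 1%E.
Proof.
rewrite -[LHS]mul1e -integral_cst//.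
have := @sqlaw_integral_sphere n (cst 1) (measurable_cst _) (fun _ => ler01).
rewrite /= => ->; rewrite integral_cst// mul1e.
transitivity ((@sphere_mass R n.+1)^-1%:E * (@sphere_mass R n.+1)%:E)%E.
  by congr (_ * _)%E; exact: esym (sphere_massE _).
by rewrite -EFinM mulVf// gt_eqF// sphere_mass_gt0.
Qed.

(** A class of functions, stable under ring operations, for which [sqmean] is linear. *)
Definition bmeas (f : R -> R) := measurable_fun setT (f : measurableTypeR R -> measurableTypeR R) /\
  exists M, forall t, 0 <= t <= 1 -> `|f t| <= M.

Lemma bmeas_integrable n f : bmeas f -> (sqlaw n).-integrable `[0, 1] (EFin \o f).
Proof.
move=> [mf [M fM]]; apply: measurable_bounded_integrable => //.
- by rewrite [X in (X < _)%E]sqlaw01 ltry.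
- exact: measurable_funTS.
- exists M; split; first by rewrite num_real.
  move=> x Mx t; rewrite /= in_itv /= => /fM h; exact: le_trans h (ltW Mx).
Qed.

Lemma sqmean_EFin n f : bmeas f -> (\int[sqlaw n]_(t in `[0%R, 1%R]) (f t)%:E = (sqmean n f)%:E)%E.
Proof.
move=> bf; rewrite /sqmean /Rintegral fineK//.
by apply: integrable_fin_num => //; exact: bmeas_integrable.
Qed.

Lemma bmeas_continuous f : continuous f -> bmeas f.
Proof.
move=> cf; split; first exact: continuous_measurable_fun.
have := @compact_bounded R R (f @` `[0, 1]%classic).
case.
  apply: continuous_compact; last exact: segment_compact.
  exact: continuous_subspaceT.
move=> M [_ MB]; exists (M + 1) => t t01; apply: MB; first by rewrite ltrDl.
by exists t => //=; rewrite in_itv.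
Qed.

Lemma bmeas_cst c : bmeas (cst c).
Proof. by apply: bmeas_continuous => x; exact: cst_continuous. Qed.

Lemma bmeasD f g : bmeas f -> bmeas g -> bmeas (fun t => f t + g t).
Proof.
move=> [mf [M fM]] [mg [N gN]]; split; first exact: measurable_funD.
by exists (M + N) => t t01; rewrite (le_trans (ler_normD _ _))// lerD ?fM ?gN.
Qed.

Lemma bmeasM f g : bmeas f -> bmeas g -> bmeas (fun t => f t * g t).
Proof.
move=> [mf [M fM]] [mg [N gN]]; split; first exact: measurable_funM.
by exists (M * N) => t t01; rewrite normrM ler_pM// ?fM ?gN.
Qed.

Lemma bmeasZ c f : bmeas f -> bmeas (fun t => c * f t).
Proof. by move=> bf; apply: bmeasM => //; exact: bmeas_cst. Qed.

Lemma bmeasB f g : bmeas f -> bmeas g -> bmeas (fun t => f t - g t).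
Proof.
move=> bf bg; rewrite (_ : (fun t => _) = (fun t => f t + (-1) * g t)).
  by apply: bmeasD => //; exact: bmeasZ.
by apply/funext => t; rewrite mulN1r.
Qed.

Lemma bmeasX f k : bmeas f -> bmeas (fun t => f t ^+ k).
Proof.
move=> bf; elim: k => [|k IH].
  rewrite (_ : (fun t => _) = cst 1); first exact: bmeas_cst.
  by apply/funext => t; rewrite expr0.
rewrite (_ : (fun t => _) = (fun t => f t * f t ^+ k)); first exact: bmeasM.
by apply/funext => t; rewrite exprS.
Qed.

Lemma bmeas_indic (A : set (measurableTypeR R)) : measurable A -> bmeas (\1_A : R -> R).
Proof.
move=> mA; split; first exact: measurable_indic.
by exists 1 => t _; rewrite indicE ger0_norm// lern1 leq_b1.
Qed.

Lemma sqmean_cst n c : sqmean n (cst c) = c.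
Proof. by rewrite /sqmean Rintegral_cst// [X in fine X]sqlaw01 mulr1. Qed.

Lemma sqmeanD n f g : bmeas f -> bmeas g -> sqmean n (fun t => f t + g t) = sqmean n f + sqmean n g.
Proof. by move=> bf bg; rewrite /sqmean RintegralD//; exact: bmeas_integrable. Qed.

Lemma sqmeanB n f g : bmeas f -> bmeas g -> sqmean n (fun t => f t - g t) = sqmean n f - sqmean n g.
Proof. by move=> bf bg; rewrite /sqmean RintegralB//; exact: bmeas_integrable. Qed.

Lemma sqmeanZ n c f : bmeas f -> sqmean n (fun t => c * f t) = c * sqmean n f.
Proof. by move=> bf; rewrite /sqmean RintegralZl//; exact: bmeas_integrable. Qed.

Lemma sqmean_le n f g : bmeas f -> bmeas g -> (forall t, 0 <= t <= 1 -> f t <= g t) ->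
  sqmean n f <= sqmean n g.
Proof.
move=> bf bg fg; apply: le_Rintegral => //; try exact: bmeas_integrable.
Qed.

Lemma eq_Ex n f g : (forall t, 0 <= t <= 1 -> f t = g t) -> sqmean n f = sqmean n g.
Proof. by move=> fg; apply: eq_Rintegral => t; rewrite inE /= in_itv /= => /fg. Qed.

Lemma sqmean_ge0 n f : (forall t, 0 <= t <= 1 -> 0 <= f t) -> 0 <= sqmean n f.
Proof. by move=> f0; apply: Rintegral_ge0 => t; rewrite /= in_itv; exact: f0. Qed.

Lemma sqmean_normr n f : bmeas f -> `|sqmean n f| <= sqmean n (fun t => `|f t|).
Proof. by move=> bf; apply: le_normr_Rintegral => //; exact: bmeas_integrable. Qed.

End sqlaw.

Section formulas.
Context {R : realType}.

Lemma continuous_scale (c : R) (f : R -> R) : continuous f -> continuous (fun v => f (c * v)).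
Proof.
move=> cf x; apply: (@cvg_comp _ _ _ (fun v : R => c * v) f _ (nbhs (c * x))); last exact: cf.
by apply: cvgM; [exact: cvg_cst|exact: cvg_id].
Qed.

(** The mean of f (x_0^2) over the unit vectors x of R^(n+2) orthogonal to xi, where
xi_0^2 = t: the first basis vector projects to a vector of squared length 1 - t of
the hyperplane. *)
Definition slice_mean n (f : R -> R) (t : R) : R := sqmean n (fun v => f ((1 - t) * v)).

Lemma slice_mean_EFin n (f : R -> R) (t : R) : continuous f -> (forall t, 0 <= f t) ->
  ((slice_mean n f t)%:E = (@sphere_mass R n.+1)^-1%:E *
     \int[axis_law n]_x (f ((1 - t) * x ^+ 2))%:E)%E.
Proof.
move=> cf f0; have cg := @continuous_scale (1 - t) f cf.
rewrite -sqmean_EFin; last exact: bmeas_continuous.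
by rewrite sqlaw_integral//; exact: continuous_measurable_fun.
Qed.

Lemma bmeas_slice_mean n (f : R -> R) : continuous f -> (forall t, 0 <= f t) -> bmeas (slice_mean n f).
Proof.
move=> cf f0; split.
  apply/measurable_EFinP; rewrite (_ : _ \o _ = (fun t => (@sphere_mass R n.+1)^-1%:E *
     \int[axis_law n]_x (f ((1 - t) * x ^+ 2))%:E)%E); last first.
    by apply/funext => t; exact: slice_mean_EFin.
  apply: measurable_funeM.
  apply: (@measurable_fun_fubini_tonelli_F _ _ _ _ R (axis_law n)
    (fun p : measurableTypeR R * measurableTypeR R => (f ((1 - p.1) * p.2 ^+ 2))%:E)).
    apply/measurable_EFinP; apply: (measurableT_comp (continuous_measurable_fun cf)).
    apply: measurable_funM; first exact: measurable_funB.
    by apply: measurable_funX; exact: measurable_snd.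
  by move=> p; rewrite lee_fin.
have [_ [M fM]] := bmeas_continuous cf; exists M => t /andP[t0 t1].
have bg : bmeas (fun v => f ((1 - t) * v)) by apply: bmeas_continuous; exact: continuous_scale.
apply: le_trans (sqmean_normr n bg) _; rewrite -[leRHS](sqmean_cst n M).
apply: sqmean_le.
- split; first by apply: measurableT_comp => //; case: bg.
  by case: bg => _ [N fN]; exists N => v /fN; rewrite normr_id.
- exact: bmeas_cst.
- move=> v /andP[v0 v1]; apply: fM; apply/andP; split; first by rewrite mulr_ge0// subr_ge0.
  by rewrite mulr_ile1// ?subr_ge0// gerBl.
Qed.

(** For a uniform unit vector with latitude t and longitude v, the number
(1 - t^2) v_0^2 is the square of its second coordinate, which has the same law as
the square of the first one. *)
Lemma sqmean_slice_mean n (f : R -> R) : continuous f -> (forall t, 0 <= f t) -> sqmean n.+1 (slice_mean n f) = sqmean n.+1 f.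
Proof.
move=> cf f0; apply: EFin_inj.
have mf := continuous_measurable_fun cf.
have M1 : @sphere_mass R n.+1 != 0 by rewrite gt_eqF// sphere_mass_gt0.
rewrite -!sqmean_EFin; [|exact: bmeas_continuous|exact: bmeas_slice_mean].
rewrite [RHS]sqlaw_integral_sphere// sqlaw_integral; last 2 first.
- by case: (bmeas_slice_mean n cf f0).
- by move=> t; apply: sqmean_ge0.
congr (_ * _)%E.
pose F (p : measurableTypeR R * 'rV[R]_n.+1) := (f ((1 - p.1 ^+ 2) * p.2 ord0 ord0 ^+ 2))%:E.
have mF : measurable_fun setT F.
  apply/measurable_EFinP; apply: (measurableT_comp mf).
  apply: measurable_funM.
    by apply: measurable_funB => //; apply: measurable_funX; exact: measurable_fst.
  apply: measurable_funX; exact: (measurableT_comp (@measurable_coord R n.+1 ord0) measurable_snd).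
have F0 p : (0 <= F p)%E by rewrite lee_fin.
have key := integral_latlong mF F0.
transitivity ((sphere_mass n.+1)^-1%:E * (\int[axis_law n.+1]_t \int[sphere_measure]_v F (t, v)))%E.
  rewrite -ge0_integralZl//; last 3 first.
  - exact: measurable_fun_fubini_tonelli_F.
  - by move=> t _; apply: integral_ge0 => v _.
  - by rewrite lee_fin invr_ge0 ltW// sphere_mass_gt0.
  apply: eq_integral => t _; rewrite slice_mean_EFin//; congr (_ * _)%E.
  apply: (@integral_axis_law R n (fun x : R => (f ((1 - t ^+ 2) * x ^+ 2))%:E)).
    apply/measurable_EFinP; apply: (measurableT_comp mf).
    by apply: measurable_funM => //; exact: measurable_funX.
  by move=> x; rewrite lee_fin.
rewrite key muleA -EFinM mulVf// mul1e.
pose e0 : 'rV[R]_n.+2 := delta_mx ord0 ord0.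
pose e1 : 'rV[R]_n.+2 := delta_mx ord0 (rshift 1 (ord0 : 'I_n.+1)).
have [|Q [QQ Q1 _]] := @exists_reflection R n.+2 e1 e0.
  by rewrite !delta_dotp !eqxx.
rewrite -[RHS](integral_sphere_rotate (f := fun x : 'rV[R]_n.+2 => (f (x ord0 ord0 ^+ 2))%:E) QQ); last 2 first.
- by apply/measurable_EFinP; exact: (measurableT_comp mf (@measurable_sqcoord R n.+1)).
- by move=> x; rewrite lee_fin.
have xQ (x : 'rV[R]_n.+2) : (x *m Q) ord0 ord0 = x ord0 (rshift 1 (ord0 : 'I_n.+1)).
  by rewrite -[LHS]dotp_delta -/e0 -Q1 dotp_mulmx// dotp_delta.
apply: eq_integral_sphere.
- exact: (measurableT_comp mF (@measurable_latlong R n.+1)).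
- by move=> x.
- apply/measurable_EFinP; apply: (measurableT_comp mf).
  exact: (measurableT_comp (@measurable_sqcoord R n.+1) (measurable_mulmxr Q)).
- by move=> x; rewrite lee_fin.
move=> x x1; rewrite xQ; congr (f _)%:E.
rewrite -[x]uncons_rVK; case: (uncons_rV x) (uncons_rVK x) => t y xE.
have ty1 : t ^+ 2 + enorm y ^+ 2 = 1 by rewrite -enorm_cons xE x1 expr1n.
have -> : latlong (cons_rV (t, y)) = (t, normalize y) by rewrite /latlong cons_rVK cons_rV0.
rewrite cons_rVS /=.
by rewrite (sqr_coord_direction ty1).
Qed.

(** The squares of the n.+1 coordinates have equal means and sum to 1. *)
Lemma sqmean_id n : sqmean n (@id R) = n.+1%:R^-1.
Proof.
apply: EFin_inj; rewrite -sqmean_EFin; last by apply: bmeas_continuous => x; exact: cvg_id.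
have M1 : @sphere_mass R n.+1 != 0 by rewrite gt_eqF// sphere_mass_gt0.
transitivity (\int[@sqlaw R n]_(t in `[0%R, 1%R]) (`|t|%R)%:E)%E.
  by apply: eq_integral => t; rewrite inE /= in_itv /= => /andP[t0 _]; rewrite ger0_norm.
rewrite sqlaw_integral_sphere//.
pose I := (\int[@sphere_measure R n.+1]_x (`|x ord0 ord0 ^+ 2|%R)%:E)%E.
have Ii (i : 'I_n.+1) : (\int[@sphere_measure R n.+1]_x (x ord0 i ^+ 2)%:E = I)%E.
  pose e0 : 'rV[R]_n.+1 := delta_mx ord0 ord0.
  have [|Q [QQ Q1 _]] := @exists_reflection R n.+1 (delta_mx ord0 i) e0.
    by rewrite !delta_dotp !eqxx.
  rewrite /I -(integral_sphere_rotate (f := fun x : 'rV[R]_n.+1 => (`|x ord0 ord0 ^+ 2|%R)%:E) QQ); last 2 first.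
  - by apply/measurable_EFinP; apply: measurableT_comp => //; exact: measurable_sqcoord.
  - by move=> x; rewrite lee_fin.
  apply: eq_integral => x _; rewrite ger0_norm ?sqr_ge0//.
  by rewrite -[(x *m Q) _ _]dotp_delta -/e0 -Q1 dotp_mulmx// dotp_delta.
have : (\sum_(i < n.+1) \int[@sphere_measure R n.+1]_x (x ord0 i ^+ 2)%:E = (@sphere_mass R n.+1)%:E)%E.
  rewrite -ge0_integral_sum//; last 2 first.
  - by move=> i; apply/measurable_EFinP; apply: measurable_funX; exact: measurable_coord.
  - by move=> i x _; rewrite lee_fin sqr_ge0.
  transitivity (\int[@sphere_measure R n.+1]_x 1%E)%E; last first.
    by rewrite integral_cst// mul1e; exact: esym (sphere_massE _).
  apply: eq_integral_sphere => //.
  - apply: emeasurable_sum => i; apply/measurable_EFinP; apply: measurable_funX; exact: measurable_coord.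
  - by move=> x; apply: sume_ge0 => i _; rewrite lee_fin sqr_ge0.
  - move=> x x1; rewrite sumEFin; congr EFin.
    rewrite -[RHS](expr1n R 2) -x1 enorm_sqr dotpE; apply: eq_bigr => i _.
    by rewrite expr2.
have [r Ir] : exists r : R, I = r%:E.
  exists (@sphere_mass R n.+1 * sqmean n (fun t : R => `|t|)); rewrite EFinM -sqmean_EFin; last first.
    by apply: bmeas_continuous; exact: norm_continuous.
  by rewrite sqlaw_integral_sphere// muleA -EFinM divff// mul1e.
under eq_bigr do rewrite Ii Ir.
rewrite sumEFin sumr_const card_ord -/I Ir => -[h].
rewrite -EFinM; congr EFin; rewrite -h -[r *+ _]mulr_natl invfM -mulrA mulVf ?mulr1//.
by apply: contra_eq_neq h => ->; rewrite mul0rn eq_sym.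
Qed.

(** The set {x_0^2 >= c^2} is the union of two opposite caps. *)
Lemma sqmean_cap n (c : R) : 0 < c < 1 ->
  @sphere_mass R n.+1 * cap_area n.+1 c <= @sphere_mass R n.+2 * sqmean n.+1 (\1_`[c ^+ 2, +oo[ : R -> R)
    <= 2 * (@sphere_mass R n.+1 * cap_area n.+1 c).
Proof.
move=> c01; have [c0 c1] := andP c01.
pose A := [set x : 'rV[R]_n.+2 | c <= x ord0 ord0].
pose A' := [set x : 'rV[R]_n.+2 | A (x *m (- 1%:M))].
have M1 : @sphere_mass R n.+2 != 0 by rewrite gt_eqF// sphere_mass_gt0.
have mA : measurable A by exact: measurable_coord0_ge.
have QQ : (- 1%:M : 'M[R]_n.+2) *m (- 1%:M)^T = 1%:M.
  by rewrite linearN /= trmx1 mulNmx mul1mx opprK.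
have mA' : measurable A' by exact: (measurable_preimage (measurable_mulmxr _)).
have E : ((@sphere_mass R n.+2 * sqmean n.+1 (\1_`[(c ^+ 2)%R, +oo[ : R -> R))%:E =
    sphere_measure (A `|` A'))%E.
  rewrite EFinM -sqmean_EFin; last exact: bmeas_indic.
  rewrite sqlaw_integral_sphere//.
  rewrite muleA -EFinM divff// mul1e.
  transitivity (\int[@sphere_measure R n.+2]_x (\1_(A `|` A') x)%:E)%E; last first.
    by rewrite integral_indic ?setIT//; exact: measurableU.
  apply: eq_integral => x _; congr EFin; rewrite !indicE; congr ((nat_of_bool _)%:R).
  apply/idP/idP; rewrite !inE /= in_itv /= andbT /A' /A /= mulmxN mulmx1 !mxE => h.
    have : c <= `|x ord0 ord0| by rewrite -ler_sqr ?nnegrE ?(ltW c0)// real_normK ?num_real.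
    by rewrite ler_normr => /orP[]; [left|right].
  rewrite -[leRHS]real_normK ?num_real// ler_sqr ?nnegrE ?(ltW c0)//.
  by rewrite ler_normr; case: h => ->; rewrite ?orbT.
have cap : @sphere_measure R n.+2 A = (@sphere_mass R n.+1 * cap_area n.+1 c)%:E := sphere_cap n c01.
have cap' : @sphere_measure R n.+2 A' = (@sphere_mass R n.+1 * cap_area n.+1 c)%:E.
  by apply: etrans (sphere_measure_rotate QQ mA) cap.
apply/andP; split.
  rewrite -lee_fin E -cap; apply: le_measure; rewrite ?inE//.
  exact: measurableU.
rewrite -lee_fin E mulr_natl mulr2n EFinD -{1}cap -cap'.
exact: measureU2.
Qed.

End formulas.

(** * Volume and section integral as means *)

Section body_formulas.
Context {R : realType}.

Definition capprof p (A A' B t : R) : R := cap_area p (qprofile A A' B t).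

Lemma continuous_qprofile_lin (A A' B : R) : 0 < A -> continuous (qprofile A A' B).
Proof.
move=> A0 x; rewrite /qprofile.
apply: (@cvg_comp _ _ _ (fun x : R => Num.max A (A' + B * x)) coheight _
  (nbhs (Num.max A (A' + B * x)))); last by apply: continuous_coheight; rewrite lt_max A0.
have c2 : {for x, continuous (fun x : R => A' + B * x)}.
  apply: cvgD; first exact: cvg_cst.
  by apply: cvgM; [exact: cvg_cst|exact: cvg_id].
by apply: (@continuous_max _ _ (cst A) (fun x : R => A' + B * x)) => //; exact: cvg_cst.
Qed.

Lemma continuous_capprof p (A A' B : R) : 0 < A -> continuous (capprof p A A' B).
Proof.
move=> A0 x; apply: (@cvg_comp _ _ _ (qprofile A A' B) (cap_area p) _ (nbhs (qprofile A A' B x))).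
  exact: continuous_qprofile_lin.
by apply: continuous_cap_area; exact: qprofile01.
Qed.

Lemma capprof_ge0 p (A A' B t : R) : 0 < A -> 0 <= capprof p A A' B t.
Proof. by move=> A0; apply: cap_area_ge0; exact: qprofile01. Qed.

Lemma vol_qbodyE n (A A' B : R) : 0 < A ->
  vol (@qbody R n A A' B) = (@sphere_mass R n.+1 * sqmean n (capprof n.+1 A A' B))%:E.
Proof.
move=> A0; rewrite vol_qbody// EFinM -sqmean_EFin; last by apply: bmeas_continuous; exact: continuous_capprof.
rewrite sqlaw_integral; last 2 first.
- by apply: continuous_measurable_fun; exact: continuous_capprof.
- by move=> t; exact: capprof_ge0.
by rewrite muleA -EFinM divff ?mul1e// gt_eqF// sphere_mass_gt0.
Qed.

Lemma vol_perp_qbodyE n (A A' B : R) (xi : 'rV[R]_n.+2) : 0 < A -> enorm xi = 1 ->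
  vol_perp xi (@qbody R n.+1 A A' B `&` perp xi) =
  (@sphere_mass R n.+1 * slice_mean n (capprof n.+1 A A' B) (xi ord0 ord0 ^+ 2))%:E.
Proof.
move=> A0 xi1; rewrite vol_perp_qbody// EFinM slice_mean_EFin; last 2 first.
- exact: continuous_capprof.
- by move=> t; exact: capprof_ge0.
by rewrite muleA -EFinM divff ?mul1e// gt_eqF// sphere_mass_gt0.
Qed.

(** The volume of the section by the hyperplane xi depends on xi_0^2 only. *)
Lemma section_integral_qbodyE n (A A' B : R) : 0 < A ->
  section_integral (@qbody R n.+1 A A' B) =
  (@sphere_mass R n.+2 * @sphere_mass R n.+1 ^+ n.+2 *
   sqmean n.+1 (fun t => slice_mean n (capprof n.+1 A A' B) t ^+ n.+2))%:E.
Proof.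
move=> A0.
have bS : bmeas (slice_mean n (capprof n.+1 A A' B)).
  apply: bmeas_slice_mean; first exact: continuous_capprof.
  by move=> t; exact: capprof_ge0.
have S0 t : 0 <= slice_mean n (capprof n.+1 A A' B) t.
  by apply: sqmean_ge0 => v _; exact: capprof_ge0.
pose M := @sphere_mass R n.+1; have M0 : 0 < M := sphere_mass_gt0 n.
pose g t := (M * slice_mean n (capprof n.+1 A A' B) t) ^+ n.+2.
have bg : bmeas g by apply: bmeasX; exact: bmeasZ.
have g0 t : 0 <= g t by rewrite exprn_ge0// mulr_ge0// ltW.
transitivity (\int[@sphere_measure R n.+2]_(x in usphere) (g (x ord0 ord0 ^+ 2))%:E)%E.
  apply: eq_integral => xi; rewrite inE => xi1.
  by rewrite vol_perp_qbodyE// -EFin_expe.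
have mg : measurable_fun setT (fun x : 'rV[R]_n.+2 => (g (x ord0 ord0 ^+ 2))%:E).
  apply/measurable_EFinP; case: bg => mg _.
  exact: (measurableT_comp mg (@measurable_sqcoord R n.+1)).
rewrite -integral_usphere//; last by move=> x; rewrite lee_fin.
have E := @sqlaw_integral_sphere R n.+1 g (proj1 bg) g0.
have -> : (\int[@sphere_measure R n.+2]_x (g (x ord0 ord0 ^+ 2))%:E =
    (@sphere_mass R n.+2)%:E * \int[sqlaw n.+1]_(t in `[0%R, 1%R]) (g t)%:E)%E.
  by rewrite E muleA -EFinM divff ?mul1e// gt_eqF// sphere_mass_gt0.
rewrite sqmean_EFin// -EFinM; congr EFin; rewrite -mulrA -sqmeanZ; last exact: bmeasX.
by congr (_ * _); apply: eq_Ex => t _; rewrite /g exprMn.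
Qed.

Lemma hemisphere_dotp n (x : 'rV[R]_(1 + n)) : hemisphere x -> 0 <= dotp x (pole n) <= 1.
Proof.
move=> [x1 x0]; rewrite x0/= -(@expr_le1 _ 2)//.
have := dotp_proj_ge0 x (@pole_pole R n).
by rewrite -[dotp x x]enorm_sqr (x1 : enorm x = 1) expr1n subr_ge0.
Qed.

Lemma acos_lt01 (c d : R) : 0 <= c <= 1 -> 0 <= d <= 1 -> (acos d < acos c) = (c < d).
Proof.
have h u : 0 <= u <= 1 -> -1 <= u <= 1 by move=> /andP[u0 ->]; rewrite (le_trans _ u0)//; lra.
have I u : 0 <= u <= 1 -> acos u \in `[0, pi].
  by move=> u01; rewrite in_itv /= acos_ge0 ?acos_lepi// h.
by move=> c01 d01; rewrite -ltr_cos ?I// !acosK// in_itv /= h.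
Qed.

Lemma qbody_convex_body n (A A' B : R) : 0 < A -> 0 <= A' -> 0 <= B ->
  convex_body (@qbody R n A A' B).
Proof.
move=> A0 A'0 B0; split.
- apply: closedI; last exact: closed_qcone.
  rewrite (_ : @hemisphere R n.+1 = usphere `&` [set x | 0 <= dotp x (pole n.+1)]).
    apply: closedI; first exact: closed_usphere.
    by apply: closed_ge0; exact: continuous_dotpl.
  by [].
- exists (qcone (pole n.+1) (tangent (qaxis n)) A A' B) => //.
  by have [] := @qcone_convex R _ (pole n.+1) (tangent (qaxis n)) A A' B (pole_pole _) (ltW A0) A'0 B0.
(* The round cone of squared slope A + A' + B is contained in the body. *)
- pose M := A + A' + B; have M0 : 0 < M by rewrite /M; lra.
  have /andP[c0 c1] := coheight01 M0.
  exists (pole n.+1), (acos (coheight M)); split.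
  + by split; [rewrite /usphere /= /enorm pole_pole sqrtr1|rewrite pole_pole].
  + by apply: acos_gt0; rewrite c1 andbT; lra.
  + move=> y hy; rewrite /gdist dotpC acos_lt01 ?(ltW c0) ?(ltW c1) ?hemisphere_dotp//.
    move=> /ltW; rewrite coheight_le// => /andP[y0 My].
    have y1 : enorm y = 1 by case: hy.
    apply/(qbody_sphereP _ _ _ y1); rewrite /qcone /mkset.
    have -> : dotp y y = 1 by rewrite -enorm_sqr y1 expr1n.
    have h0 : 0 <= 1 - dotp y (pole n.+1) ^+ 2.
      by rewrite subr_ge0 expr_le1//; case/andP: (hemisphere_dotp hy).
    have hb : dotp y (tangent (qaxis n)) ^+ 2 <= 1 - dotp y (pole n.+1) ^+ 2.
      pose z := y - dotp y (pole n.+1) *: pole n.+1.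
      have tt : dotp (tangent (qaxis n)) (tangent (qaxis n)) = 1 :> R by rewrite tangent_tangent qaxis_qaxis.
      have zt : dotp z (tangent (qaxis n)) = dotp y (tangent (qaxis n)).
        by rewrite /z -scaleNr dotpDl dotpZl pole_tangent mulr0 addr0.
      have zz : dotp z z = 1 - dotp y (pole n.+1) ^+ 2.
        rewrite /z -scaleNr !dotpDl !dotpDr !dotpZl !dotpZr pole_pole.
        by rewrite (dotpC (pole _) y) -[dotp y y]enorm_sqr y1 expr1n; ring.
      by have := dotp_proj_ge0 z tt; rewrite subr_ge0 zt zz.
    move: (dotp y (pole n.+1)) (dotp y (tangent (qaxis n))) y0 My h0 hb => p t y0 My h0 hb.
    split => //; first by rewrite /M in My; nra.
    by rewrite /M in My; nra.
Qed.

(** The tangent components of a point enter the equations squared. *)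
Lemma qbody_reflect n (A A' B : R) (a b : R) (xi : 'rV[R]_n.+1) :
  qbody A A' B (a *: pole n.+1 + b *: tangent (- xi)) ->
  qbody A A' B (a *: pole n.+1 + b *: tangent xi).
Proof.
have E (e : 'rV[R]_n.+1) : [/\ dotp (a *: pole n.+1 + b *: tangent e) (pole n.+1) = a,
   dotp (a *: pole n.+1 + b *: tangent e) (tangent (qaxis n)) = b * dotp e (qaxis n) &
   dotp (a *: pole n.+1 + b *: tangent e) (a *: pole n.+1 + b *: tangent e) =
     a ^+ 2 + b ^+ 2 * dotp e e].
  rewrite !dotpDl !dotpDr !dotpZl !dotpZr (dotpC (tangent e) (pole _)).
  rewrite !pole_tangent pole_pole !tangent_tangent; split; ring.
have [E1 E2 E3] := E (- xi); have [F1 F2 F3] := E xi.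
have N2 : (b * dotp (- xi) (qaxis n)) ^+ 2 = (b * dotp xi (qaxis n)) ^+ 2.
  by rewrite -scaleN1r dotpZl; ring.
have N3 : dotp (- xi) (- xi) = dotp xi xi.
  by rewrite -scaleN1r dotpZl dotpZr; ring.
rewrite /qbody /hemisphere /usphere /qcone /setI /mkset /enorm E1 E2 E3 F1 F2 F3 N2 N3.
by [].
Qed.

Lemma qbody_symmetric n (A A' B : R) : origin_symmetric (@qbody R n A A' B).
Proof.
move=> xi _; rewrite /radial; congr (sup _).
have pt (a b : R) (e : 'rV[R]_n.+1) : gdist (a *: pole n.+1 + b *: tangent e) (pole n.+1) = acos a.
  by rewrite /gdist dotpDl !dotpZl (dotpC (tangent e)) pole_tangent pole_pole mulr0 mulr1 addr0.
apply/seteqP; split => d /= [x [Kx [t t0 xE]] <-]; rewrite -{}xE in Kx *.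
- exists (cos t *: pole n.+1 + sin t *: tangent (- xi)); last by rewrite !pt.
  split; last by exists t.
  by apply: qbody_reflect; rewrite opprK.
- exists (cos t *: pole n.+1 + sin t *: tangent xi); last by rewrite !pt.
  split; last by exists t.
  exact: qbody_reflect.
Qed.

(** The distance r from the pole corresponds to the slope cos r / sin r. *)
Lemma centered_ballE n (r : R) : 0 < r < pi / 2 ->
  @centered_ball R n.+1 r = @qbody R n (cos r ^+ 2 / sin r ^+ 2) (cos r ^+ 2 / sin r ^+ 2) 0.
Proof.
move=> /andP[r0 r1]; have pi0 : 0 < pi :> R := pi_gt0 R.
have s0 : 0 < sin r by apply: sin_gt0_pi; apply/andP; split => //; lra.
have c0 : 0 < cos r by apply: cos_gt0_pihalf; apply/andP; split => //; lra.
have c1 : cos r <= 1 by exact: cos_le1.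
have rE : r = acos (cos r).
  by rewrite cosK// in_itv /=; apply/andP; split; lra.
have sc : sin r ^+ 2 = 1 - cos r ^+ 2 by rewrite sin2cos2.
have key x : hemisphere x -> (gdist x (pole n.+1) <= r) = (cos r <= dotp x (pole n.+1)).
  move=> hx; rewrite [in LHS]rE leNgt acos_lt01 -?leNgt ?hemisphere_dotp//.
  by rewrite ltW.
have key2 x : hemisphere x -> (cos r <= dotp x (pole n.+1)) =
    (cos r ^+ 2 / sin r ^+ 2 * (dotp x x - dotp x (pole n.+1) ^+ 2) <= dotp x (pole n.+1) ^+ 2).
  move=> hx; have [x1 x0] := hx.
  rewrite -[dotp x x]enorm_sqr (x1 : enorm x = 1) expr1n mulrAC ler_pdivrMr ?exprn_gt0// sc.
  rewrite -ler_sqr ?nnegrE ?(ltW c0)//; apply/idP/idP; lra.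
apply/seteqP; split => x [hx].
  rewrite key// => h; split => //; rewrite /qcone /mkset mul0r addr0 -key2//.
  by split => //; case: hx.
rewrite /qcone /mkset mul0r addr0 -key2// => -[_ h _].
by split => //; rewrite key.
Qed.

End body_formulas.

(** * Expansions of cap areas *)

Section calculus.
Context {R : realType}.

Lemma first_order (f : R -> R) (x a : R) : is_derive x 1 f a ->
  forall e, 0 < e -> exists2 d, 0 < d & forall y, `|y - x| <= d ->
    `|f y - f x - a * (y - x)| <= e * `|y - x|.
Proof.
move=> /is_derive1_caratheodory[g [fg cg ga]] e e0.
have /cvgrPdist_le/(_ e e0)/nbhs_ballP[d /= d0 gd] := cg.
exists (d / 2); first by rewrite divr_gt0.
move=> y yd; rewrite fg -mulrBl normrM ler_wpM2r//.
rewrite -ga distrC; apply: gd; rewrite /ball /= distrC (le_lt_trans yd)//; lra.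
Qed.

(** The mean value theorem, applied to f minus the parabola of leading coefficient
g x / 2 + e or g x / 2 - e. *)
Lemma second_order (f g : R -> R) (x l u : R) : l < x < u ->
  (forall y, l < y < u -> is_derive y 1 f ((y - x) * g y)) -> {for x, continuous g} ->
  forall e, 0 < e -> exists2 d, 0 < d & forall y, `|y - x| <= d ->
    `|f y - f x - g x / 2 * (y - x) ^+ 2| <= e * (y - x) ^+ 2.
Proof.
move=> /andP[lx xu] df cg e e0.
have /cvgrPdist_le/(_ e e0)/nbhs_ballP[d /= d0 gd] := cg.
pose d' := Num.min (d / 2) (Num.min ((x - l) / 2) ((u - x) / 2)).
have d'0 : 0 < d' by rewrite !lt_min !divr_gt0// subr_gt0.
exists d' => // y; rewrite !le_min => /andP[yd /andP[yl yu]].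
have yb z : `|z - x| <= `|y - x| -> l < z < u /\ `|g z - g x| <= e.
  move=> zy; split.
    by move: (le_trans zy yl) (le_trans zy yu); rewrite !ler_norml => /andP[? ?] /andP[? ?]; lra.
  rewrite distrC; apply: gd; rewrite /ball /= distrC (le_lt_trans (le_trans zy yd))//; lra.
pose k := g x / 2.
have main (s : R) (F := fun z => f z - k * (z - x) ^+ 2 - s * e * (z - x) ^+ 2) :
    exists2 z, `|z - x| <= `|y - x| /\ 0 <= (z - x) * (y - x) &
      F y - F x = ((z - x) * (g z - g x - 2 * s * e)) * (y - x).
  have dF z : l < z < u -> is_derive z 1 F ((z - x) * (g z - g x - 2 * s * e)).
    move=> /df dfz; apply: is_derive_eq; rewrite /GRing.scale /= /k; lra.
  have cF a b : l < a -> b < u -> {within `[a, b], continuous F}.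
    move=> la bu; apply: derivable_within_continuous => z; rewrite in_itv /= => /andP[az zb].
    have := dF z; rewrite (lt_le_trans la az) (le_lt_trans zb bu) => /(_ isT) h; exact: ex_derive.
  have [/andP[ly uy] _] := yb y (lexx _).
  have [xy|yx] := lerP x y.
    have [||z] := @MVT_segment R F (fun z => (z - x) * (g z - g x - 2 * s * e)) x y xy.
    - by move=> z; rewrite in_itv /= => /andP[xz zy]; apply: dF; rewrite (lt_trans lx)// (lt_trans zy).
    - exact: cF.
    rewrite in_itv /= => /andP[xz zy] ->; exists z => //; split.
      by rewrite !ger0_norm ?subr_ge0// lerB.
    by rewrite mulr_ge0// subr_ge0.
  have [||z] := @MVT_segment R F (fun z => (z - x) * (g z - g x - 2 * s * e)) y x (ltW yx).
  - by move=> z; rewrite in_itv /= => /andP[yz zx]; apply: dF; rewrite (lt_trans ly)// (lt_trans zx).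
  - exact: cF.
  rewrite in_itv /= => /andP[yz zx] E; exists z; last by rewrite -opprB E; ring.
  split; first by rewrite !ler0_norm ?subr_le0 ?(ltW yx)//; lra.
  by rewrite mulr_le0// subr_le0// ltW.
rewrite -/k ler_norml; apply/andP; split.
  have [z [zy sgn] /=] := main (-1); have [_ h] := yb z zy.
  rewrite subrr expr0n /= !mulr0 !subr0 => E.
  have : 0 <= g z - g x + 2 * e by move: h; rewrite ler_norml; lra.
  move=> h2; have := mulr_ge0 sgn h2; nra.
have [z [zy sgn] /=] := main 1; have [_ h] := yb z zy.
rewrite subrr expr0n /= !mulr0 !subr0 => E.
have : 0 <= g x + 2 * e - g z by move: h; rewrite ler_norml; lra.
move=> h2; have := mulr_ge0 sgn h2; nra.
Qed.

Lemma cap_area_mvt q (c d : R) : 0 < c -> c <= d -> d < 1 ->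
  exists2 z, 0 < z < 1 & cap_area q.+2 d - cap_area q.+2 c = - axdist z ^+ q * (d - c).
Proof.
move=> c0 cd d1.
have [||z] := @MVT_segment R (cap_area q.+2) (fun z => - axdist z ^+ q) c d cd.
- move=> z; rewrite in_itv /= => /andP[cz zd]; apply: is_derive_cap_area.
  by rewrite (lt_trans c0 cz) (lt_trans zd d1).
- apply: derivable_within_continuous => z; rewrite in_itv /= => /andP[cz zd].
  have h : is_derive z 1 (cap_area q.+2) (- axdist z ^+ q).
    by apply: is_derive_cap_area; rewrite (lt_le_trans c0 cz) (le_lt_trans zd d1).
  exact: ex_derive.
rewrite in_itv /= => /andP[cz zd] ->; exists z => //.
by rewrite (lt_le_trans c0 cz) (le_lt_trans zd d1).
Qed.

Lemma cap_area_anti q (c d : R) : 0 < c -> c <= d -> d < 1 -> cap_area q.+2 d <= cap_area q.+2 c.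
Proof.
move=> c0 cd d1; have [z _ E] := cap_area_mvt q c0 cd d1.
rewrite -subr_le0 E mulNr oppr_le0; apply: mulr_ge0; last by rewrite subr_ge0.
by rewrite exprn_ge0// axdist_ge0.
Qed.

Lemma cap_area_lip q (c d : R) : 0 < c < 1 -> 0 < d < 1 ->
  `|cap_area q.+2 c - cap_area q.+2 d| <= `|c - d|.
Proof.
wlog cd : c d / c <= d.
  move=> W c01 d01; have [cd|dc] := leP c d; first exact: W.
  by rewrite distrC (distrC c) W// ltW.
move=> /andP[c0 _] /andP[_ d1]; rewrite distrC (distrC c).
have [z _ ->] := cap_area_mvt q c0 cd d1.
rewrite normrM normrN ler_piMl// ger0_norm ?exprn_ge0 ?axdist_ge0//.
by rewrite exprn_ile1 ?axdist_ge0 ?axdist_le1.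
Qed.

Lemma coheight_sqr (w : R) : 0 < w -> coheight w ^+ 2 = w / (1 + w).
Proof. by move=> w0; rewrite sqr_sqrtr// divr_ge0// ltW// addr_gt0. Qed.

Lemma coheight_homo (v w : R) : 0 < v -> v <= w -> coheight v <= coheight w.
Proof.
move=> v0 vw; have w0 := lt_le_trans v0 vw.
apply: ler_wsqrtr; rewrite ler_pdivrMr ?addr_gt0// mulrAC ler_pdivlMr ?addr_gt0//; nra.
Qed.

Lemma coheight_lip (a v w : R) : 0 < a -> a <= v -> a <= w ->
  `|coheight v - coheight w| <= (coheight a)^-1 * `|v - w|.
Proof.
move=> a0 av aw; have v0 := lt_le_trans a0 av; have w0 := lt_le_trans a0 aw.
have ca := coheight_gt0 a0; have cav := coheight_homo a0 av; have caw := coheight_homo a0 aw.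
rewrite ler_pdivlMl//.
have E : (coheight v - coheight w) * (coheight v + coheight w) = (v - w) / ((1 + v) * (1 + w)).
  by rewrite -subr_sqr !coheight_sqr//; field; apply/andP; split; rewrite gt_eqF// addr_gt0.
have : `|coheight v - coheight w| * (coheight v + coheight w) <= `|v - w|.
  rewrite -[X in _ * X](@ger0_norm _ (coheight v + coheight w)); last by rewrite addr_ge0// ltW// coheight_gt0.
  rewrite -normrM E normrM ler_piMr// ger0_norm; last by rewrite invr_ge0 mulr_ge0// ltW// addr_gt0.
  by rewrite invf_le1 ?mulr_gt0 ?addr_gt0//; nra.
have := normr_ge0 (coheight v - coheight w); nra.
Qed.

Definition coheight_slope (w : R) : R := (2 * coheight w)^-1 * ((1 + w) ^+ 2)^-1.

Lemma coheight_slope_gt0 (w : R) : 0 < w -> 0 < coheight_slope w.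
Proof.
move=> w0; rewrite mulr_gt0// invr_gt0; first by rewrite mulr_gt0// coheight_gt0.
by rewrite exprn_gt0// addr_gt0.
Qed.

Lemma is_derive_coheight (w : R) : 0 < w -> is_derive w 1 coheight (coheight_slope w).
Proof.
move=> w0; have w1 : 0 < 1 + w by rewrite addr_gt0.
have h : 0 < w / (1 + w) by rewrite divr_gt0.
have hs := is_derive1_sqrt h.
have hv : is_derive w 1 (fun x : R => (1 + x)^-1) (- ((1 + w) ^+ 2)^-1).
  have h1 : is_derive w 1 (fun x : R => 1 + x) 1.
    by apply: is_derive_eq; rewrite add0r mul1r.
  have h2 : 1 + w != 0 by rewrite gt_eqF.
  have h3 := is_deriveV h2 h1.
  by apply: is_derive_eq; rewrite /GRing.scale /= mulr1.
have hg : is_derive w 1 (fun x : R => x / (1 + x)) (((1 + w) ^+ 2)^-1).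
  apply: is_derive_eq; rewrite /GRing.scale /=; field; by rewrite gt_eqF.
exact: (is_derive_eq (@is_derive1_comp _ (@Num.sqrt R) (fun x : R => x / (1 + x)) _ _ _ hs hg)).
Qed.

End calculus.

Section expansions.
Context {R : realType}.

(** Area of the cap bounded by the round cone of squared slope w. *)
Definition conecap p (w : R) : R := cap_area p (coheight w).

Lemma is_derive_conecap q (w : R) : 0 < w ->
  is_derive w 1 (conecap q.+2) (- axdist (coheight w) ^+ q * coheight_slope w).
Proof.
move=> w0; have h1 := is_derive_cap_area q (coheight01 w0).
exact: (@is_derive1_comp _ (cap_area q.+2) coheight _ _ _ h1 (is_derive_coheight w0)).
Qed.

Lemma conecap_anti q (v w : R) : 0 < v -> v <= w -> conecap q.+2 w <= conecap q.+2 v.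
Proof.
move=> v0 vw; apply: cap_area_anti; [exact: coheight_gt0|exact: coheight_homo|].
by apply: coheight_lt1; exact: lt_le_trans vw.
Qed.

Lemma conecap_lip q (a v w : R) : 0 < a -> a <= v -> a <= w ->
  `|conecap q.+2 v - conecap q.+2 w| <= (coheight a)^-1 * `|v - w|.
Proof.
move=> a0 av aw; apply: le_trans (coheight_lip a0 av aw).
by apply: cap_area_lip; apply: coheight01; exact: lt_le_trans a0 _.
Qed.

Lemma conecap_gt0 q (w : R) : 0 < w -> 0 < conecap q.+1 w.
Proof.
move=> w0; have /andP[c0 c1] := coheight01 w0.
apply: lt_le_trans (cap_area_ge _ _) => //; rewrite divr_gt0// mulr_gt0// exprn_gt0// axdist_gt0//.
by rewrite ltW.
Qed.

Section deficit.
Variables (q : nat) (w0 : R).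
Hypothesis w00 : 0 < w0.
Let c0 := coheight w0.
Let s0 := axdist c0.

Let c01 : 0 < c0 < 1. Proof. exact: coheight01. Qed.

Let s00 : 0 < s0. Proof. by case/andP: c01 => h1 h2; apply: axdist_gt0; rewrite ltW. Qed.

Let G : R := s0 ^+ q * c0 / (2 * s0 ^+ 2).

Let G0 : 0 < G.
Proof. by rewrite divr_gt0// mulr_gt0// ?exprn_gt0//; case/andP: c01. Qed.

Let C := coheight_slope w0.
Let C0 : 0 < C. Proof. exact: coheight_slope_gt0. Qed.

(** The derivatives of the two cap areas with respect to the height are
- axdist ^+ q and - axdist ^+ q.+1, so the first-order terms cancel at w0. If the
mean of [conecap q.+3] is its value at w0, then the mean of this quantity is the mean
change of [conecap q.+2]. *)
Definition deficit (w : R) : R := conecap q.+2 w - conecap q.+2 w0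
  - (conecap q.+3 w - conecap q.+3 w0) / axdist (coheight w0).

Let D (c : R) := cap_area q.+2 c - cap_area q.+3 c / s0.

Let deficitE w : deficit w = D (coheight w) - D c0.
Proof.
have aux (a b c d s : R) : a - b - (c - d) / s = a - c / s - (b - d / s) by ring.
exact: aux.
Qed.

(** The derivative of D is axdist ^+ q * (axdist / s0 - 1); the factor c - c0 is extracted
by multiplying by axdist + s0. *)
Let D_expand e : 0 < e -> exists2 d, 0 < d & forall c, `|c - c0| <= d ->
  `|D c - D c0 + G * (c - c0) ^+ 2| <= e * (c - c0) ^+ 2.
Proof.
move=> e0; pose g c := - (axdist c ^+ q * (c + c0) / (s0 * (s0 + axdist c))).
have [||d d0 h] := @second_order R D g c0 0 1 c01 _ _ e e0.
- move=> c cc; have h1 := is_derive_cap_area q cc; have h2 := is_derive_cap_area q.+1 cc.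
  have h : is_derive c 1 D (- axdist c ^+ q + axdist c ^+ q.+1 / s0).
    rewrite /D; apply: is_derive_eq; rewrite /GRing.scale /=; ring.
  apply: (is_derive_eq h); rewrite /g exprS.
  have sc : axdist c ^+ 2 = 1 - c ^+ 2.
    by apply: axdist_sqr; case/andP: cc => a b; rewrite !ltW.
  have sc0 : s0 ^+ 2 = 1 - c0 ^+ 2.
    by apply: axdist_sqr; case/andP: c01 => a b; rewrite !ltW.
  have s1 : 0 < s0 + axdist c by rewrite ltr_wpDr// axdist_ge0.
  have cc0 : (c - c0) * (c + c0) = (s0 - axdist c) * (s0 + axdist c).
    by rewrite -!subr_sqr sc sc0; ring.
  have -> : (c - c0) * - (axdist c ^+ q * (c + c0) / (s0 * (s0 + axdist c))) =
     - (axdist c ^+ q * ((c - c0) * (c + c0)) / (s0 * (s0 + axdist c))) by ring.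
  rewrite cc0; field; by rewrite !gt_eqF.
- have cs : {for c0, continuous (@axdist R)} by exact: continuous_axdist.
  apply: cvgN; apply: cvgM.
    by apply: cvgM; [exact: continuous_axdistX|apply: cvgD; [exact: cvg_id|exact: cvg_cst]].
  apply: cvgV; first by rewrite gt_eqF// mulr_gt0// addr_gt0.
  by apply: cvgM; [exact: cvg_cst|apply: cvgD; [exact: cvg_cst|exact: cs]].
exists d => // c /h.
have -> : g c0 / 2 = - G.
  by rewrite /g /G -/s0; field; rewrite !gt_eqF ?addr_gt0.
by rewrite mulNr opprK.
Qed.

Let slope_expand e : 0 < e -> exists2 d, 0 < d & forall w, `|w - w0| <= d ->
  `|coheight w - c0 - C * (w - w0)| <= e * `|w - w0|.
Proof. by move=> e0; exact: (first_order (is_derive_coheight w00) e0). Qed.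

Let deficit_near d1 e : 0 < d1 -> 0 < e -> exists2 d, 0 < d & forall w, `|w - w0| <= d ->
  `|coheight w - c0| <= d1 /\ `|coheight w - c0 - C * (w - w0)| <= e * `|w - w0|.
Proof.
move=> d10 e0; have [d2 d20 h2] := slope_expand e0.
exists (Num.min d2 (d1 / (C + e))); first by rewrite lt_min d20 divr_gt0// addr_gt0.
move=> w; rewrite le_min => /andP[/h2 h]; rewrite ler_pdivlMr ?addr_gt0// => wd; split => //.
apply: le_trans wd; rewrite -[coheight w - c0](subrK (C * (w - w0))).
apply: le_trans (ler_normD _ _) _; rewrite normrM (gtr0_norm C0).
by apply: le_trans (lerD h (lexx _)) _; rewrite mulrDr addrC (mulrC C) (mulrC e).
Qed.

(** Minus the quadratic coefficient of [deficit] at w0. *)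
Definition deficit_curv : R :=
  axdist (coheight w0) ^+ q * coheight w0 / (2 * axdist (coheight w0) ^+ 2) * coheight_slope w0 ^+ 2.

Lemma deficit_curv_gt0 : 0 < deficit_curv.
Proof. exact: (mulr_gt0 G0 (exprn_gt0 2 C0)). Qed.

Lemma deficit_ge e : 0 < e -> exists2 d, 0 < d & forall w, `|w - w0| <= d ->
  - (deficit_curv + e) * (w - w0) ^+ 2 <= deficit w.
Proof.
move=> e0; pose K := 2 * G * C + G + C ^+ 2 + 2 * C + 1.
have K0 : 0 < K.
  by rewrite /K; have := mulr_gt0 G0 C0; have := sqr_ge0 C; have := G0; have := C0; lra.
pose e' := Num.min 1 (e / K).
have e'0 : 0 < e' by rewrite lt_min ltr01 divr_gt0.
have e'1 : e' <= 1 by rewrite ge_min lexx.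
have e'K : e' * K <= e by rewrite -ler_pdivlMr// ge_min lexx orbT.
have [d1 d10 h1] := D_expand e'0.
have [d d0 h] := deficit_near d10 e'0.
exists d => // w /h[/h1 hD hC]; rewrite deficitE.
set x := coheight w - c0 in hD hC *; set y := w - w0 in hC *.
have x2 : x ^+ 2 <= (C + e') ^+ 2 * y ^+ 2.
  rewrite -exprMn -[leLHS]real_normK ?num_real// -[leRHS]real_normK ?num_real//.
  rewrite ler_sqr ?nnegrE// normrM (@gtr0_norm _ (C + e')) ?addr_gt0//.
  rewrite -[x](subrK (C * y)); apply: le_trans (ler_normD _ _) _.
  by rewrite normrM (gtr0_norm C0) mulrDl addrC lerD2l.
have : - (G + e') * x ^+ 2 <= D (coheight w) - D c0.
  move: hD; rewrite ler_norml => /andP[hD _].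
  by move: (D (coheight w) - D c0) hD => z hD; lra.
apply: le_trans; rewrite !mulNr lerN2.
apply: le_trans (ler_wpM2l _ x2) _; first by rewrite addr_ge0// ltW.
rewrite mulrA ler_wpM2r ?sqr_ge0//.
have -> : deficit_curv = G * C ^+ 2 by [].
apply: le_trans (lerD (lexx _) e'K); rewrite /K.
have e'2 : e' * e' <= e' by rewrite ler_piMl// ltW.
have e'3 : e' * (e' * e') <= e' by rewrite ler_piMr// ?(ltW e'0)// mulr_ile1// ltW.
have hG : G * (e' * e') <= G * e' by rewrite ler_wpM2l// ltW.
have hC2 : C * (e' * e') <= C * e' by rewrite ler_wpM2l// ltW.
nra.
Qed.

Lemma deficit_le : exists k d, [/\ 0 < k, 0 < d & forall w, `|w - w0| <= d ->
  deficit w <= - k * (w - w0) ^+ 2].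
Proof.
have G2 : 0 < G / 2 by rewrite divr_gt0.
have C2 : 0 < C / 2 by rewrite divr_gt0.
have [d1 d10 h1] := D_expand G2.
have [d d0 h] := deficit_near d10 C2.
exists (G / 2 * (C / 2) ^+ 2), d; split => //; first by rewrite mulr_gt0// exprn_gt0.
move=> w /h[/h1 hD hC]; rewrite deficitE.
set x := coheight w - c0 in hD hC *; set y := w - w0 in hC *.
have x2 : (C / 2) ^+ 2 * y ^+ 2 <= x ^+ 2.
  rewrite -exprMn -[leLHS]real_normK ?num_real// -[leRHS]real_normK ?num_real//.
  rewrite ler_sqr ?nnegrE// normrM (@gtr0_norm _ (C / 2))//.
  have := ler_normD (x - C * y) (- x).
  rewrite addrAC subrr add0r !normrN normrM (gtr0_norm C0) => hh.
  have := normr_ge0 y; lra.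
have := ler_wpM2l (ltW G2) x2.
move: hD; rewrite ler_norml => /andP[_ hD].
by move: (D (coheight w) - D c0) hD => z hD; lra.
Qed.

End deficit.

Lemma lip_continuous (h : R -> R) L : (forall a b, `|h a - h b| <= L * `|a - b|) -> continuous h.
Proof.
move=> hL x; apply/cvgrPdist_le => e e0.
have L0 : 0 <= L.
  by have := hL 1 0; rewrite subr0 normr1 mulr1; apply: le_trans.
apply/nbhs_ballP; exists (e / (L + 1)) => /=; first by rewrite divr_gt0// ltr_wpDl.
move=> y; rewrite /ball /= => /ltW xy; apply: le_trans (hL x y) _.
move: xy; rewrite ler_pdivlMr ?ltr_wpDl// => xy; have := normr_ge0 (x - y); lra.
Qed.

(** The mean is a continuous function of the parameter, which gives the member of a
family of bodies that has a prescribed volume. *)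
Lemma sqmean_ivt n (Phi : R -> R -> R) (a0 a1 L v : R) : a0 <= a1 -> 0 <= L ->
  (forall a, a0 <= a <= a1 -> bmeas (Phi a)) ->
  (forall a b t, a0 <= a <= a1 -> a0 <= b <= a1 -> 0 <= t <= 1 ->
    `|Phi a t - Phi b t| <= L * `|a - b|) ->
  sqmean n (Phi a1) <= v <= sqmean n (Phi a0) ->
  exists2 a, a0 <= a <= a1 & sqmean n (Phi a) = v.
Proof.
move=> a01 L0 bP lP /andP[v1 v0].
(* Clamping the parameter to [a0, a1] makes the mean continuous on the whole line. *)
pose cl a := Num.max a0 (Num.min a a1).
have clI a : a0 <= cl a <= a1 by rewrite /cl le_max lexx/= ge_max a01 ge_min lexx orbT.
have clL a b : `|cl a - cl b| <= `|a - b|.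
  have nle (x y : R) : x - y <= `|x - y| /\ - (x - y) <= `|x - y|.
    by rewrite ler_norm -[`|_|]normrN ler_norm.
  have minL x y : `|Num.min x a1 - Num.min y a1| <= `|x - y|.
    have [h1 h2] := nle x y; rewrite /Order.min.
    case: (ltP x a1) => ?; case: (ltP y a1) => ?; rewrite ler_norml; apply/andP; split; lra.
  have maxL x y : `|Num.max a0 x - Num.max a0 y| <= `|x - y|.
    have [h1 h2] := nle x y; rewrite /Order.max.
    case: (ltP a0 x) => ?; case: (ltP a0 y) => ?; rewrite ler_norml; apply/andP; split; lra.
  exact: le_trans (maxL _ _) (minL _ _).
have hc : continuous (fun a => sqmean n (Phi (cl a))).
  apply: (@lip_continuous _ L) => a b.
  rewrite -sqmeanB; [|exact: bP|exact: bP].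
  apply: le_trans (sqmean_normr n _) _; first by apply: bmeasB; exact: bP.
  rewrite -[leRHS](sqmean_cst n); apply: sqmean_le; last first.
  - by move=> t t01; apply: le_trans (lP _ _ _ (clI a) (clI b) t01) _; rewrite ler_wpM2l.
  - exact: bmeas_cst.
  - have [mf [M fM]] := bmeasB (bP _ (clI a)) (bP _ (clI b)).
    split; first exact: measurableT_comp.
    by exists M => t /fM; rewrite normr_id.
have cl0 : cl a0 = a0 by rewrite /cl; apply/max_idPl; rewrite ge_min lexx.
have cl1 : cl a1 = a1 by rewrite /cl minxx; apply/max_idPr.
have [||a aI E] := @IVT R (fun a => sqmean n (Phi (cl a))) a0 a1 v a01.
- exact: continuous_subspaceT.
- rewrite cl0 cl1; apply/andP; split; first by rewrite ge_min v1 orbT.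
  by rewrite le_max v0.
by exists (cl a).
Qed.

End expansions.

(** * Ellipsoids have larger section integral than the ball *)

Section ellipsoid.
Context {R : realType}.

(** The expansion of a power at y, where the quadratic coefficient is reduced by rho ^+ k
to make it a lower bound for all x above rho * y. *)
Lemma exprn_ge_quadratic k (x y rho : R) : 0 <= rho <= 1 -> 0 <= y -> rho * y <= x ->
  y ^+ k.+2 + k.+2%:R * y ^+ k.+1 * (x - y)
    + rho ^+ k * (k.+2%:R * k.+1%:R / 2) * y ^+ k * (x - y) ^+ 2 <= x ^+ k.+2.
Proof.
move=> /andP[r0 r1] y0 xy; have x0 : 0 <= x by rewrite (le_trans _ xy)// mulr_ge0.
elim: k => [|k IH].
  by rewrite !expr0 expr1 !mul1r !mulr1 divff// mul1r le_eqVlt; apply/orP; left; apply/eqP; ring.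
rewrite [leRHS]exprS; apply: le_trans (ler_wpM2l x0 IH).
have Y0 : 0 <= y ^+ k by rewrite exprn_ge0.
have P0 : 0 <= rho ^+ k by rewrite exprn_ge0.
have P1 : rho ^+ k.+1 <= 1 by rewrite exprn_ile1.
have E2 : k.+2%:R = k%:R + 2 :> R by rewrite -addn2 natrD.
have E1 : k.+1%:R = k%:R + 1 :> R by rewrite -addn1 natrD.
have E3 : k.+3%:R = k%:R + 3 :> R by rewrite -addn3 natrD.
have k0 : 0 <= k%:R :> R by [].
have k2 : 0 <= k%:R + 2 :> R by lra.
have k1 : 0 <= k%:R + 1 :> R by lra.
have h1 : rho ^+ k * ((k%:R + 2) * (k%:R + 1) / 2) * y ^+ k * (x - y) ^+ 2 * (rho * y) <=
          rho ^+ k * ((k%:R + 2) * (k%:R + 1) / 2) * y ^+ k * (x - y) ^+ 2 * x.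
  rewrite ler_wpM2l//; apply: mulr_ge0; last exact: sqr_ge0.
  by rewrite !mulr_ge0.
have h2 : rho ^+ k.+1 * ((k%:R + 2) * (y * y ^+ k) * (x - y) ^+ 2) <= (k%:R + 2) * (y * y ^+ k) * (x - y) ^+ 2.
  rewrite ler_piMl//; apply: mulr_ge0; last exact: sqr_ge0.
  by rewrite !mulr_ge0.
rewrite E1 E2 E3; move: h1 h2; rewrite !exprS !expr0.
move: (rho ^+ k) (y ^+ k) (k%:R : R) => P Y K h1 h2; lra.
Qed.

Lemma capprof_ellipsoid p (A B t : R) : 0 <= B -> 0 <= t -> capprof p A A B t = conecap p (A + B * t).
Proof.
by move=> B0 t0; rewrite /capprof /qprofile /conecap (max_idPr _)// lerDl mulr_ge0.
Qed.

Lemma sqmean_cap_gt0 n (c : R) : 0 < c < 1 -> 0 < sqmean n.+1 (\1_`[c ^+ 2, +oo[ : R -> R).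
Proof.
move=> c01; have /andP[h _] := sqmean_cap n c01.
have M0 := @sphere_mass_gt0 R n.+1; rewrite -(pmulr_rgt0 _ M0).
apply: lt_le_trans h; rewrite mulr_gt0 ?sphere_mass_gt0//.
have /andP[c0 c1] := c01.
apply: lt_le_trans (cap_area_ge _ _) => //; rewrite divr_gt0// mulr_gt0// exprn_gt0// axdist_gt0//.
by rewrite ltW.
Qed.

Lemma bmeas_id : bmeas (@id R).
Proof. by apply: bmeas_continuous => x; exact: cvg_id. Qed.

Lemma sqmean_affine n (a b : R) : sqmean n (fun t => a + b * t) = a + b * n.+1%:R^-1.
Proof.
rewrite sqmeanD; [|exact: bmeas_cst|by apply: bmeasZ; exact: bmeas_id].
rewrite sqmeanZ; last exact: bmeas_id.
by rewrite sqmean_id (sqmean_cst n a).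
Qed.

Lemma sqmean_close n (f g : R -> R) e : bmeas f -> bmeas g ->
  (forall t, 0 <= t <= 1 -> `|f t - g t| <= e) -> `|sqmean n f - sqmean n g| <= e.
Proof.
move=> bf bg fg; have be : bmeas (fun _ : R => e) by exact: bmeas_cst.
have Ee : sqmean n (fun _ : R => e) = e by exact: sqmean_cst.
have h1 : sqmean n f <= sqmean n g + e.
  rewrite -[X in _ + X]Ee -(sqmeanD _ bg be); apply: sqmean_le => //; first exact: bmeasD.
  by move=> t /fg; rewrite ler_norml; move: (f t) (g t) => x y; lra.
have h2 : sqmean n g <= sqmean n f + e.
  rewrite -[X in _ + X]Ee -(sqmeanD _ bf be); apply: sqmean_le => //; first exact: bmeasD.
  by move=> t /fg; rewrite ler_norml; move: (f t) (g t) => x y; lra.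
by rewrite ler_norml; apply/andP; split; lra.
Qed.

(** The polar caps have positive measure, and there t is away from its mean. *)
Lemma sqmean_var_gt0 n : (2 <= n)%N -> 0 < sqmean n (fun t => (t - n.+1%:R^-1) ^+ 2) :> R.
Proof.
case: n => [//|[//|n]] _; set nu : R := n.+3%:R^-1.
have nu3 : 0 < nu <= 1 / 3.
  rewrite /nu invr_gt0 ltr0n/= div1r lef_pV2 ?posrE ?ltr0n//.
  by rewrite -[3 in leLHS]/(3%:R) ler_nat.
have c01 : 0 < (9 / 10 : R) < 1 by apply/andP; split; lra.
have := sqmean_cap_gt0 n.+1 c01 => h.
apply: (@lt_le_trans _ _ (9^-1 * sqmean n.+2 (\1_`[(9 / 10) ^+ 2, +oo[ : R -> R))).
  by rewrite mulr_gt0.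
rewrite -sqmeanZ; last exact: bmeas_indic.
apply: sqmean_le.
- by apply: bmeasZ; exact: bmeas_indic.
- apply: bmeasX; apply: bmeasB; first exact: bmeas_id.
  exact: bmeas_cst.
move=> t t01; rewrite indicE; case: (boolP (_ \in _)) => [|_]; last by rewrite mulr0 sqr_ge0.
rewrite inE /= in_itv /= andbT mulr1 => ht; nra.
Qed.

Section larger.
Variables (q : nat) (w0 : R).
Hypothesis w00 : 0 < w0.

Let J0 := conecap q.+2 w0.
Let H0 := conecap q.+3 w0.
Let c0 := coheight w0.
Let s0 := axdist c0.
Let C := coheight_slope w0.
Let j := s0 ^+ q * C.
Let h := s0 ^+ q.+1 * C.
Let nu : R := q.+3%:R^-1.
Let nu' : R := q.+2%:R^-1.
Let V := sqmean q.+2 (fun t : R => (t - nu) ^+ 2).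
Let Q := deficit_curv q w0.
Let K3 := 2 / h.
Let K1 := 2 + j * K3.
Let K2 := 2 * j * K1.

Let J00 : 0 < J0. Proof. exact: conecap_gt0. Qed.
Let C0 : 0 < C. Proof. exact: coheight_slope_gt0. Qed.
Let s00 : 0 < s0.
Proof. by have /andP[a b] := coheight01 w00; apply: axdist_gt0; rewrite ltW. Qed.
Let j0 : 0 < j. Proof. by rewrite mulr_gt0// exprn_gt0. Qed.
Let h0 : 0 < h. Proof. by rewrite mulr_gt0// exprn_gt0. Qed.

(** A lower bound for the gain of the ellipsoid over the ball, divided by the square of
the eccentricity parameter, when all expansions hold up to a relative error e: the
first term is the loss in the mean section volume, the second one the gain due to
the variance of the section volumes. *)
Let gain (e : R) : R :=
  - (q.+3%:R * J0 ^+ q.+2 * ((Q + e) * (V + (K3 * e) ^+ 2)))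
  + (1 - e) ^+ q.+1 * (q.+3%:R * q.+2%:R / 2) * J0 ^+ q.+1 * ((j * nu') ^+ 2 * V - K2 * e).

(** The squared slope has variance V and the section volumes have variance
(j * nu')^2 V. What remains to be compared is the content of [cap_area_lt]. *)
Let gain0 : 0 < gain 0.
Proof.
have V0 : 0 < V by exact: sqmean_var_gt0.
have key := cap_area_lt q (coheight01 w00).
rewrite /gain mulr0 expr0n /= !addr0 subr0 expr1n mul1r mulr0 subr0.
have -> : Q = s0 ^+ q * c0 / (2 * s0 ^+ 2) * C ^+ 2 by [].
rewrite -/c0 -/s0 -[cap_area _ _]/J0 in key.
have q2 : 0 < q.+2%:R :> R by rewrite ltr0n.
have q3 : 0 < q.+3%:R :> R by rewrite ltr0n.
rewrite /j /nu'.
have -> : - (q.+3%:R * J0 ^+ q.+2 * (s0 ^+ q * c0 / (2 * s0 ^+ 2) * C ^+ 2 * V)) +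
   q.+3%:R * q.+2%:R / 2 * J0 ^+ q.+1 * ((s0 ^+ q * C * q.+2%:R^-1) ^+ 2 * V) =
   q.+3%:R * J0 ^+ q.+1 * V * (s0 ^+ q * C ^+ 2 / (2 * q.+2%:R * s0 ^+ 2)) *
   (s0 ^+ q.+2 - q.+2%:R * c0 * J0).
  rewrite (exprS J0 q.+1) (exprS s0 q.+1) (exprS s0 q).
  move: (J0 ^+ q.+1) (s0 ^+ q) (q.+3%:R : R) (q.+2%:R : R) q2 => X S q3' q2' q20.
  by field; rewrite !gt_eqF.
rewrite mulr_gt0 ?subr_gt0// !mulr_gt0 ?exprn_gt0// ?invr_gt0 ?mulr_gt0 ?exprn_gt0//;
  by [exact: coheight_gt0|rewrite addr_gt0].
Qed.

Let gain_pos : exists2 e, 0 < e <= 2^-1 & 0 < gain e.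
Proof.
have cg : continuous gain.
  have cvgx2 (u : R -> R) x : u y @[y --> x] --> u x -> u y ^+ 2 @[y --> x] --> u x ^+ 2.
    by move=> ux; rewrite expr2; apply: cvgM.
  move=> x; rewrite /gain; apply: cvgD.
    apply: cvgN; apply: cvgM; first exact: cvg_cst.
    apply: cvgM; first by apply: cvgD; [exact: cvg_cst|exact: cvg_id].
    apply: cvgD; first exact: cvg_cst.
    by apply: (cvgx2 (fun e => K3 * e)); apply: cvgM; [exact: cvg_cst|exact: cvg_id].
  apply: cvgM.
    apply: cvgM; last exact: cvg_cst.
    apply: cvgM; last exact: cvg_cst.
    apply: (@cvg_comp _ _ _ (fun e : R => 1 - e) (fun y : R => y ^+ q.+1) _ (nbhs (1 - x))).
      by apply: cvgB; [exact: cvg_cst|exact: cvg_id].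
    exact: exprn_continuous.
  apply: cvgB; first exact: cvg_cst.
  by apply: cvgM; [exact: cvg_cst|exact: cvg_id].
have /cvgrPdist_lt/(_ _ gain0)/nbhs_ballP[d /= d0 hd] := cg 0.
have d2 : 0 < d / 2 by rewrite divr_gt0.
pose m : R := Num.min (d / 2) 2^-1.
have m0 : 0 < m by rewrite /m lt_min d2 invr_gt0 ltr0n.
have m1 : m <= 2^-1 by rewrite ge_min lexx orbT.
have m2 : m <= d / 2 by rewrite ge_min lexx.
exists m; first by rewrite m0 m1.
have : `|gain 0 - gain m| < gain 0.
  by apply: hd; rewrite /ball /= sub0r normrN (gtr0_norm m0); lra.
by rewrite ltr_norml; move: (gain 0) (gain m) => a b; lra.
Qed.

(** The squared slope A + x * t is centered by the volume constraint, so that its mean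
differs from w0 by kap = o(x). To first order the section volume at t is then
J0 + j * x * nu' * (t - nu), and its mean is bounded below by [deficit_ge]. *)
Lemma ellipsoid_larger : exists A B, [/\ 0 < A, 0 <= B,
  sqmean q.+2 (capprof q.+3 A A B) = conecap q.+3 w0 &
  conecap q.+2 w0 ^+ q.+3 < sqmean q.+2 (fun t => slice_mean q.+1 (capprof q.+2 A A B) t ^+ q.+3)].
Proof.
have [e /andP[e0 e12] ge0] := gain_pos.
have [d1 d10 hH] := first_order (is_derive_conecap q.+1 w00) e0.
have [d2 d20 hJ] := first_order (is_derive_conecap q w00) e0.
have [d3 d30 hD] := deficit_ge q w00 e0.
pose x := Num.min (Num.min d1 (Num.min d2 d3)) (Num.min (w0 / 2) (e * J0 / (j + e))).
have je0 : 0 < j + e by rewrite addr_gt0.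
have x0 : 0 < x by rewrite !lt_min d10 d20 d30 !divr_gt0// mulr_gt0.
have [xd1 xd2 xd3 xw xe] : [/\ x <= d1, x <= d2, x <= d3, x <= w0 / 2 & x * (j + e) <= e * J0].
  rewrite -ler_pdivlMr//; have := lexx x; rewrite {2}/x !le_min.
  by case/andP => /and3P[h1 h2 h3] /andP[h4 h5]; split.
clearbody x; have x0' := ltW x0.
have A00 : 0 < w0 - x by lra.
have w20 : 0 < w0 / 2 by rewrite divr_gt0.
have wnear A t : w0 - x <= A <= w0 -> 0 <= t <= 1 -> `|A + x * t - w0| <= x.
  by move=> /andP[A1 A2] /andP[t1 t2]; rewrite ler_norml; apply/andP; split; nra.
have [A /andP[A1 A2] EA] : exists2 A, w0 - x <= A <= w0 & sqmean q.+2 (capprof q.+3 A A x) = H0.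
  apply: (@sqmean_ivt R q.+2 (fun A => capprof q.+3 A A x) (w0 - x) w0 (coheight (w0 / 2))^-1).
  - by lra.
  - by rewrite invr_ge0 ltW// coheight_gt0.
  - move=> a /andP[a1 _]; apply: bmeas_continuous; apply: continuous_capprof.
    exact: lt_le_trans a1.
  - move=> a b t /andP[a1 a2] /andP[b1 b2] /andP[t1 t2]; rewrite !capprof_ellipsoid//.
    have xt : 0 <= x * t by rewrite mulr_ge0.
    have -> : a - b = (a + x * t) - (b + x * t) by ring.
    by apply: conecap_lip => //; lra.
  apply/andP; split.
    rewrite -[leRHS](sqmean_cst q.+2 H0); apply: sqmean_le; last first.
    - move=> t /andP[t1 t2]; rewrite capprof_ellipsoid//; apply: conecap_anti => //.
      by rewrite lerDl mulr_ge0.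
    - exact: bmeas_cst.
    - by apply: bmeas_continuous; exact: continuous_capprof.
  rewrite -[leLHS](sqmean_cst q.+2 H0); apply: sqmean_le.
  - exact: bmeas_cst.
  - by apply: bmeas_continuous; exact: continuous_capprof.
  - move=> t /andP[t1 t2]; rewrite capprof_ellipsoid//; apply: conecap_anti => //.
      by rewrite ltr_wpDr// mulr_ge0.
    by nra.
have A0 : 0 < A by exact: lt_le_trans A1.
have AI : w0 - x <= A <= w0 by rewrite A1.
exists A, x; split => //.
have bH : bmeas (capprof q.+3 A A x) by apply: bmeas_continuous; exact: continuous_capprof.
have cJ : continuous (capprof q.+2 A A x) by exact: continuous_capprof.
have pJ t : 0 <= capprof q.+2 A A x t by exact: capprof_ge0.
have bJ : bmeas (capprof q.+2 A A x) by exact: bmeas_continuous.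
pose S := slice_mean q.+1 (capprof q.+2 A A x).
have bS : bmeas S by exact: bmeas_slice_mean.
have ES : sqmean q.+2 S = sqmean q.+2 (capprof q.+2 A A x) by exact: sqmean_slice_mean.
have baff (a b : R) : bmeas (fun t : R => a + b * t).
  by apply: bmeasD; [exact: bmeas_cst|apply: bmeasZ; exact: bmeas_id].
pose kap := A + x * nu - w0.
(* By the volume constraint, H0 is the mean of H0 - h * (w - w0) up to an error
   e * x. *)
have kapE : `|kap| <= K3 * e * x.
  have : `|sqmean q.+2 (capprof q.+3 A A x) - sqmean q.+2 (fun t => (H0 - h * (A - w0)) + (- h * x) * t)| <= e * x.
    apply: sqmean_close => // t t01; have [t1 t2] := andP t01; rewrite capprof_ellipsoid//.
    have wn := wnear A t AI t01.
    have := hH (A + x * t) (le_trans wn xd1).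
    rewrite (_ : conecap _ _ - _ - _ = conecap q.+3 (A + x * t) - (H0 - h * (A - w0) + - h * x * t)).
      by move=> hh; apply: le_trans hh _; rewrite ler_wpM2l// ltW.
    by rewrite /H0 /h /s0 /C /c0; move: (conecap _ _) (conecap _ _) => X Y; ring.
  rewrite EA sqmean_affine (_ : _ - _ = h * kap); last by rewrite /kap /nu; ring.
  rewrite normrM (gtr0_norm h0) -ler_pdivlMl// => hk; apply: le_trans hk _.
  rewrite /K3 (_ : 2 / h * e * x = h^-1 * (e * x) + h^-1 * (e * x)); last by ring.
  by rewrite lerDl mulr_ge0// ?invr_ge0 ?ltW// mulr_gt0.
have Jdev t : 0 <= t <= 1 -> `|capprof q.+2 A A x t - (J0 - j * (A - w0) + - (j * x) * t)| <= e * x.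
  move=> t01; have [t1 t2] := andP t01; rewrite capprof_ellipsoid//.
  have wn := wnear A t AI t01.
  have := hJ (A + x * t) (le_trans wn xd2).
  rewrite (_ : conecap _ _ - _ - _ = conecap q.+2 (A + x * t) - (J0 - j * (A - w0) + - (j * x) * t)).
    by move=> hh; apply: le_trans hh _; rewrite ler_wpM2l// ltW.
  by rewrite /J0 /j /s0 /C /c0; move: (conecap _ _) (conecap _ _) => X Y; ring.
(* Averaging over a slice multiplies the deviation t - nu of the squared coordinate
   from its mean by - nu'. *)
have Sdev t : 0 <= t <= 1 -> `|S t - J0 - j * x * nu' * (t - nu)| <= K1 * e * x.
  move=> t01; have [t1 t2] := andP t01.
  have : `|S t - sqmean q.+1 (fun v => (J0 - j * (A - w0)) + (- (j * x) * (1 - t)) * v)| <= e * x.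
    apply: sqmean_close; last first.
    - move=> v /andP[v1 v2]; rewrite -mulrA; apply: Jdev.
      by apply/andP; split; [rewrite mulr_ge0// subr_ge0|nra].
    - exact: baff.
    - by apply: bmeas_continuous; exact: continuous_scale.
  rewrite sqmean_affine -/nu' => h1.
  have nuE : nu' - nu = nu' * nu.
    rewrite /nu /nu'; have -> : q.+3%:R = q.+2%:R + 1 :> R by rewrite -natr1.
    have : 0 < q.+2%:R :> R by rewrite ltr0n.
    by move: (q.+2%:R : R) => N N0; field; rewrite !gt_eqF// addr_gt0.
  have -> : S t - J0 - j * x * nu' * (t - nu) =
     (S t - (J0 - j * (A - w0) + - (j * x) * (1 - t) * nu')) - j * kap.
    rewrite /kap mulrBr -!mulrA mulrBr -nuE.
    by move: (S t) => X; ring.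
  apply: le_trans (ler_normB _ _) _.
  rewrite /K1 (_ : (2 + j * K3) * e * x = e * x + e * x + j * (K3 * e * x)); last by ring.
  apply: lerD; first by apply: le_trans h1 _; rewrite lerDl ltW// mulr_gt0.
  by rewrite normrM (gtr0_norm j0) ler_wpM2l// ltW.
have nu01 : 0 <= nu <= 1 by rewrite invr_ge0 ler0n/= invf_le1 ?ltr0n// ler1n.
have nu'01 : 0 <= nu' <= 1 by rewrite invr_ge0 ler0n/= invf_le1 ?ltr0n// ler1n.
have K30 : 0 < K3 by rewrite divr_gt0.
have K10 : 0 < K1 by rewrite addr_gt0// mulr_gt0.
have Ssq t : 0 <= t <= 1 ->
    (j * x * nu') ^+ 2 * (t - nu) ^+ 2 - K2 * e * x ^+ 2 <= (S t - J0) ^+ 2.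
  move=> t01; have := Sdev t t01; move: (S t - J0) => s hs.
  have hjx : 0 <= j * x by rewrite mulr_ge0// ltW.
  have gle : `|j * x * nu' * (t - nu)| <= j * x.
    have t1 : `|t - nu| <= 1.
      by move: t01 nu01 => /andP[? ?] /andP[? ?]; rewrite ler_norml; apply/andP; split; lra.
    rewrite normrM ger0_norm; last by apply: mulr_ge0; [exact: hjx|case/andP: nu'01].
    by rewrite -(mulrA (j * x)) ler_piMr//; case/andP: nu'01 => n1 n2; rewrite mulr_ile1.
  rewrite -exprMn; move: (j * x * nu' * (t - nu)) gle hs => g gle hs.
  have : `|g * (s - g)| <= j * x * (K1 * e * x) by rewrite normrM ler_pM.
  rewrite ler_norml => /andP[hg _]; have := sqr_ge0 (s - g); rewrite /K2.
  by move: hg; move: (j) (K1) => a b; lra.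
(* As x * (j + e) <= e * J0, no section volume falls below (1 - e) * J0. *)
have Slow t : 0 <= t <= 1 -> (1 - e) * J0 <= S t.
  move=> t01; have [t1 t2] := andP t01.
  rewrite -[leLHS](sqmean_cst q.+1); apply: sqmean_le; first exact: bmeas_cst.
    by apply: bmeas_continuous; exact: continuous_scale.
  move=> v /andP[v1 v2] /=.
  have u01 : 0 <= (1 - t) * v <= 1.
    by apply/andP; split; [rewrite mulr_ge0// subr_ge0|nra].
  have := Jdev _ u01; move: ((1 - t) * v) u01 => u u01; have := wnear A u AI u01.
  rewrite !ler_norml; move: (capprof _ _ _ _ _) => X /andP[h1 h2] /andP[h3 h4].
  have h5 := ler_wpM2l (ltW j0) h2; nra.
have ESlow : - ((Q + e) * (x ^+ 2 * (V + (K3 * e) ^+ 2))) <= sqmean q.+2 S - J0.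
  have b1 : bmeas (fun t => capprof q.+3 A A x t - H0) by exact: (bmeasB bH (bmeas_cst H0)).
  have b2 : bmeas (fun t => capprof q.+2 A A x t - J0) by exact: (bmeasB bJ (bmeas_cst J0)).
  have -> : sqmean q.+2 S - J0 = sqmean q.+2 (fun t => capprof q.+2 A A x t - J0 - s0^-1 * (capprof q.+3 A A x t - H0)).
    rewrite (sqmeanB _ b2 (bmeasZ _ b1)) (sqmeanZ _ _ b1) (sqmeanB _ bH (bmeas_cst H0)).
    rewrite (sqmeanB _ bJ (bmeas_cst J0)) EA ES (sqmean_cst q.+2 J0) (sqmean_cst q.+2 H0).
    by move: (sqmean _ _) => X; ring.
  have bf : bmeas (fun t : R => t - nu) by apply: bmeasB; [exact: bmeas_id|exact: bmeas_cst].
  have bf2 : bmeas (fun t : R => (t - nu) ^+ 2) by exact: bmeasX.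
  apply: (@le_trans _ _ (sqmean q.+2 (fun t => - (Q + e) * (A + x * t - w0) ^+ 2))); last first.
    apply: sqmean_le.
    - apply: bmeasZ; apply: bmeasX; apply: bmeasB; last exact: bmeas_cst.
      exact: baff.
    - exact: (bmeasB b2 (bmeasZ _ b1)).
    - move=> t t01; have [t1 t2] := andP t01; rewrite !capprof_ellipsoid//.
      have wn := wnear A t AI t01.
      apply: le_trans (hD _ (le_trans wn xd3)) _; rewrite /deficit.
      by rewrite [_^-1 * _]mulrC.
  have -> : sqmean q.+2 (fun t => - (Q + e) * (A + x * t - w0) ^+ 2) =
      - (Q + e) * (kap ^+ 2 + x ^+ 2 * V).
    rewrite sqmeanZ; last first.
      by apply: bmeasX; apply: bmeasB; [exact: baff|exact: bmeas_cst].
    congr (_ * _); transitivity (sqmean q.+2 (fun t : R =>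
        (kap ^+ 2 - 2 * kap * x * nu) + 2 * kap * x * t + x ^+ 2 * (t - nu) ^+ 2)).
      by apply: eq_Ex => t _; rewrite /kap; ring.
    rewrite (sqmeanD _ (baff _ _) (bmeasZ _ bf2)) sqmean_affine (sqmeanZ _ _ bf2) -/nu -/V.
    by move: (V) => V'; ring.
  rewrite mulNr lerN2 ler_wpM2l//.
    by rewrite addr_ge0 ?(ltW e0)// ltW// deficit_curv_gt0.
  rewrite mulrDr addrC lerD2l -exprMn -[leLHS]real_normK ?num_real//.
  have xK : 0 <= x * (K3 * e) by exact: mulr_ge0 x0' (mulr_ge0 (ltW K30) (ltW e0)).
  by rewrite ler_sqr ?nnegrE// [leRHS]mulrC; exact: kapE.
pose c2 : R := (1 - e) ^+ q.+1 * (q.+3%:R * q.+2%:R / 2) * J0 ^+ q.+1.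
have c20 : 0 <= c2.
  rewrite /c2 mulr_ge0 ?exprn_ge0 ?(ltW J00)//; last first.
  by rewrite mulr_ge0 ?exprn_ge0//; lra.
pose c1 : R := q.+3%:R * J0 ^+ q.+2.
have c10 : 0 <= c1 by rewrite mulr_ge0 ?exprn_ge0 ?(ltW J00).
have low t : 0 <= t <= 1 ->
   (J0 ^+ q.+3 - c1 * J0 - c2 * (K2 * e * x ^+ 2)) + c1 * S t + c2 * (j * x * nu') ^+ 2 * (t - nu) ^+ 2 <= S t ^+ q.+3.
  move=> t01.
  have e01 : 0 <= 1 - e <= 1 by apply/andP; split; lra.
  have := exprn_ge_quadratic q.+1 e01 (ltW J00) (Slow t t01).
  rewrite -/c1 -/c2; apply: le_trans.
  have := ler_wpM2l c20 (Ssq t t01).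
  by move: (S t) => s; move: (c1) (c2) (J0 ^+ q.+3) => u v w; lra.
have bf2 : bmeas (fun t : R => (t - nu) ^+ 2).
  by apply: bmeasX; apply: bmeasB; [exact: bmeas_id|exact: bmeas_cst].
have bc1 : bmeas (fun t : R => c1 * S t) by exact: bmeasZ.
have bc2 : bmeas (fun t : R => c2 * (j * x * nu') ^+ 2 * (t - nu) ^+ 2) by exact: bmeasZ.
have bc3 := bmeasD (bmeas_cst (J0 ^+ q.+3 - c1 * J0 - c2 * (K2 * e * x ^+ 2))) bc1.
apply: lt_le_trans (sqmean_le q.+2 (bmeasD bc3 bc2) (bmeasX _ bS) low).
rewrite (sqmeanD _ bc3 bc2) (sqmeanD _ (bmeas_cst _) bc1) (sqmean_cst q.+2) (sqmeanZ _ _ bS) (sqmeanZ _ _ bf2) -/V.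
have x20 : 0 < x ^+ 2 by rewrite exprn_gt0.
have := mulr_gt0 ge0 x20; rewrite /gain -/c1 -/c2.
have := ler_wpM2l c10 ESlow.
rewrite !exprMn; move: (sqmean q.+2 S) (c1) (c2) (J0 ^+ q.+3) => s u v w.
rewrite -!exprMn; move: (V) (K2) (Q) => V' K Q'.
rewrite (_ : (j * x * nu') ^+ 2 = (j * nu') ^+ 2 * x ^+ 2); last by ring.
move: ((j * nu') ^+ 2) ((K3 * e) ^+ 2) (x ^+ 2) => a b c; lra.
Qed.

End larger.

End ellipsoid.

(** * Cut balls have smaller section integral than the ball *)

Section cut.
Context {R : realType}.

(** The polar caps of radius e, in terms of the squared coordinate. *)
Definition tail (e : R) : R -> R := \1_`[1 - e ^+ 2, +oo[.

Lemma bmeas_tail e : bmeas (tail e).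
Proof. exact: bmeas_indic. Qed.

Lemma tailT e t : 1 - e ^+ 2 <= t -> tail e t = 1.
Proof. by move=> h; rewrite /tail indicE mem_set//= in_itv /= h. Qed.

Lemma tailF e t : t < 1 - e ^+ 2 -> tail e t = 0.
Proof.
by move=> h; rewrite /tail indicE memNset//= in_itv /= andbT; apply/negP; rewrite -ltNge.
Qed.

Lemma sqmean_tail n : exists k K, [/\ 0 < k, 0 < K & forall e : R, 0 < e <= 2^-1 ->
  k * e ^+ n.+1 <= sqmean n.+1 (tail e) <= K * e ^+ n.+1].
Proof.
pose rho := @sphere_mass R n.+1 / @sphere_mass R n.+2.
have m1 := @sphere_mass_gt0 R n; have m2 := @sphere_mass_gt0 R n.+1.
have rho0 : 0 < rho by rewrite divr_gt0.
exists (rho / (2 * n.+1%:R)), (4 * rho); split.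
- by rewrite divr_gt0// mulr_gt0.
- by rewrite mulr_gt0.
move=> e /andP[e0 e12].
have e2 : 0 < e ^+ 2 <= 4^-1 by rewrite exprn_gt0//=; nra.
pose c := Num.sqrt (1 - e ^+ 2).
have cc : c ^+ 2 = 1 - e ^+ 2 by rewrite sqr_sqrtr//; lra.
have c0 : 0 < c by rewrite sqrtr_gt0; lra.
have c1 : c < 1.
  by rewrite -(ltr_pXn2r (n := 2)) ?nnegrE ?(ltW c0)// cc expr1n; lra.
have c2 : 2^-1 <= c.
  by rewrite -(ler_pXn2r (n := 2)) ?nnegrE ?(ltW c0)// cc; lra.
have ce : axdist c = e.
  apply/eqP; rewrite -(eqrXn2 (n := 2)) ?axdist_ge0 ?(ltW e0)// axdist_sqr ?cc; first by apply/eqP; ring.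
  by rewrite (ltW c0) (ltW c1).
have c01 : 0 < c < 1 by rewrite c0.
have := sqmean_cap n c01; rewrite cc -/(tail e) => /andP[lo hi].
move: (sqmean _ _) lo hi => P lo hi; apply/andP; split.
  rewrite -(ler_pM2l m2); apply: le_trans lo.
  have -> : @sphere_mass R n.+2 * (rho / (2 * n.+1%:R) * e ^+ n.+1) =
    @sphere_mass R n.+1 * (2^-1 * axdist c ^+ n.+1 / n.+1%:R).
    rewrite ce /rho; have : 0 < n.+1%:R :> R by [].
    move: (e ^+ n.+1) (n.+1%:R : R) (sphere_mass n.+1) (sphere_mass n.+2) m1 m2 => X N a b a0 b0 N0.
    by field; rewrite !gt_eqF.
  rewrite ler_pM2l//; apply: le_trans (cap_area_ge _ _) => //.
  by rewrite ler_wpM2r ?invr_ge0// ler_wpM2r// exprn_ge0// axdist_ge0.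
rewrite -(ler_pM2l m2); apply: le_trans hi _.
have -> : @sphere_mass R n.+2 * (4 * rho * e ^+ n.+1) = 2 * (@sphere_mass R n.+1 * (2 * axdist c ^+ n.+1)).
  rewrite ce /rho; move: (e ^+ n.+1) (sphere_mass n.+1) (sphere_mass n.+2) m1 m2 => X a b a0 b0.
  by field; rewrite gt_eqF.
rewrite ler_wpM2l// ler_pM2l//; apply: cap_area_le => //.
by rewrite (ltW c0) (ltW c1).
Qed.

Lemma exprn_sub_le k (x y : R) : 0 <= y <= x ->
  (x - y) ^+ k.+2 <= x ^+ k.+2 - k.+2%:R * x ^+ k.+1 * y + k.+2%:R ^+ 2 * x ^+ k * y ^+ 2.
Proof.
move=> /andP[y0 yx]; have x0 : 0 <= x by exact: le_trans yx.
elim: k => [|k IH]; first by rewrite expr0 expr1; nra.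
rewrite exprS; have xy : 0 <= x - y by rewrite subr_ge0.
apply: le_trans (ler_wpM2l xy IH) _.
have -> : k.+3%:R = k.+2%:R + 1 :> R by rewrite -natr1.
have : 1 <= k.+2%:R :> R by rewrite ler1n.
have : 0 <= x ^+ k by rewrite exprn_ge0.
rewrite !(exprS x); move: (x ^+ k) (k.+2%:R : R) => X N X0 N1.
rewrite -subr_ge0.
have -> : x * (x * (x * X)) - (N + 1) * (x * (x * X)) * y + (N + 1) ^+ 2 * (x * X) * y ^+ 2 -
  (x - y) * (x * (x * X) - N * (x * X) * y + N ^+ 2 * X * y ^+ 2) =
  X * y ^+ 2 * ((N + 1) * x + N ^+ 2 * y) by ring.
by apply: mulr_ge0; [apply: mulr_ge0 => //; exact: sqr_ge0|nra].
Qed.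

Lemma exprn_ge_tangent k (x y : R) : 0 <= x -> 0 <= y ->
  x ^+ k.+1 + k.+1%:R * x ^+ k * (y - x) <= y ^+ k.+1.
Proof.
move=> x0 y0; elim: k => [|k IH]; first by rewrite expr0 !expr1; lra.
rewrite (exprS y); apply: le_trans (ler_wpM2l y0 IH).
have -> : k.+2%:R = k.+1%:R + 1 :> R by rewrite -natr1.
rewrite -subr_ge0 !(exprS x).
have : 0 <= x ^+ k by rewrite exprn_ge0.
have : 0 <= k.+1%:R :> R by [].
move: (x ^+ k) (k.+1%:R : R) => X N N0 X0.
have -> : y * (x * X + N * X * (y - x)) - (x * (x * X) + (N + 1) * (x * X) * (y - x)) =
  N * X * (y - x) ^+ 2 by ring.
by rewrite mulr_ge0// ?sqr_ge0// mulr_ge0.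
Qed.

Section cut_profile.
Variables (m a : R).
Hypotheses (m0 : 0 < m) (m1 : m <= 1) (a0 : 0 < a).

(** Squared slope of the ball of squared slope a with two caps cut off, those of the
directions whose squared coordinate along the cut axis exceeds m; it is continuous,
and a / m at the axis. *)
Definition cutslope t : R := Num.max a (0 + a / m * t).

Lemma cutslope_near t : t < m -> cutslope t = a.
Proof.
move=> tm; rewrite /cutslope add0r; apply/max_idPl.
by rewrite -mulrA ler_piMr ?(ltW a0)// mulrC ler_pdivrMr// mul1r ltW.
Qed.

Lemma cutslope_far t : m <= t -> cutslope t = a / m * t.
Proof.
move=> mt; rewrite /cutslope add0r; apply/max_idPr.
by rewrite -mulrA ler_peMr ?(ltW a0)// mulrC ler_pdivlMr// mul1r.
Qed.

Lemma cutslope_ge t : a <= cutslope t.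
Proof. by rewrite le_max lexx. Qed.

Lemma cutslope_le t : t <= 1 -> cutslope t <= a / m.
Proof.
move=> t1; rewrite /cutslope ge_max add0r; apply/andP; split.
  by rewrite ler_pdivlMr// ler_piMr// ltW.
by rewrite ler_piMr// divr_ge0// ltW.
Qed.

End cut_profile.

Lemma cutslope_lip (m a b t : R) : 0 < m -> 0 < a -> 0 < b -> 2^-1 <= m -> 0 <= t <= 1 ->
  `|cutslope m a t - cutslope m b t| <= 2 * `|a - b|.
Proof.
move=> m0 a0 b0 m2 /andP[t0 t1]; have [tm|mt] := ltP t m.
  by rewrite !cutslope_near//; have := normr_ge0 (a - b); lra.
rewrite !cutslope_far// (_ : a / m * t - b / m * t = (t / m) * (a - b)); last by ring.
rewrite normrM ler_wpM2r// ger0_norm ?divr_ge0 ?(ltW m0)//.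
by rewrite ler_pdivrMr//; lra.
Qed.

Section smaller.
Variables (q : nat) (w0 : R).
Hypothesis w00 : 0 < w0.

Let J0 := conecap q.+2 w0.
Let H0 := conecap q.+3 w0.
Let N : R := q.+3%:R.
Let L := (coheight (w0 / 2))^-1.
Let L' := 2 * L * w0.

Let w20 : 0 < w0 / 2. Proof. by rewrite divr_gt0. Qed.
Let J00 : 0 < J0. Proof. exact: conecap_gt0. Qed.
Let N0 : 0 < N. Proof. by rewrite ltr0n. Qed.
Let L0 : 0 < L. Proof. by rewrite invr_gt0 coheight_gt0. Qed.
Let L'0 : 0 < L'. Proof. by rewrite !mulr_gt0. Qed.

Section fixed_cut.
Variable e : R.
Hypothesis e01 : 0 < e <= 2^-1.
Let m := 1 - e ^+ 2.

Let e0 : 0 < e. Proof. by case/andP: e01. Qed.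
Let e2 : 0 < e ^+ 2 <= 4^-1.
Proof. by case/andP: e01 => h1 h2; rewrite exprn_gt0//=; nra. Qed.
Let m2 : 2^-1 <= m. Proof. by case/andP: e2 => h1 h2; rewrite /m; lra. Qed.
Let m1 : m <= 1. Proof. by case/andP: e2 => h1 h2; rewrite /m; lra. Qed.
Let m0 : 0 < m. Proof. by apply: lt_le_trans m2; rewrite invr_gt0. Qed.
Let w0m : w0 * m <= w0. Proof. by rewrite ler_piMr// ltW. Qed.
Let w0m0 : w0 / 2 <= w0 * m. Proof. by rewrite ler_pM2l. Qed.

(** At A = w0 the cut ball is contained in the ball of squared slope w0, and at A = w0 * m
it contains that ball, as the squared slope is w0 only at the axis of the cut. *)
Lemma cut_exists : exists2 A, w0 * m <= A <= w0 & sqmean q.+2 (capprof q.+3 A 0 (A / m)) = H0.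
Proof.
apply: (@sqmean_ivt R q.+2 (fun A => capprof q.+3 A 0 (A / m)) (w0 * m) w0 (L * 2)).
- exact: w0m.
- by rewrite mulr_ge0// ltW.
- move=> a /andP[a1 _]; apply: bmeas_continuous; apply: continuous_capprof.
  exact: lt_le_trans (lt_le_trans w20 w0m0) a1.
- move=> a b t /andP[a1 a2] /andP[b1 b2] t01.
  have a3 := le_trans w0m0 a1; have b3 := le_trans w0m0 b1.
  have a4 := lt_le_trans w20 a3; have b4 := lt_le_trans w20 b3.
  apply: le_trans (_ : L * `|cutslope m a t - cutslope m b t| <= _); last first.
    by rewrite -mulrA ler_wpM2l ?(ltW L0)// cutslope_lip.
  apply: (conecap_lip q.+1 w20).
    by apply: le_trans a3 _; exact: cutslope_ge.
  by apply: le_trans b3 _; exact: cutslope_ge.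
have w0m00 : 0 < w0 * m by rewrite mulr_gt0.
apply/andP; split.
  rewrite -[leRHS](sqmean_cst q.+2 H0); apply: sqmean_le.
  - by apply: bmeas_continuous; exact: continuous_capprof.
  - exact: bmeas_cst.
  - by move=> t _; apply: (conecap_anti q.+1 w00); exact: cutslope_ge.
rewrite -[leLHS](sqmean_cst q.+2 H0); apply: sqmean_le.
- exact: bmeas_cst.
- by apply: bmeas_continuous; exact: continuous_capprof.
- move=> t /andP[_ t1]; apply: (conecap_anti q.+1).
    by apply: lt_le_trans w0m00 _; exact: cutslope_ge.
  apply: le_trans (cutslope_le m0 m1 w0m00 t1) _.
  by rewrite mulfK// gt_eqF.
Qed.

Variable A : R.
Hypothesis AI : w0 * m <= A <= w0.
Let W := cutslope m A.
Let J1 := conecap q.+2 A.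
Let prof := capprof q.+2 A 0 (A / m).
Let S := slice_mean q.+1 prof.

Let A2 : w0 / 2 <= A. Proof. by case/andP: AI => h _; apply: le_trans h. Qed.
Let A0 : 0 < A. Proof. exact: lt_le_trans A2. Qed.
Let cprof : continuous prof. Proof. exact: continuous_capprof. Qed.
Let prof0 t : 0 <= prof t. Proof. exact: capprof_ge0. Qed.
Let bprof : bmeas prof. Proof. exact: bmeas_continuous. Qed.
Let bS : bmeas S. Proof. exact: bmeas_slice_mean. Qed.

Let AmE : A / m <= A + 2 * w0 * e ^+ 2.
Proof.
case/andP: AI => _ hA; case/andP: e2 => h1 h2.
rewrite ler_pdivrMr// /m; move: (e ^+ 2) h1 h2 => x h1 h2.
have h3 : 0 <= w0 * (1 - 2 * x) by rewrite mulr_ge0 ?(ltW w00)//; lra.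
have h4 : 0 <= x * (2 * w0 * (1 - x) - A) by rewrite mulr_ge0 ?(ltW h1)//; lra.
rewrite -subr_ge0; apply: le_trans h4 _; lra.
Qed.

Let cut_dist t : t <= 1 -> `|W t - w0| <= 2 * w0 * e ^+ 2.
Proof.
move=> t1; have h1 := cutslope_ge m A t; have h2 := cutslope_le m0 m1 A0 t1.
case/andP: AI => h3 h4; have h5 := le_trans h2 AmE.
have h6 : w0 - w0 * e ^+ 2 <= A by move: h3; rewrite /m mulrBr mulr1.
have h7 : 0 <= w0 * e ^+ 2 by rewrite mulr_ge0 ?sqr_ge0// ltW.
by rewrite -/(W t) in h1 h2 h5; rewrite ler_norml; apply/andP; split; lra.
Qed.

Let prof_le t : prof t <= J1.
Proof. by apply: (conecap_anti q A0); exact: cutslope_ge. Qed.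

(** Only directions in the caps lose area, and there the squared slope increases by at
most 2 * w0 * e^2. *)
Let prof_ge t : t <= 1 -> J1 - prof t <= L' * e ^+ 2 * tail e t.
Proof.
move=> t1; have [tm|mt] := ltP t m.
  rewrite tailF// mulr0 subr_le0.
  by rewrite -[prof t]/(conecap q.+2 (W t)) /W (cutslope_near m0 A0 tm).
rewrite tailT// mulr1.
have h1 := cutslope_ge m A t; have h2 := le_trans (cutslope_le m0 m1 A0 t1) AmE.
have := @conecap_lip R q (w0 / 2) A (W t) w20 A2 (le_trans A2 h1).
rewrite -/L -/J1 -[conecap _ (W t)]/(prof t) => h.
apply: le_trans (ler_norm _) _; apply: le_trans h _.
rewrite (_ : L' * e ^+ 2 = L * (2 * w0 * e ^+ 2)); last by rewrite /L'; ring.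
rewrite ler_wpM2l ?(ltW L0)// distrC ger0_norm ?subr_ge0//.
by rewrite lerBlDl.
Qed.

Let slice_le t : S t <= J1.
Proof.
rewrite -[leRHS](sqmean_cst q.+1); apply: sqmean_le; last by move=> v _; exact: prof_le.
  by apply: bmeas_continuous; exact: continuous_scale.
exact: bmeas_cst.
Qed.

(** A point (1 - t) * v of a slice lies in the cap only if v does, so no slice meets
the cap more than the one at t = 0. *)
Let slice_ge t K : 0 <= t <= 1 -> sqmean q.+1 (tail e) <= K -> J1 - S t <= L' * e ^+ 2 * K.
Proof.
move=> /andP[t0 t1] hK.
have bsc : bmeas (fun v => prof ((1 - t) * v)).
  by apply: bmeas_continuous; exact: continuous_scale.
have -> : J1 - S t = sqmean q.+1 (fun v => J1 - prof ((1 - t) * v)).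
  by rewrite (sqmeanB _ (bmeas_cst J1) bsc) (sqmean_cst q.+1 J1).
apply: (@le_trans _ _ (L' * e ^+ 2 * sqmean q.+1 (tail e))); last first.
  by rewrite ler_wpM2l// mulr_ge0 ?sqr_ge0// ltW.
rewrite -(sqmeanZ _ _ (bmeas_tail e)); apply: sqmean_le.
- exact: bmeasB (bmeas_cst J1) bsc.
- exact: bmeasZ (bmeas_tail e).
move=> v /andP[v0 v1]; have vv : (1 - t) * v <= v by rewrite ler_piMl//; lra.
apply: le_trans (prof_ge (le_trans vv v1)) _.
rewrite ler_wpM2l//; first by rewrite mulr_ge0 ?sqr_ge0// ltW.
have [h|h] := ltP ((1 - t) * v) (1 - e ^+ 2); first by rewrite (tailF h) /tail indicE.
by rewrite (tailT h) (tailT (le_trans h vv)).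
Qed.

Let ES : sqmean q.+2 S = sqmean q.+2 prof. Proof. exact: sqmean_slice_mean. Qed.

Let mean_ge K : sqmean q.+2 (tail e) <= K -> J1 - sqmean q.+2 S <= L' * e ^+ 2 * K.
Proof.
move=> hK; rewrite ES.
have -> : J1 - sqmean q.+2 prof = sqmean q.+2 (fun t => J1 - prof t).
  by rewrite (sqmeanB _ (bmeas_cst J1) bprof) (sqmean_cst q.+2 J1).
apply: (@le_trans _ _ (L' * e ^+ 2 * sqmean q.+2 (tail e))); last first.
  by rewrite ler_wpM2l// mulr_ge0 ?sqr_ge0// ltW.
rewrite -(sqmeanZ _ _ (bmeas_tail e)); apply: sqmean_le.
- exact: bmeasB (bmeas_cst J1) bprof.
- exact: bmeasZ (bmeas_tail e).
by move=> t /andP[t0 t1]; exact: prof_ge.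
Qed.

Let bW : bmeas W.
Proof.
apply: bmeas_continuous => t; apply: (@continuous_max _ _ (cst A) (fun t => 0 + A / m * t)).
  exact: cvg_cst.
by apply: cvgD; [exact: cvg_cst|apply: cvgM; [exact: cvg_cst|exact: cvg_id]].
Qed.

Let bWw : bmeas (fun t => (W t - w0) ^+ 2).
Proof. exact: (bmeasX 2 (bmeasB bW (bmeas_cst w0))). Qed.

(** If A is well below w0, then the uncut directions contribute; otherwise the slope
still exceeds w0 well inside the caps. *)
Let var_ge K : sqmean q.+2 (tail e) <= 2^-1 -> K <= sqmean q.+2 (tail (e / 2)) -> K <= 2^-1 ->
  (w0 / 8 * e ^+ 2) ^+ 2 * K <= sqmean q.+2 (fun t => (W t - w0) ^+ 2).
Proof.
move=> T2 KT K2; have c0 := sqr_ge0 (w0 / 8 * e ^+ 2).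
have x0 : 0 < w0 * e ^+ 2 by case/andP: e2 => h1 h2; rewrite mulr_gt0.
have [hA|hA] := ltP (w0 - w0 * e ^+ 2 / 8) A.
  apply: le_trans (ler_wpM2l c0 KT) _; rewrite -(sqmeanZ _ _ (bmeas_tail _)).
  apply: sqmean_le; [exact: bmeasZ (bmeas_tail _)|exact: bWw|] => t /andP[t0 t1].
  have [ht|ht] := ltP t (1 - (e / 2) ^+ 2); first by rewrite (tailF ht) mulr0 sqr_ge0.
  rewrite (tailT ht) mulr1.
  have mt : m <= t by apply: le_trans ht; rewrite /m exprMn; case/andP: e2 => h1 h2; lra.
  have Wm : W t * m = A * t by rewrite /W (cutslope_far m0 A0 mt); field; rewrite gt_eqF.
  have : w0 / 8 * e ^+ 2 <= W t - w0.
    rewrite -(ler_pM2r m0) mulrBl Wm.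
    have At : A * (1 - (e / 2) ^+ 2) <= A * t by rewrite ler_pM2l.
    have := e2; move: At hA x0; rewrite /m exprMn; move: (e ^+ 2) => x At hA x0 /andP[h1 h2].
    have h3 : 0 <= (A - (w0 - w0 * x / 8)) * (1 - 2^-1 ^+ 2 * x) by rewrite mulr_ge0//; lra.
    have h4 : 0 <= w0 * x * x by rewrite mulr_ge0// ltW.
    nra.
  have p0 : 0 <= w0 / 8 * e ^+ 2 by lra.
  by move=> h; rewrite ler_sqr ?nnegrE// (le_trans p0).
apply: le_trans (_ : (w0 / 8 * e ^+ 2) ^+ 2 * (1 - sqmean q.+2 (tail e)) <= _).
  by rewrite ler_wpM2l//; lra.
have -> : 1 - sqmean q.+2 (tail e) = sqmean q.+2 (fun t => 1 - tail e t).
  by rewrite (sqmeanB _ (bmeas_cst 1) (bmeas_tail e)) (sqmean_cst q.+2 1).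
have b1 := bmeasB (bmeas_cst 1) (bmeas_tail e).
rewrite -(sqmeanZ _ _ b1); apply: sqmean_le; [exact: bmeasZ b1|exact: bWw|] => t _ /=.
have [ht|ht] := ltP t (1 - e ^+ 2); last by rewrite (tailT ht) subrr mulr0 sqr_ge0.
rewrite (tailF ht) subr0 mulr1 /W (cutslope_near m0 A0 ht) -(sqrrN (A - w0)) opprB.
have h : w0 / 8 * e ^+ 2 <= w0 - A by lra.
have h0 : 0 <= w0 / 8 * e ^+ 2 by lra.
by rewrite ler_sqr ?nnegrE// (le_trans h0).
Qed.

(** By the volume constraint, the change of the mean section volume is the mean of
[deficit]. *)
Let deficit_mean k d : 0 < k -> 2 * w0 * e ^+ 2 <= d -> sqmean q.+2 (capprof q.+3 A 0 (A / m)) = H0 ->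
  (forall w, `|w - w0| <= d -> deficit q w0 w <= - k * (w - w0) ^+ 2) ->
  sqmean q.+2 S - J0 <= - k * sqmean q.+2 (fun t => (W t - w0) ^+ 2).
Proof.
move=> k0 ed EH hd.
have bH : bmeas (capprof q.+3 A 0 (A / m)) by apply: bmeas_continuous; exact: continuous_capprof.
pose s0 := axdist (coheight w0).
have b1 : bmeas (fun t => capprof q.+3 A 0 (A / m) t - H0) by exact: (bmeasB bH (bmeas_cst H0)).
have b2 : bmeas (fun t => prof t - J0) by exact: (bmeasB bprof (bmeas_cst J0)).
have -> : sqmean q.+2 S - J0 = sqmean q.+2 (fun t => prof t - J0 - s0^-1 * (capprof q.+3 A 0 (A / m) t - H0)).
  rewrite (sqmeanB _ b2 (bmeasZ _ b1)) (sqmeanZ _ _ b1) (sqmeanB _ bH (bmeas_cst H0)).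
  rewrite (sqmeanB _ bprof (bmeas_cst J0)) EH ES (sqmean_cst q.+2 J0) (sqmean_cst q.+2 H0).
  by move: (sqmean _ _) => X; ring.
rewrite -(sqmeanZ _ _ bWw); apply: sqmean_le.
- exact: (bmeasB b2 (bmeasZ _ b1)).
- exact: bmeasZ bWw.
move=> t /andP[_ t1]; have := hd (W t) (le_trans (cut_dist t1) ed).
by rewrite /deficit -/s0 [_ / s0]mulrC.
Qed.

(** Expanding the power at J1, the section volume of the uncut ball of squared slope A:
the linear term compares the mean of S with J0, and the quadratic one is at most
the largest loss of a section times the mean loss. *)
Lemma cut_smaller k d K1 K2 K3 : 0 < k -> 2 * w0 * e ^+ 2 <= d ->
  sqmean q.+2 (capprof q.+3 A 0 (A / m)) = H0 ->
  (forall w, `|w - w0| <= d -> deficit q w0 w <= - k * (w - w0) ^+ 2) ->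
  sqmean q.+1 (tail e) <= K1 -> sqmean q.+2 (tail e) <= K2 -> K2 <= 2^-1 ->
  0 <= K3 <= sqmean q.+2 (tail (e / 2)) -> K3 <= 2^-1 ->
  N * (L' * e ^+ 2 * K1) * (L' * e ^+ 2 * K2) < J0 * k * ((w0 / 8 * e ^+ 2) ^+ 2 * K3) ->
  sqmean q.+2 (fun t => S t ^+ q.+3) < J0 ^+ q.+3.
Proof.
move=> k0 ed EH hd T1 T2 K22 /andP[K30 T3] K32 key.
have defm := deficit_mean k0 ed EH hd.
have varm := var_ge (le_trans T2 K22) T3 K32.
have J01 : J0 <= J1 by apply: (conecap_anti q A0); case/andP: AI.
have J10 : 0 < J1 by exact: lt_le_trans J01.
pose D t := J1 - S t.
have bD : bmeas D by exact: (bmeasB (bmeas_cst J1) bS).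
have ED : sqmean q.+2 D = J1 - sqmean q.+2 S by rewrite (sqmeanB _ (bmeas_cst J1) bS) (sqmean_cst q.+2 J1).
have S0 t : 0 <= S t by apply: sqmean_ge0 => v _; exact: prof0.
have D0 t : 0 <= D t by rewrite subr_ge0; exact: slice_le.
have c1 : 0 <= J1 ^+ q.+1 by exact: exprn_ge0 (ltW J10).
pose M := L' * e ^+ 2 * K1.
have b1 := bmeasB (bmeas_cst (J1 ^+ q.+3)) (bmeasZ (N * J1 ^+ q.+2) bD).
have b2 := bmeasZ (N ^+ 2 * J1 ^+ q.+1 * M) bD.
apply: le_lt_trans (sqmean_le q.+2 (bmeasX q.+3 bS) (bmeasD b1 b2) _) _.
  move=> t t01 /=.
  have DJ : 0 <= D t <= J1 by apply/andP; split; [exact: D0|rewrite /D lerBlDl lerDr; exact: S0].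
  have := exprn_sub_le q.+1 DJ; rewrite (_ : J1 - D t = S t); last by rewrite /D; ring.
  move=> h; apply: le_trans h _; rewrite -/N lerD2l -[leRHS]mulrA.
  apply: ler_wpM2l; first by apply: mulr_ge0; [exact: sqr_ge0|exact: c1].
  by rewrite expr2; apply: ler_wpM2r; [exact: D0|exact: slice_ge].
rewrite (sqmeanD _ b1 b2) (sqmeanB _ (bmeas_cst _) (bmeasZ _ bD)) (sqmean_cst q.+2) (sqmeanZ _ _ bD) (sqmeanZ _ _ bD).
apply: lt_le_trans (exprn_ge_tangent q.+2 (ltW J10) (ltW J00)).
have EDle : sqmean q.+2 D <= L' * e ^+ 2 * K2 by rewrite ED; exact: mean_ge.
have ED0 : 0 <= sqmean q.+2 D by apply: sqmean_ge0.
have M0 : 0 <= M by apply: (le_trans (D0 0)); apply: slice_ge T1; rewrite lexx ler01.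
have MED : N * M * sqmean q.+2 D <= N * M * (L' * e ^+ 2 * K2) by apply: ler_wpM2l => //; exact: mulr_ge0 (ltW N0) M0.
pose c := (w0 / 8 * e ^+ 2) ^+ 2 * K3.
have gap : J1 - J0 - sqmean q.+2 D <= - (k * c).
  rewrite ED (_ : J1 - J0 - (J1 - sqmean q.+2 S) = sqmean q.+2 S - J0).
    by apply: le_trans defm _; rewrite mulNr lerN2; apply: ler_wpM2l; [exact: ltW|exact: varm].
  by move: (sqmean _ _) => X; ring.
have c0 : 0 <= k * c.
  by apply: mulr_ge0; [exact: ltW|apply: mulr_ge0 => //; exact: sqr_ge0].
have fin : J1 * (J1 - J0 - sqmean q.+2 D) + N * M * sqmean q.+2 D < 0.
  apply: le_lt_trans (lerD (ler_wpM2l (ltW J10) gap) MED) _.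
  rewrite mulrN addrC subr_lt0; apply: lt_le_trans key _.
  by rewrite -(mulrA J0 k) ler_wpM2r.
have : N * J1 ^+ q.+1 * (J1 * (J1 - J0 - sqmean q.+2 D) + N * M * sqmean q.+2 D) < 0.
  by rewrite pmulr_rlt0//; exact: mulr_gt0 N0 (exprn_gt0 _ J10).
move=> h; rewrite -subr_lt0; apply: le_lt_trans h; rewrite -/N (exprS J1 q.+1).
move: (J1 ^+ q.+1) (J1 ^+ q.+3) (sqmean _ _) => X Y Z.
by rewrite le_eqVlt; apply/orP; left; apply/eqP; ring.
Qed.

End fixed_cut.

Lemma cut_ball_smaller : exists A B, [/\ 0 < A, 0 <= B,
  sqmean q.+2 (capprof q.+3 A 0 B) = conecap q.+3 w0 &
  sqmean q.+2 (fun t => slice_mean q.+1 (capprof q.+2 A 0 B) t ^+ q.+3) < conecap q.+2 w0 ^+ q.+3].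
Proof.
have [k [d [k0 d0 hd]]] := deficit_le q w00.
have [k1 [K1 [_ K10 T1]]] := sqmean_tail q.
have [k2 [K2 [k20 K20 T2]]] := sqmean_tail q.+1.
pose kap : R := Num.min 2^-1 (k2 * 2^-1 ^+ q.+2).
have kap0 : 0 < kap.
  by rewrite lt_min invr_gt0 ltr0n; apply: mulr_gt0 => //; rewrite exprn_gt0// invr_gt0.
pose C1 := N * L' ^+ 2 * K1 * K2.
pose C2 := J0 * k * ((w0 / 8) ^+ 2 * kap).
have C10 : 0 < C1.
  by apply: mulr_gt0 K20; apply: mulr_gt0 K10; exact: mulr_gt0 N0 (exprn_gt0 _ L'0).
have C20 : 0 < C2.
  apply: mulr_gt0; first exact: mulr_gt0.
  by apply: mulr_gt0 kap0; rewrite exprn_gt0// divr_gt0.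
pose e := Num.min (Num.min 2^-1 (d / (2 * w0))) (Num.min (2 * K2)^-1 (C2 / (2 * C1))).
have e0 : 0 < e.
  have h1 : 0 < d / (2 * w0) by apply: divr_gt0 => //; exact: mulr_gt0.
  have h2 : 0 < (2 * K2)^-1 by rewrite invr_gt0; exact: mulr_gt0.
  have h3 : 0 < C2 / (2 * C1) by apply: divr_gt0 => //; exact: mulr_gt0.
  by rewrite !lt_min h1 h2 h3 invr_gt0 ltr0n.
have : e <= e by [].
rewrite {2}/e !le_min => /andP[/andP[e2 ed] /andP[eK eC]].
clearbody e.
rewrite ler_pdivlMr ?mulr_gt0// in ed.
rewrite -div1r ler_pdivlMr ?mulr_gt0// in eK.
rewrite ler_pdivlMr ?mulr_gt0// in eC.
have e1 : e <= 1 by apply: le_trans e2 _; rewrite invf_le1// ler1n.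
have e01 : 0 < e <= 2^-1 by rewrite e0.
have epow p : e ^+ p.+1 <= e.
  by rewrite exprS ler_piMr ?(ltW e0)// exprn_ile1// ltW.
have [A AI EH] := cut_exists e01.
have A0 : 0 < A.
  case/andP: AI => h _; apply: lt_le_trans h; apply: mulr_gt0 => //.
  by have := epow 1%N; lra.
exists A, (A / (1 - e ^+ 2)); split => //.
  apply: divr_ge0; first exact: ltW.
  by have := epow 1%N; lra.
have e201 : 0 < e / 2 <= 2^-1 by rewrite divr_gt0//=; lra.
have [/andP[_ t1] /andP[_ t2] /andP[t3 _]] := And3 (T1 e e01) (T2 e e01) (T2 (e / 2) e201).
have kap2 : kap <= 2^-1 by rewrite ge_min lexx.
have kapk : kap <= k2 * 2^-1 ^+ q.+2 by rewrite ge_min lexx orbT.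
apply: (@cut_smaller e e01 A AI k d _ _ (kap * e ^+ q.+2) k0 _ EH hd t1 t2).
- apply: le_trans ed; rewrite [leRHS]mulrC; apply: ler_wpM2l; last exact: (epow 1%N).
  by rewrite mulr_ge0// ltW.
- apply: le_trans (ler_wpM2l (ltW K20) (epow q.+1)) _.
  by rewrite -(ler_pM2l (ltr0Sn R 1)) mulfV ?pnatr_eq0// mulrA mulrC.
- rewrite mulr_ge0 ?exprn_ge0 ?(ltW kap0) ?(ltW e0)//=; apply: le_trans t3.
  by rewrite exprMn (mulrC (e ^+ q.+2)) (mulrA k2) ler_pM2r ?exprn_gt0.
- apply: le_trans kap2; rewrite -[leRHS]mulr1 ler_wpM2l ?(ltW kap0)//.
  exact: le_trans (epow _) e1.
have X0 : 0 < e ^+ 4 * e ^+ q.+2 by rewrite mulr_gt0// exprn_gt0.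
have -> : N * (L' * e ^+ 2 * (K1 * e ^+ q.+1)) * (L' * e ^+ 2 * (K2 * e ^+ q.+2)) =
   C1 * e ^+ q.+1 * (e ^+ 4 * e ^+ q.+2).
  by rewrite /C1; move: (e ^+ q.+1) (e ^+ q.+2) => a b; ring.
have -> : J0 * k * ((w0 / 8 * e ^+ 2) ^+ 2 * (kap * e ^+ q.+2)) = C2 * (e ^+ 4 * e ^+ q.+2).
  by rewrite /C2; move: (e ^+ q.+2) => b; ring.
(* The factor e ^+ q.+1 is the ratio theta ^ (n - 2) of the two effects. *)
rewrite ltr_pM2r//; apply: le_lt_trans (ler_wpM2l (ltW C10) (epow q)) _.
by apply: lt_le_trans eC; rewrite mulrCA (mulrC e) -[ltLHS]mul1r ltr_pM2r ?mulr_gt0// ltr1n.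
Qed.

End smaller.

End cut.

(** * The ball is not extremal *)

Theorem theorem6p1 (R : realType) (n : nat) (r : R)
    (hn : (3 <= n)%N) (hr : 0 < r < pi / 2) :
  let B : set 'rV[R]_(1 + n) := @centered_ball R n r in
  let admissible (K : set 'rV[R]_(1 + n)) :=
    [/\ convex_body K, origin_symmetric K & vol K = vol B] in
  ~ (forall K, admissible K ->
       (section_integral B <= section_integral K)%E) /\
  ~ (forall K, admissible K ->
       (section_integral K <= section_integral B)%E).
Proof.
case: n hn => [//|[//|[//|k]]] _ B admissible.
pose w0 : R := cos r ^+ 2 / sin r ^+ 2.
have w00 : 0 < w0.
  case/andP: hr => r0 r2; have pi0 := pi_gt0 R.
  rewrite divr_gt0// exprn_gt0//; first by apply: cos_gt0_pihalf; rewrite (lt_trans _ r0)//; lra.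
  by apply: sin_gt0_pi; rewrite r0 /=; lra.
have BE : B = @qbody R k.+2 w0 w0 0 by exact: centered_ballE.
have ball p t : capprof p w0 w0 0 t = conecap p w0.
  by rewrite /capprof /qprofile mul0r addr0 maxxx.
have ballS t : slice_mean k.+1 (capprof k.+2 w0 w0 0) t = conecap k.+2 w0.
  by rewrite -[RHS](sqmean_cst k.+1); apply: eq_Ex => v _; exact: ball.
have volB : vol B = (@sphere_mass R k.+3 * conecap k.+3 w0)%:E.
  rewrite BE vol_qbodyE//; congr (_ * _)%:E.
  by rewrite -[RHS](sqmean_cst k.+2); apply: eq_Ex => t _; exact: ball.
pose mass : R := @sphere_mass R k.+3 * @sphere_mass R k.+2 ^+ k.+3.
have mass0 : 0 < mass.
  by apply: mulr_gt0; [exact: sphere_mass_gt0|apply: exprn_gt0; exact: sphere_mass_gt0].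
have secB : section_integral B = (mass * conecap k.+2 w0 ^+ k.+3)%:E.
  rewrite BE section_integral_qbodyE//; congr (_ * _)%:E.
  by rewrite -[RHS](sqmean_cst k.+2); apply: eq_Ex => t _; rewrite ballS.
have adm A A' b : 0 < A -> 0 <= A' -> 0 <= b ->
    sqmean k.+2 (capprof k.+3 A A' b) = conecap k.+3 w0 -> admissible (@qbody R k.+2 A A' b).
  move=> A0 A'0 b0 E; split; [exact: qbody_convex_body|exact: qbody_symmetric|].
  by rewrite vol_qbodyE// E volB.
split=> opt.
  have [A [b [A0 b0 EV lt]]] := cut_ball_smaller k w00.
  have := opt _ (adm A 0 b A0 (lexx 0) b0 EV).
  by rewrite secB section_integral_qbodyE// lee_fin ler_pM2l// leNgt lt.
have [A [b [A0 b0 EV lt]]] := ellipsoid_larger k w00.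
have := opt _ (adm A A b A0 (ltW A0) b0 EV).
by rewrite secB section_integral_qbodyE// lee_fin ler_pM2l// leNgt lt.
Qed.
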